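(* Under the standing assumptions below, for every $p\in[1,\infty[$ one has $f\in L^p(d\mu)$, where $f(u)=\chi(\|u\|_{L^2(\Theta)})\exp(-\int_\Theta V(u))$. Moreover, fix $\sigma\in[s,1/2[$. Then for every open set $U$ of $H^\sigma_{rad}(\Theta)$, $$\rho(U)\le\liminf_{N\to\infty}\rho_N(U\cap E_N),$$ and for every closed set $F$ of $H^\sigma_{rad}(\Theta)$, $$\rho(F)\ge\limsup_{N\to\infty}\rho_N(F\cap E_N).$$
   Context: Let $\Theta$ be the open unit disc of $\mathbb R^2$; radial functions depend only on $r=|x|$. Let $0<z_1<z_2<\cdots$ be the positive zeros of $J_0$ and $e_n(r)=J_0(z_nr)/\|J_0(z_n|\cdot|)\|_{L^2(\Theta)}$ (orthonormal basis of radial $L^2(\Theta)$, Dirichlet eigenfunctions of $-\Delta$ with eigenvalues $z_n^2$). $H^\sigma_{rad}(\Theta)$: radial $u=\sum a_ne_n$ with $\|u\|_{H^\sigma(\Theta)}^2=\sum z_n^{2\sigma}|a_n|^2<\infty$. $S_N$ = orthogonal projection onto $E_N=\mathrm{span}(e_1,\dots,e_N)$. $V:\mathbb C\to\mathbb R$ is $C^\infty$, $V(z)=G(|z|^2)$ with $G$ smooth, (i) there is $\alpha\in]0,4[$ such that for all $k_1,k_2$ there is $C$ with $|\partial^{k_1}\bar\partial^{k_2}V(z)|\le C(1+|z|)^{2+\alpha-k_1-k_2}$; (ii) there are $C>0$, $\beta\in[2,4[$ with $V(z)\ge-C(1+|z|)^\beta$. Fix $s$ with $\max(\frac13,1-\frac2\alpha,1-\frac2\beta)<s<\frac12$.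 $\chi:\mathbb R\to[0,\infty[$ is continuous with compact support. $(g_n)$ i.i.d. complex Gaussians $g_n=(h_n+il_n)/\sqrt2$ on $(\Omega,\mathcal F,p)$; $\varphi_N=\sum_{n\le N}\frac{g_n}{z_n}e_n$, $\varphi=\lim\varphi_N$ in $L^2(\Omega;H^s_{rad})$; $\mu$ = law of $\varphi$ on $H^s_{rad}(\Theta)$. The Gibbs measure is $d\rho(u)=\chi(\|u\|_{L^2(\Theta)})\exp(-\int_\Theta V(u))\,d\mu(u)$. Set $f_N(u)=\chi(\|S_N(u)\|_{L^2(\Theta)})\exp(-\int_\Theta V(S_N(u)))$; $\rho_N$ is the measure on $E_N$ given by $\rho_N(B)=\int_{\{u:S_N(u)\in B\}}f_N\,d\mu$ for Borel $B\subset E_N$. *)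

(* Defs.v *)
From HB Require Import structures.
From mathcomp Require Import all_boot all_order all_algebra.
From mathcomp Require Import all_classical all_reals all_analysis.
Import Order.TTheory GRing.Theory Num.Theory.
Import numFieldNormedType.Exports.

Set Implicit Arguments.
Unset Strict Implicit.
Unset Printing Implicit Defensive.

Local Open Scope classical_set_scope.
Local Open Scope ring_scope.

(* Conventions:
   - the plane R^2 is [R * R]; complex numbers are pairs [(Re, Im) : R * R];
   - functions on the disc are [u : R * R -> R * R] (complex valued);
   - indices are shifted: [z 0] is the paper's z_1, [e z 0] is e_1, etc. *)

Section Defs.
Variable R : realType.

Definition Theta : set (R * R) := [set x | x.1 ^+ 2 + x.2 ^+ 2 < 1].

Definition cmod (x : R * R) : R := Num.sqrt (x.1 ^+ 2 + x.2 ^+ 2).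

Definition leb2 := (@lebesgue_measure R \x @lebesgue_measure R)%E.

Definition J0 (x : R) : R :=
  limn (series (fun k : nat => (-1) ^+ k * (x / 2) ^+ (2 * k) / (k`!%:R) ^+ 2)).

Definition J0_zeros (z : nat -> R) : Prop :=
  [/\ (forall n, 0 < z n), (forall n, z n < z n.+1), (forall n, J0 (z n) = 0)
    & (forall x, 0 < x -> J0 x = 0 -> exists n, z n = x)].

Definition e (z : nat -> R) (n : nat) (x : R * R) : R :=
  J0 (z n * cmod x) /
  Num.sqrt (Rintegral leb2 Theta (fun y => J0 (z n * cmod y) ^+ 2)).

Definition coef (z : nat -> R) (n : nat) (u : R * R -> R * R) : R * R :=
  (Rintegral leb2 Theta (fun x => (u x).1 * e z n x),
   Rintegral leb2 Theta (fun x => (u x).2 * e z n x)).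

Definition Hnorm2 (z : nat -> R) (sigma : R) (u : R * R -> R * R) : \bar R :=
  (\sum_(0 <= n <oo) ((z n) `^ (2 * sigma) * cmod (coef z n u) ^+ 2)%:E)%E.

Definition Hnorm (z : nat -> R) (sigma : R) (u : R * R -> R * R) : R :=
  Num.sqrt (fine (Hnorm2 z sigma u)).

Definition L2norm (u : R * R -> R * R) : R :=
  Num.sqrt (Rintegral leb2 Theta (fun x => cmod (u x) ^+ 2)).

Definition radial (u : R * R -> R * R) : Prop :=
  forall x y, Theta x -> Theta y -> cmod x = cmod y -> u x = u y.

Definition Hrad (z : nat -> R) (sigma : R) : set (R * R -> R * R) :=
  [set u | [/\ measurable_fun Theta u, radial u,
     (\int[leb2]_(x in Theta) (cmod (u x) ^+ 2)%:E < +oo)%E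
     & (Hnorm2 z sigma u < +oo)%E]].

Definition openH (z : nat -> R) (sigma : R) (U : set (R * R -> R * R)) : Prop :=
  U `<=` Hrad z sigma /\
  forall u, U u -> exists2 eps : R, 0 < eps &
    forall v, Hrad z sigma v -> Hnorm z sigma (fun x => u x - v x) < eps -> U v.

Definition closedH (z : nat -> R) (sigma : R) (F : set (R * R -> R * R)) : Prop :=
  F `<=` Hrad z sigma /\ openH z sigma (Hrad z sigma `\` F).

Definition SN (z : nat -> R) (N : nat) (u : R * R -> R * R) : R * R -> R * R :=
  fun x => (\sum_(n < N) (coef z n u).1 * e z n x,
            \sum_(n < N) (coef z n u).2 * e z n x).

Definition EN (z : nat -> R) (N : nat) : set (R * R -> R * R) :=
  [set v | exists c : nat -> R * R,
     v = fun x => (\sum_(n < N) (c n).1 * e z n x, \sum_(n < N) (c n).2 * e z n x)].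

Definition fdens (chi : R -> R) (V : R * R -> R) (u : R * R -> R * R) : R :=
  chi (L2norm u) * expR (- Rintegral leb2 Theta (fun x => V (u x))).

(* Wirtinger derivatives of a complex valued function on C = R^2 *)
Definition dz (F : R * R -> R * R) : R * R -> R * R :=
  fun x => let a : R * R := 'D_((1, 0) : R * R) F x in
           let b : R * R := 'D_((0, 1) : R * R) F x in
           ((a.1 + b.2) / 2, (a.2 - b.1) / 2).
Definition dzb (F : R * R -> R * R) : R * R -> R * R :=
  fun x => let a : R * R := 'D_((1, 0) : R * R) F x in
           let b : R * R := 'D_((0, 1) : R * R) F x in
           ((a.1 - b.2) / 2, (a.2 + b.1) / 2).
Definition wirt (k1 k2 : nat) (V : R * R -> R) : R * R -> R * R :=
  iter k1 dz (iter k2 dzb (fun x => (V x, 0))).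

Definition smooth2 (V : R * R -> R) : Prop :=
  forall (ds : seq (R * R)) (x : R * R),
    differentiable (foldr (fun d g => ('D_d g : R * R -> R)) V ds) x.

Definition smooth1 (G : R -> R) : Prop :=
  forall (n : nat) (x : R), derivable (iter n (fun g : R -> R => derive1 g) G) x 1.

Definition mutually_independent (d : measure_display) (T : measurableType d)
  (P : probability T R) (I : eqType) (X : I -> T -> R) : Prop :=
  forall (J : seq I) (B : I -> set R), uniq J -> (forall i, measurable (B i)) ->
    P (\bigcap_(i in [set` J]) (X i @^-1` B i)) = (\prod_(i <- J) P (X i @^-1` B i))%E.

Definition iid_std_gaussians (d : measure_display) (T : measurableType d)
  (P : probability T R) (h l : nat -> T -> R) : Prop :=
  let X := fun i : bool * nat => if i.1 then h i.2 else l i.2 in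
  [/\ (forall i, measurable_fun setT (X i)),
      (forall i B, measurable B -> P (X i @^-1` B) = normal_prob 0 1 B)
    & mutually_independent P X].

(* phi_N = sum_{n <= N} g_n / z_n e_n, with g_n = (h_n + i l_n)/sqrt 2 *)
Definition phiN (T : Type) (z : nat -> R) (h l : nat -> T -> R) (N : nat) (w : T)
  : R * R -> R * R :=
  fun x => (\sum_(n < N) h n w / (Num.sqrt 2 * z n) * e z n x,
            \sum_(n < N) l n w / (Num.sqrt 2 * z n) * e z n x).

(* phi = lim phi_N (representative: pointwise limit where it exists, 0 elsewhere) *)
Definition phi (T : Type) (z : nat -> R) (h l : nat -> T -> R) (w : T)
  : R * R -> R * R :=
  fun x => let a := fun N => (phiN z h l N w x).1 in
           let b := fun N => (phiN z h l N w x).2 in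
           if `[< cvgn a >] && `[< cvgn b >] then (limn a, limn b) else (0, 0).

(* rho(B) = int_B f dmu, mu = law of phi *)
Definition rho (d : measure_display) (T : measurableType d) (P : probability T R)
  (z : nat -> R) (h l : nat -> T -> R) (chi : R -> R) (V : R * R -> R)
  (B : set (R * R -> R * R)) : \bar R :=
  (\int[P]_(w in [set w | B (phi z h l w)]) (fdens chi V (phi z h l w))%:E)%E.

Definition rhoN (d : measure_display) (T : measurableType d) (P : probability T R)
  (z : nat -> R) (h l : nat -> T -> R) (chi : R -> R) (V : R * R -> R)
  (N : nat) (B : set (R * R -> R * R)) : \bar R :=
  (\int[P]_(w in [set w | B (SN z N (phi z h l w))])
      (fdens chi V (SN z N (phi z h l w)))%:E)%E.

End Defs.

(* Main.v *)
(** With b = max(beta, 3) < 4, assumption (ii) reduces the L^p bounds on the densities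
    f_N to an exponential moment of the b-th power of the L^b norm of phi_N, restricted
    to a ball of L^2.  Split the series at the frequency L.  On the L^2 ball the low
    modes are O(L) in sup norm, so they contribute O(L^(b-2)) to the integral of
    |phi_N|^b.  The high modes form a Gaussian of variance O(1/(L|x|)), because
    |e_n(x)|^2 <= C/|x| and z_n >= c n, so they contribute more than L^(b-2) with
    probability at most C exp(-c L^(3-4/b)).  Since b < 4, 3 - 4/b > b - 2, and summing
    over the levels L gives a bound uniform in N.

    Almost surely phi_N converges pointwise with an integrable majorant of its 8th power
    (summation by parts against independent Gaussians), whence S_N phi = phi_N and, V
    being of growth 2 + alpha < 8, f_N(phi) -> f(phi).  Fatou's lemma gives f in L^p and
    the inequality for open sets.  The bound in L^2 makes the f_N uniformly integrable,
    which gives the inequality for closed sets. *)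
Require Import Defs.
From HB Require Import structures.
From mathcomp Require Import all_boot all_order all_algebra.
From mathcomp Require Import all_classical all_reals all_analysis.
From mathcomp Require Import measurable_realfun.
From mathcomp Require Import ring lra.
Import Order.TTheory GRing.Theory Num.Theory.
Import numFieldNormedType.Exports.
Set Implicit Arguments.
Unset Strict Implicit.
Unset Printing Implicit Defensive.
Local Open Scope classical_set_scope.
Local Open Scope ring_scope.

(** * The Bessel function of order zero *)

Section Bessel.
Variable R : realType.
Implicit Types (x t : R) (c : nat -> R).

(** The exponents come from balancing the two halves of the split. A Gaussian field of standard
    deviation (L|x|)^(-1/2) brings the integral up to L^(b-2) only if the normalised Gaussian is of
    order L^(3/2-2/b), which costs exp(-c L^(3-4/b)); the margin 3-4/b-(b-2) equals (b-1)(4-b)/b.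
    The same threshold b < 4 makes |x|^(-b/2) integrable on the disc. All information on J0 is drawn
    from its differential equation by energy arguments, without asymptotic expansions: decay,
    spacing of the zeros and size of the normalising constants. The variable |x|^2 takes the place
    of polar coordinates, because the area of a disc is linear in it. Eighth powers are used for the
    pointwise convergence because 8 > 2 + alpha and because Jensen for squares, applied three times,
    reaches them. The bound |e_n|^2 <= C/|x| alone would then produce |x|^(-4), which is not
    integrable; interpolation with |e_n|^2 <= C z_n brings this down to |x|^(-8/5) at an affordable
    price in n. *)

Definition bessel_coeff (k : nat) : R := (-1) ^+ k / (k`!%:R) ^+ 2.

(* J0 x = besselK (x ^+ 2 / 4), and besselK is entire. *)
Definition besselK t : R := limn (pseries bessel_coeff t).
Definition besselK1 t : R := limn (pseries (pseries_diffs bessel_coeff) t).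
Definition besselK2 t : R :=
  limn (pseries (pseries_diffs (pseries_diffs bessel_coeff)) t).

Lemma fact_neq0 k : k`!%:R != 0 :> R.
Proof. by rewrite pnatr_eq0 -lt0n fact_gt0. Qed.

(** Domination by the exponential series; it makes [besselK] and its formal derivatives entire. *)
Lemma is_cvg_pseries_le_inv_fact c x :
  (forall k, `|c k| <= (k`!%:R)^-1) -> cvgn (pseries c x).
Proof.
move=> ck; apply: normed_cvg.
apply: (@series_le_cvg _ _ (exp_coeff `|x|)).
- by move=> n /=.
- by move=> n; exact: exp_coeff_ge0.
- move=> n /=; rewrite normrM normrX /exp_coeff /= mulrC.
  by rewrite ler_wpM2l// exprn_ge0.
- exact: is_cvg_series_exp_coeff.
Qed.

Lemma bessel_coeff_le k : `|bessel_coeff k| <= (k`!%:R)^-1.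
Proof.
rewrite /bessel_coeff normrM normrX normrN1 expr1n mul1r ger0_norm; last first.
  by rewrite invr_ge0 exprn_ge0.
rewrite lef_pV2 ?posrE ?exprn_gt0 ?ltr0n ?fact_gt0//.
by rewrite expr2 ler_peMl// ler1n fact_gt0.
Qed.

(** This recursion is the Bessel equation read on coefficients. It also shows that formal
    differentiation does not increase the coefficients in absolute value. *)
Lemma bessel_coeffS k : bessel_coeff k = - (k.+1%:R ^+ 2 * bessel_coeff k.+1).
Proof.
have := fact_neq0 k; have : k.+1%:R != 0 :> R by rewrite pnatr_eq0.
rewrite /bessel_coeff factS natrM (exprS (-1)).
by move: (k.+1%:R) (k`!%:R) ((-1) ^+ k) => a b s a0 b0; field; rewrite ?a0 ?b0.
Qed.

Lemma norm_pseries_diffs c k : `|pseries_diffs c k| = k.+1%:R * `|c k.+1|.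
Proof. by rewrite /pseries_diffs normrM ger0_norm. Qed.

Lemma norm_bessel_coeffS k :
  `|bessel_coeff k| = k.+1%:R ^+ 2 * `|bessel_coeff k.+1|.
Proof. by rewrite bessel_coeffS normrN normrM ger0_norm ?exprn_ge0. Qed.

Lemma bessel_coeff1_le k : `|pseries_diffs bessel_coeff k| <= (k`!%:R)^-1.
Proof.
apply: le_trans (bessel_coeff_le k); rewrite norm_pseries_diffs.
rewrite (norm_bessel_coeffS k) ler_wpM2r// expr2 ler_peMl// ler1n//.
Qed.

Lemma bessel_coeff2_le k :
  `|pseries_diffs (pseries_diffs bessel_coeff) k| <= (k`!%:R)^-1.
Proof.
apply: le_trans (bessel_coeff1_le k); rewrite !norm_pseries_diffs ler_wpM2l//.
by rewrite (norm_bessel_coeffS k.+1) ler_wpM2r// expr2 ler_peMl// ler1n.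
Qed.

Lemma bessel_coeff3_le k :
  `|pseries_diffs (pseries_diffs (pseries_diffs bessel_coeff)) k| <= (k`!%:R)^-1.
Proof.
apply: le_trans (bessel_coeff1_le k); rewrite !norm_pseries_diffs ler_wpM2l//.
rewrite (norm_bessel_coeffS k.+1) (norm_bessel_coeffS k.+2) mulrA mulrA.
rewrite ler_wpM2r// [leRHS]mulrC expr2 -mulrA ler_pM//.
  by rewrite ler_nat.
by rewrite expr2 ler_peMr// ?mulr_ge0// -natrM ler1n muln_gt0.
Qed.

Lemma is_derive_besselK t : is_derive t 1 besselK (besselK1 t).
Proof.
apply: (@pseries_snd_diffs _ _ (`|t| + 1)).
- exact/is_cvg_pseries_le_inv_fact/bessel_coeff_le.
- exact/is_cvg_pseries_le_inv_fact/bessel_coeff1_le.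
- exact/is_cvg_pseries_le_inv_fact/bessel_coeff2_le.
- by rewrite [ltRHS]ger0_norm ?addr_ge0// ltrDl.
Qed.

Lemma is_derive_besselK1 t : is_derive t 1 besselK1 (besselK2 t).
Proof.
apply: (@pseries_snd_diffs _ _ (`|t| + 1)).
- exact/is_cvg_pseries_le_inv_fact/bessel_coeff1_le.
- exact/is_cvg_pseries_le_inv_fact/bessel_coeff2_le.
- exact/is_cvg_pseries_le_inv_fact/bessel_coeff3_le.
- by rewrite [ltRHS]ger0_norm ?addr_ge0// ltrDl.
Qed.

Lemma besselK_ode t : t * besselK2 t + besselK1 t + besselK t = 0.
Proof.
have C0 : pseries bessel_coeff t @ \oo --> besselK t.
  exact/is_cvg_pseries_le_inv_fact/bessel_coeff_le.
have C1 : pseries (pseries_diffs bessel_coeff) t @ \oo --> besselK1 t.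
  exact/is_cvg_pseries_le_inv_fact/bessel_coeff1_le.
have C2 : pseries (pseries_diffs (pseries_diffs bessel_coeff)) t @ \oo
    --> besselK2 t.
  exact/is_cvg_pseries_le_inv_fact/bessel_coeff2_le.
(* Two of the truncations are one term longer, so that the three polynomials cover the same degrees.
   Their combination then vanishes for every n, not only in the limit. *)
have C0' : [sequence pseries bessel_coeff t n.+1]_n @ \oo --> besselK t.
  by rewrite cvg_shiftS.
have C1' : [sequence pseries (pseries_diffs bessel_coeff) t n.+1]_n @ \oo
    --> besselK1 t by rewrite cvg_shiftS.
have Ct : (fun _ : nat => t) @ \oo --> t by exact: cvg_cst.
have C : (fun n => t * pseries (pseries_diffs (pseries_diffs bessel_coeff)) t n
    + pseries (pseries_diffs bessel_coeff) t n.+1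
    + pseries bessel_coeff t n.+1) @ \oo -->
    t * besselK2 t + besselK1 t + besselK t.
  by apply: cvgD C0'; apply: cvgD C1'; apply: cvgM.
rewrite -[LHS](cvg_lim _ C)//.
rewrite (_ : (fun _ => _) = (fun=> 0)); first exact: lim_cst.
apply/funext => n; rewrite /pseries /series /=.
elim: n => [|n IHn].
  rewrite !big_nat1 big_nil mulr0 add0r !expr0 !mulr1 /pseries_diffs mul1r.
  by rewrite (bessel_coeffS 0) expr1n mul1r subrr.
rewrite (big_nat_recr n)//= (big_nat_recr n.+1)//= (big_nat_recr n.+1)//=.
have E : t * (pseries_diffs (pseries_diffs bessel_coeff) n * t ^+ n) +
    pseries_diffs bessel_coeff n.+1 * t ^+ n.+1 +
    bessel_coeff n.+1 * t ^+ n.+1 = 0.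
  rewrite /pseries_diffs (bessel_coeffS n.+1) -!natr1 exprS; ring.
move: IHn E; move: (\sum_(_ <= _ < _) _) (\sum_(_ <= _ < _) _).
move=> A B; move: (\sum_(_ <= _ < _) _) (_ * t ^+ n) => C' a.
move: (_ * t ^+ n.+1) (_ * t ^+ n.+1) => b c E1 E2.
transitivity ((t * B + A + C') + (t * a + c + b)); first by ring.
by rewrite E1 E2 addr0.
Qed.

Lemma besselK0 : besselK 0 = 1.
Proof.
rewrite /besselK; apply/cvg_lim => //; rewrite -cvg_shiftS.
rewrite (_ : (fun _ => _) = cst 1); first exact: cvg_cst.
apply/funext => n; rewrite /= /pseries /series /= big_nat_recl//= expr0.
rewrite big1 ?addr0; last by move=> i _; rewrite expr0n mulr0.
by rewrite /bessel_coeff expr0 fact0 expr1n invr1 !mulr1.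
Qed.

Lemma J0E x : J0 x = besselK (x ^+ 2 / 4).
Proof.
rewrite /J0 /besselK /pseries; congr (limn (series _)); apply/funext => k.
rewrite /bessel_coeff mulrAC; congr (_ * _); rewrite exprM; congr (_ ^+ _).
by field.
Qed.

End Bessel.

#[global] Opaque besselK besselK1 besselK2.

(** * Energy estimates for the Bessel equation *)

Section BesselDecay.
Variable R : realType.
Implicit Types (x t : R).
Local Notation K := (@besselK R).
Local Notation K1 := (@besselK1 R).

Lemma derive_le_homo (f df : R -> R) (a b : R) : a <= b ->
  (forall x, a <= x <= b -> is_derive x 1 f (df x)) ->
  (forall x, a <= x <= b -> 0 <= df x) -> f a <= f b.
Proof.
move=> ab fd df0.
have [||c] := @MVT_segment _ f df a b ab.
- by move=> x; rewrite in_itv/= => /andP[/ltW ax /ltW xb]; apply: fd; rewrite ax.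
- apply: derivable_within_continuous => x; rewrite in_itv/= => xab.
  by have [] := fd x xab.
- rewrite in_itv/= => cab E; rewrite -subr_ge0 E mulr_ge0 ?subr_ge0//.
  exact: df0.
Qed.

Lemma besselK2E t : t * besselK2 t = - besselK1 t - besselK t.
Proof. by have := besselK_ode t; lra. Qed.

(** By the Bessel equation the left-hand side has derivative - K1^2, and its value at 0 is 1. *)
Lemma besselK_energy t : 0 <= t -> t * K1 t ^+ 2 + K t ^+ 2 <= 1.
Proof.
move=> t0; rewrite -lerN2.
have := @derive_le_homo (fun t => - (t * K1 t ^+ 2 + K t ^+ 2))
  (fun t => K1 t ^+ 2) 0 t t0.
rewrite mul0r add0r besselK0 expr1n; apply => // x _; last exact: sqr_ge0.
have := is_derive_besselK x; have := is_derive_besselK1 x => ? ?.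
apply: is_derive_eq.
rewrite /GRing.scale /=.
transitivity (- (2 * K1 x * (x * besselK2 x) + K1 x ^+ 2 + 2 * (K x * K1 x))).
  by ring.
by rewrite besselK2E; ring.
Qed.

Lemma besselK_sq_le1 t : 0 <= t -> K t ^+ 2 <= 1.
Proof.
move=> t0; apply: le_trans (besselK_energy t0).
by rewrite lerDr mulr_ge0// sqr_ge0.
Qed.

(** Put w(x) = sqrt(x) J0(2x) = sqrt(x) K(x^2). Then w' = 2 besselB / sqrt(x) and w'' + (4 +
    1/(4x^2)) w = 0, and [besselG] below is the energy w^2 + w'^2/4 of this perturbed oscillator. *)
Definition besselB x := K (x ^+ 2) / 4 + x ^+ 2 * K1 (x ^+ 2).

Lemma is_derive_besselKsq x :
  is_derive x 1 (fun x => K (x ^+ 2)) (2 * x * K1 (x ^+ 2)).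
Proof.
have ? := is_derive_besselK (x ^+ 2).
apply: (@is_derive_eq _ _ _ (K \o (fun x => x ^+ 2))).
by rewrite /GRing.scale /=; ring.
Qed.

Lemma is_derive_besselB x :
  is_derive x 1 besselB (2 * x * (K1 (x ^+ 2) / 4 - K (x ^+ 2))).
Proof.
have ? := is_derive_besselKsq x.
have d1 : is_derive x 1 (fun x => K1 (x ^+ 2)) (2 * x * besselK2 (x ^+ 2)).
  have ? := is_derive_besselK1 (x ^+ 2).
  apply: (@is_derive_eq _ _ _ (K1 \o (fun x => x ^+ 2))).
  by rewrite /GRing.scale /=; ring.
have ? : is_derive x 1 (fun x => x ^+ 2) (2 * x).
  by apply: is_derive_eq; rewrite /GRing.scale /=; ring.
have -> : besselB = (fun x => K (x ^+ 2) * 4^-1 + x ^+ 2 * K1 (x ^+ 2)) by [].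
apply: is_derive_eq.
rewrite /GRing.scale /=.
transitivity (2 * x * (K1 (x ^+ 2) / 4 + x ^+ 2 * besselK2 (x ^+ 2)
  + K1 (x ^+ 2))); first by ring.
by rewrite besselK2E; ring.
Qed.

(* As x grows, the pair (besselB x, x K (x^2)) nearly rotates, so besselG is nearly
   constant at infinity; this gives the decay of J0. *)
Definition besselG x := (besselB x ^+ 2 + x ^+ 2 * K (x ^+ 2) ^+ 2) / x.

Lemma is_derive_besselG x : 0 < x ->
  is_derive x 1 besselG (- (K (x ^+ 2) * besselB x) / (4 * x ^+ 2)).
Proof.
move=> x0; have ? := is_derive_besselKsq x; have ? := is_derive_besselB x.
have ? : is_derive x 1 (fun x => x^-1) (- x ^- 2).
  have := @is_deriveV _ id x 1 1 (lt0r_neq0 x0) _.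
  by rewrite /GRing.scale /= mulr1; apply.
rewrite /besselG; apply: is_derive_eq.
rewrite /GRing.scale /=.
rewrite [in RHS]/besselB [in LHS]/besselB.
by field; rewrite gt_eqF.
Qed.

Lemma besselG_ge0 x : 0 < x -> 0 <= besselG x.
Proof.
move=> x0; rewrite divr_ge0 ?(ltW x0)// addr_ge0 ?sqr_ge0//.
by rewrite mulr_ge0 ?sqr_ge0.
Qed.

Lemma besselKB_le x : 0 < x -> `|K (x ^+ 2) * besselB x| <= besselG x / 2.
Proof.
move=> x0; rewrite /besselG; set k := K _; set b := besselB x.
rewrite -mulrA -invfM ler_pdivlMr ?mulr_gt0//.
have -> : `|k * b| * (x * 2) = 2 * `|b| * (x * `|k|) by rewrite normrM; ring.
rewrite -(real_normK (num_real b)) -(real_normK (num_real k)).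
have := sqr_ge0 (`|b| - x * `|k|); nra.
Qed.

(** A two-sided Gronwall argument. The derivative of [besselG] is at most besselG / (8x^2) in
    absolute value, which the derivative of 1/(8x) absorbs; the sign [eps] selects the upper or the
    lower bound. *)
Lemma besselG_exp_homo (eps x y : R) : eps = 1 \/ eps = -1 -> 0 < x -> x <= y ->
  eps * (besselG y * expR (eps / (8 * y))) <=
  eps * (besselG x * expR (eps / (8 * x))).
Proof.
move=> e1 x0 xy; rewrite -lerN2.
pose f := fun x => - (eps * (besselG x * expR (eps / (8 * x)))).
apply: (@derive_le_homo f (fun x =>
  eps * expR (eps / (8 * x)) * (eps * besselG x / (8 * x ^+ 2)
    + K (x ^+ 2) * besselB x / (4 * x ^+ 2))) x y xy) => u /andP[xu uy].
  have u0 : 0 < u := lt_le_trans x0 xu.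
  have ? := is_derive_besselG u0.
  have d1 : is_derive u 1 (fun x => eps / (8 * x)) (- eps / (8 * u ^+ 2)).
    have n8 : 8 * u != 0 by rewrite gt_eqF// mulr_gt0.
    have ? : is_derive u 1 (fun x => (8 * x)^-1) (- (8 * u) ^- 2 * 8).
      apply: (is_derive_eq (is_deriveV n8 _)).
      by rewrite /GRing.scale /=; ring.
    apply: is_derive_eq; rewrite /GRing.scale /=; field.
    by rewrite gt_eqF.
  have d2 : is_derive u 1 (fun x => expR (eps / (8 * x)))
      (expR (eps / (8 * u)) * (- eps / (8 * u ^+ 2))).
    have ? := is_derive_expR (eps / (8 * u)).
    exact: (is_derive1_comp (f := expR)).
  rewrite /f; apply: is_derive_eq; rewrite /GRing.scale /=.
  by field; rewrite gt_eqF.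
have u0 : 0 < u := lt_le_trans x0 xu.
rewrite mulrAC mulr_ge0 ?expR_ge0//.
have /ler_normlP[N1 N2] := besselKB_le u0.
rewrite mulrDr.
have -> : eps * (eps * besselG u / (8 * u ^+ 2)) +
  eps * (K (u ^+ 2) * besselB u / (4 * u ^+ 2)) =
  (eps ^+ 2 * besselG u / 2 + eps * (K (u ^+ 2) * besselB u)) / (4 * u ^+ 2).
  by field; rewrite gt_eqF.
rewrite divr_ge0 ?(mulr_ge0 _ (sqr_ge0 _))//.
by case: e1 => ->; rewrite ?sqrrN expr1n; lra.
Qed.

Lemma besselG_le x y : 0 < x -> x <= y ->
  besselG y <= besselG x * expR (1 / (8 * x)).
Proof.
move=> x0 xy; have y0 : 0 < y := lt_le_trans x0 xy.
have := @besselG_exp_homo 1 x y (or_introl erefl) x0 xy.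
rewrite !(mul1r (besselG _ * _)); apply: le_trans.
 rewrite ler_peMr ?besselG_ge0// -[leLHS]expR0 ler_expR.
by rewrite divr_ge0// mulr_ge0// ltW.
Qed.

Lemma besselG_ge x y : 0 < x -> x <= y ->
  besselG x * expR (-1 / (8 * x)) <= besselG y.
Proof.
move=> x0 xy; have y0 : 0 < y := lt_le_trans x0 xy.
have := @besselG_exp_homo (-1) x y (or_intror erefl) x0 xy.
rewrite !(mulN1r (besselG _ * _)) lerN2 => /le_trans; apply.
rewrite ler_piMr ?besselG_ge0// -[leRHS]expR0 ler_expR mulN1r oppr_le0.
by rewrite invr_ge0// mulr_ge0// ltW.
Qed.

(** By [besselG_ge] a zero of [besselG] at x would spread to all of ]0, x], so K would vanish near
    0, against K(0) = 1. *)
Lemma besselG_gt0 x : 0 < x -> 0 < besselG x.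
Proof.
move=> x0; rewrite lt_neqAle besselG_ge0// andbT eq_sym; apply/eqP => G0.
have K0 y : 0 < y -> y <= x -> K (y ^+ 2) = 0.
  move=> y0 yx; have := besselG_ge y0 yx; rewrite G0 pmulr_lle0 ?expR_gt0//.
  rewrite /besselG pmulr_lle0 ?invr_gt0// => H.
  have : besselB y ^+ 2 + y ^+ 2 * K (y ^+ 2) ^+ 2 == 0.
    by rewrite eq_le H addr_ge0 ?sqr_ge0// mulr_ge0 ?sqr_ge0.
  rewrite paddr_eq0 ?sqr_ge0 ?(mulr_ge0 (sqr_ge0 _) (sqr_ge0 _))// => /andP[_].
  by rewrite mulf_eq0 !expf_eq0/= gt_eqF//= => /eqP.
have C : K (y ^+ 2) @[y --> (0 : R)] --> (1 : R).
  have [/derivable1_diffP/differentiable_continuous + _] := is_derive_besselKsq 0.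
  by rewrite /prop_for /continuous_at /= expr0n/= besselK0.
have /nbhs_ballP[e /= e0 be] : \forall y \near (0 : R), 0 < K (y ^+ 2).
  by apply: (cvgr_gt _ C).
have y0 : 0 < Num.min x (e / 2) by rewrite lt_min x0 divr_gt0.
have := be (Num.min x (e / 2)); rewrite /ball/= sub0r normrN gtr0_norm//.
rewrite K0 ?ge_min ?lexx// ltxx => h; suff : false by []; apply: h.
by rewrite gt_min; apply/orP; right; lra.
Qed.

End BesselDecay.

(** * Integrals of Bessel functions and spacing of the zeros *)

Section BesselZeros.
Variable R : realType.
Implicit Types (x t : R).
Local Notation K := (@besselK R).
Local Notation K1 := (@besselK1 R).
Local Notation mu := (@lebesgue_measure R).

Lemma FTC01 (F f : R -> R) : (forall t, is_derive t 1 F (f t)) ->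
  continuous f -> (\int[mu]_(t in `[0%R, 1%R]) (f t)%:E = (F 1 - F 0)%:E)%E.
Proof.
move=> Ff cf; have cF : continuous F.
  move=> t; apply/differentiable_continuous/derivable1_diffP.
  by have [] := Ff t.
rewrite (@continuous_FTC2 _ f F)//.
- exact: continuous_subspaceT.
- split.
  + by move=> t _; have [] := Ff t.
  + exact/cvg_at_right_filter/cF.
  + exact/cvg_at_left_filter/cF.
- by move=> t _; rewrite derive1E; have [] := Ff t.
Qed.

Lemma is_derive_besselKM l t : is_derive t 1 (fun t => K (l * t)) (l * K1 (l * t)).
Proof.
have ? := is_derive_besselK (l * t).
apply: (@is_derive_eq _ _ _ (K \o (fun t => l * t))).
by rewrite /GRing.scale /=; ring.
Qed.

Lemma is_derive_besselK1M l t :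
  is_derive t 1 (fun t => K1 (l * t)) (l * besselK2 (l * t)).
Proof.
have ? := is_derive_besselK1 (l * t).
apply: (@is_derive_eq _ _ _ (K1 \o (fun t => l * t))).
by rewrite /GRing.scale /=; ring.
Qed.

Lemma continuous_besselKM l : continuous (fun t => K (l * t)).
Proof.
move=> t; apply/differentiable_continuous/derivable1_diffP.
by have [] := is_derive_besselKM l t.
Qed.

(** Lommel's integral: the equation turns the derivative of (t l K1(lt))^2 + l t K(lt)^2 into the
    integrand, and only K1 survives at t = 1. *)
Lemma integral_besselK_sq l : K l = 0 ->
  (\int[mu]_(t in `[0%R, 1%R]) (l * K (l * t) ^+ 2)%:E = ((l * K1 l) ^+ 2)%:E)%E.
Proof.
move=> Kl.
have /FTC01 -> : forall t, is_derive t 1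
    (fun t => (t * (l * K1 (l * t))) ^+ 2 + l * t * K (l * t) ^+ 2)
    (l * K (l * t) ^+ 2).
- move=> t; have ? := is_derive_besselKM l t.
  have ? := is_derive_besselK1M l t.
  apply: is_derive_eq; rewrite /GRing.scale /=.
  transitivity (2 * t * l ^+ 2 * K1 (l * t) *
    (l * t * besselK2 (l * t) + K1 (l * t) + K (l * t)) + l * K (l * t) ^+ 2).
    by ring.
  by rewrite besselK_ode mulr0 add0r.
- by congr EFin; rewrite !mulr1 Kl; ring.
- move=> t; apply: cvgM; first exact: cvg_cst.
  by rewrite expr2; apply: cvgM; exact: continuous_besselKM.
Qed.

(** The Sturm-Liouville argument: t times the Wronskian of K(lt) and K(mt) has derivative (m - l)
    K(lt) K(mt) and vanishes at both ends. *)
Lemma besselK_orthogonal l m : K l = 0 -> K m = 0 -> l != m ->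
  (\int[mu]_(t in `[0%R, 1%R]) (K (l * t) * K (m * t))%:E = 0)%E.
Proof.
move=> Kl Km lm; have lm' : m - l != 0 by rewrite subr_eq0 eq_sym.
have /FTC01 -> : forall t, is_derive t 1
    (fun t => (m - l)^-1 * (t * (l * K1 (l * t) * K (m * t)
      - K (l * t) * (m * K1 (m * t)))))
    (K (l * t) * K (m * t)).
- move=> t; have ? := is_derive_besselKM l t.
  have ? := is_derive_besselK1M l t.
  have ? := is_derive_besselKM m t.
  have ? := is_derive_besselK1M m t.
  apply: is_derive_eq; rewrite /GRing.scale /=.
  transitivity ((m - l)^-1 * ((m - l) * (K (l * t) * K (m * t)) +
    l * K (m * t) * (l * t * besselK2 (l * t) + K1 (l * t) + K (l * t)) -
    m * K (l * t) * (m * t * besselK2 (m * t) + K1 (m * t) + K (m * t)))).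
    by ring.
  by rewrite !besselK_ode !mulr0 subr0 addr0 mulKf.
- by congr EFin; rewrite !mulr1 Kl Km; ring.
- by move=> t; apply: cvgM; exact: continuous_besselKM.
Qed.

End BesselZeros.

Section BesselZeros2.
Variable R : realType.
Implicit Types (x t : R).
Local Notation K := (@besselK R).
Local Notation K1 := (@besselK1 R).
Local Notation mu := (@lebesgue_measure R).

Lemma measurable_fun_continuous (D : set R) (f : R -> R) :
  continuous f -> measurable_fun D f.
Proof. by move=> cf; apply: measurable_funTS; exact: continuous_measurable_fun. Qed.

Lemma J0_sq_le1 x : J0 x ^+ 2 <= 1.
Proof. by rewrite J0E besselK_sq_le1// divr_ge0 ?sqr_ge0. Qed.

Lemma continuous_J0 : continuous (@J0 R).
Proof.
have -> : @J0 R = (fun x => K (4^-1 * x ^+ 2)).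
  by apply/funext => x; rewrite J0E mulrC.
move=> x; apply: (@continuous_comp _ _ _ (fun x => x ^+ 2) (fun t => K (4^-1 * t))).
  exact: exprn_continuous.
exact: continuous_besselKM.
Qed.

Lemma besselKsq_le_G x : 0 < x -> x * K (x ^+ 2) ^+ 2 <= besselG x.
Proof.
move=> x0; rewrite /besselG ler_pdivlMr//.
have -> : x * K (x ^+ 2) ^+ 2 * x = x ^+ 2 * K (x ^+ 2) ^+ 2 by ring.
by rewrite lerDr sqr_ge0.
Qed.

(** With x = 2y, the quantity y J0(x)^2 is at most besselG y, which is controlled by its value at 1
    as soon as y >= 1; for smaller y the bound |J0| <= 1 is enough. *)
Lemma J0_decay : exists2 C : R, 0 < C & forall x, 0 < x -> x * J0 x ^+ 2 <= C.
Proof.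
exists (2 + 2 * (besselG (1 : R) * expR (1 / (8 * 1)))).
  by rewrite ltr_pwDl// mulr_ge0// mulr_ge0 ?expR_ge0// besselG_ge0.
move=> x x0; pose y := x / 2.
have xE : x = 2 * y by rewrite /y; field.
have y0 : 0 < y by rewrite divr_gt0.
have -> : J0 x = K (y ^+ 2) by rewrite J0E /y; congr K; field.
rewrite xE -mulrA.
have G1 := besselG_ge0 (@ltr01 R).
have [y1|y1] := leP 1 y.
  have := besselKsq_le_G y0; have := besselG_le ltr01 y1; lra.
have K1 := besselK_sq_le1 (sqr_ge0 y).
have : y * K (y ^+ 2) ^+ 2 <= 1.
  by rewrite -[leRHS]mulr1 ler_pM ?sqr_ge0 ?(ltW y0) ?(ltW y1).
have : 0 <= besselG 1 * expR (1 / (8 * 1)) :> R by rewrite mulr_ge0 ?expR_ge0.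
lra.
Qed.

Variable z : nat -> R.
Hypothesis Hz : J0_zeros z.

Lemma zeros_gt0 n : 0 < z n. Proof. by case: Hz. Qed.

Lemma zeros_homo m n : (m <= n)%N -> z m <= z n.
Proof.
elim: n => [|n IHn]; first by rewrite leqn0 => /eqP ->.
rewrite leq_eqVlt ltnS => /predU1P[->//|/IHn h].
by apply: le_trans h _; case: Hz => _ zz _ _; exact: ltW.
Qed.

Lemma zeros_inj m n : z m = z n -> m = n.
Proof.
case: Hz => _ zz _ _ E; case: (ltngtP m n) => // /zeros_homo H.
  by have := lt_le_trans (zz m) H; rewrite E ltxx.
by have := lt_le_trans (zz n) H; rewrite E ltxx.
Qed.

Lemma besselK_zeros n : K ((z n / 2) ^+ 2) = 0.
Proof.
by case: Hz => _ _ /(_ n) <- _; rewrite J0E; congr K; field.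
Qed.

Lemma besselK_neq0 n x : z n / 2 < x < z n.+1 / 2 -> K (x ^+ 2) != 0.
Proof.
move=> /andP[nx xn]; apply/eqP => Kx.
have x0 : 0 < 2 * x by have := zeros_gt0 n; lra.
case: Hz => _ _ _ /(_ _ x0)[|m zm].
  by rewrite J0E -Kx; congr K; field.
have [mn|nm] := leqP m n.
  by have := zeros_homo mn; rewrite zm; lra.
by have := zeros_homo nm; rewrite zm; lra.
Qed.

Lemma is_derive_xKsq x :
  is_derive x 1 (fun x => x * K (x ^+ 2) ^+ 2) (4 * (K (x ^+ 2) * besselB x)).
Proof.
have ? := is_derive_besselKsq x.
apply: is_derive_eq; rewrite /GRing.scale /= /besselB.
by field.
Qed.

Lemma continuous_xKsq : continuous (fun x => x * K (x ^+ 2) ^+ 2).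
Proof.
move=> x; apply/differentiable_continuous/derivable1_diffP.
by have [] := is_derive_xKsq x.
Qed.

Lemma besselG_bounds : exists c C : R, [/\ 0 < c, 0 < C &
  forall x, z 0 / 2 <= x -> c <= besselG x <= C].
Proof.
have z0 : 0 < z 0 / 2 by rewrite divr_gt0// zeros_gt0.
exists (besselG (z 0 / 2) * expR (-1 / (8 * (z 0 / 2)))).
exists (besselG (z 0 / 2) * expR (1 / (8 * (z 0 / 2)))).
have G0 := besselG_gt0 z0.
split; [by rewrite mulr_gt0 ?expR_gt0..|move=> x zx].
by rewrite besselG_ge// besselG_le.
Qed.

(** The function w^2 = x K(x^2)^2 vanishes at z n / 2 and z n.+1 / 2. At an interior critical point
    [besselB] is 0, so there w^2 equals [besselG] and is at least c. Its slope 4 K besselB is at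
    most 2 C, so reaching that height takes a length of at least c / (2C). *)
Lemma zeros_gap : exists2 g : R, 0 < g & forall n, z n + g <= z n.+1.
Proof.
have [c [C [c0 C0 cC]]] := besselG_bounds.
exists (c / C); first by rewrite divr_gt0.
move=> n; set a := z n / 2; set b := z n.+1 / 2.
have ab : a < b by rewrite /a /b ltr_pM2r//; case: Hz.
have a0 : z 0 / 2 <= a by rewrite ler_pM2r// zeros_homo.
have aa : 0 < a by apply: lt_le_trans a0; rewrite divr_gt0// zeros_gt0.
have W (u v : R) : {within `[u, v], continuous (fun x => x * K (x ^+ 2) ^+ 2)}.
  exact/continuous_subspaceT/continuous_xKsq.
have [x] := MVT ab (fun x _ => is_derive_xKsq x) (W _ _).
rewrite in_itv/= !besselK_zeros expr0n/= !mulr0 subr0 => axb /esym/eqP.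
rewrite mulf_eq0 subr_eq0 (gt_eqF ab) orbF mulf_eq0 pnatr_eq0/= mulf_eq0.
(* Rolle's point makes the product K besselB vanish, and K has no zero between consecutive zeros of
   J0. *)
rewrite (negbTE (besselK_neq0 axb))/= => /eqP B0.
case/andP: axb => ax xb.
have x0 : 0 < x by rewrite (lt_trans aa).
have [y] := MVT ax (fun x _ => is_derive_xKsq x) (W _ _).
rewrite in_itv/= => /andP[ay yx].
have y0 : 0 < y by rewrite (lt_trans aa).
have -> : x * K (x ^+ 2) ^+ 2 = besselG x.
  by rewrite /besselG B0; field; rewrite gt_eqF.
rewrite besselK_zeros expr0n/= mulr0 subr0.
have /andP[cG _] := cC x (le_trans a0 (ltW ax)).
have /andP[_ GC] := cC y (le_trans a0 (ltW ay)).
have /ler_normlP[_ KB] := besselKB_le y0.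
move=> E.
have : c <= 2 * C * (x - a).
  apply: le_trans cG _; rewrite E ler_wpM2r ?subr_ge0 ?(ltW ax)//; lra.
rewrite -lerBrDl ler_pdivrMr//.
have : (x - a) * C <= (b - a) * C by rewrite ler_pM2r//; lra.
have -> : z n.+1 - z n = 2 * (b - a) by rewrite /a /b; field.
lra.
Qed.

Lemma zeros_growth : exists2 c : R, 0 < c <= 1 & forall n, c * n.+1%:R <= z n.
Proof.
have [g g0 zg] := zeros_gap.
exists (Num.min 1 (Num.min g (z 0))).
  by rewrite ge_min lexx andbT !lt_min ltr01 g0 zeros_gt0.
set c := Num.min _ _.
have cg : c <= g by rewrite /c !ge_min lexx orbT.
have cz : c <= z 0 by rewrite /c !ge_min lexx !orbT.
elim=> [|n IHn]; first by rewrite mulr1.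
by rewrite -natr1 mulrDr mulr1; have := zg n; lra.
Qed.

(** Lommel's integral evaluates the norm as l K1(l)^2 with l = (z n / 2)^2. At a zero of K this is
    besselG(x) / x with x = z n / 2, and [besselG] is bounded below. *)
Lemma zeros_norm : exists2 c : R, 0 < c & forall n, exists2 a,
  c <= z n * a &
  (\int[mu]_(t in `[0%R, 1%R]) (K ((z n / 2) ^+ 2 * t) ^+ 2)%:E = a%:E)%E.
Proof.
have [c [C [c0 C0 cC]]] := besselG_bounds.
exists c => // n; set x := z n / 2.
have x0 : 0 < x by rewrite divr_gt0// zeros_gt0.
have zx : z n = 2 * x by rewrite /x; field.
set l := x ^+ 2; have l0 : 0 < l by rewrite exprn_gt0.
exists (l * K1 l ^+ 2).
  have : z 0 / 2 <= x by rewrite ler_pM2r// zeros_homo.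
  move=> /cC/andP[+ _]; rewrite /besselG /besselB besselK_zeros -/x -/l.
  rewrite zx expr0n/= !(mulr0,mul0r) add0r addr0 => /le_trans; apply.
  have -> : (l * K1 l) ^+ 2 / x = x * (l * K1 l ^+ 2).
    by rewrite /l; field; rewrite gt_eqF.
  have q0 : 0 <= l * K1 l ^+ 2 by rewrite mulr_ge0 ?sqr_ge0 ?(ltW l0).
  by rewrite ler_wpM2r//; lra.
have := integral_besselK_sq (besselK_zeros n); rewrite -/x -/l.
under eq_integral do rewrite EFinM.
rewrite ge0_integralZl ?lee_fin ?(ltW l0)//.
- move=> /(congr1 (fun u => (l^-1%:E * u)%E)).
  rewrite muleA -EFinM mulVf ?gt_eqF// mul1e => ->.
  by rewrite -EFinM; congr EFin; field; rewrite gt_eqF.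
- apply/measurable_EFinP; apply: measurable_fun_continuous => t.
  have c1 := @continuous_besselKM R l; exact: (cvgM (c1 t) (c1 t)).
- by move=> t _; rewrite lee_fin sqr_ge0.
Qed.

End BesselZeros2.

(** * Radial integrals and eigenfunctions on the disc *)

Section Polar.
Variable R : realType.
Implicit Types (x t : R).
Local Notation mu := (@lebesgue_measure R).
Local Notation leb2 := (@leb2 R).

Definition sqnorm (x : R * R) : R := x.1 ^+ 2 + x.2 ^+ 2.

Definition disc t : set (R * R) := [set x | sqnorm x < t].

Lemma measurable_sqnorm : measurable_fun setT sqnorm.
Proof.
apply: measurable_funD; apply: measurable_funX.
  exact: measurable_fst.
exact: measurable_snd.
Qed.

Lemma sqnorm_ge0 (x : R * R) : 0 <= sqnorm x.
Proof. by rewrite addr_ge0// sqr_ge0. Qed.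

Lemma measurable_disc t : measurable (disc t).
Proof.
rewrite (_ : disc t = sqnorm @^-1` `]-oo, t[); last first.
  by apply/seteqP; split => x /=; rewrite in_itv.
by rewrite -[X in measurable X]setTI; apply: measurable_sqnorm.
Qed.

Lemma ThetaE : @Theta R = disc 1. Proof. by []. Qed.

Lemma xsection_disc t x :
  xsection (disc t) x = `]- Num.sqrt (t - x ^+ 2), Num.sqrt (t - x ^+ 2)[%classic.
Proof.
apply/seteqP; split => y; rewrite /xsection /disc /sqnorm /= in_itv/= inE/= -ltr_norml.
  move=> h; rewrite -sqrtr_sqr ltr_sqrt; first by rewrite ltrBrDl.
  by rewrite subr_gt0 (le_lt_trans _ h)// lerDl sqr_ge0.
(* When the vertical line misses the disc, the square root of a nonpositive number is 0 and the
   interval is empty. *)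
have [t0|t0] := ltP 0 (t - x ^+ 2).
  by rewrite -sqrtr_sqr ltr_sqrt// ltrBrDl.
by rewrite ler0_sqrtr// ltNge normr_ge0.
Qed.

Lemma leb2_disc t : leb2 (disc t) =
  (\int[mu]_x (2 * Num.sqrt (t - x ^+ 2))%:E)%E.
Proof.
rewrite /leb2 /product_measure1; apply: eq_integral => x _ /=.
rewrite xsection_disc lebesgue_measure_itv/= lte_fin.
case: ifPn => [_|]; first by rewrite -EFinD; congr (_%:E); ring.
rewrite -leNgt -subr_ge0 => h; have /eqP -> : Num.sqrt (t - x ^+ 2) == 0.
  by rewrite eq_le sqrtr_ge0 andbT; lra.
by rewrite mulr0.
Qed.

Lemma continuous_halfchord t : continuous (fun x => 2 * Num.sqrt (t - x ^+ 2)).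
Proof.
move=> x; apply: cvgM; first exact: cvg_cst.
apply: (@continuous_comp _ _ _ (fun x => t - x ^+ 2) (@Num.sqrt R)).
  by apply: cvgB; [exact: cvg_cst|exact: exprn_continuous].
exact: sqrt_continuous.
Qed.

(** Rescaling the chords by sqrt(t) shows that the area is linear in the squared radius t. This fact
    replaces the Jacobian of polar coordinates. *)
Lemma leb2_disc_scale t : 0 <= t -> leb2 (disc t) = (t%:E * leb2 (disc 1))%E.
Proof.
rewrite le_eqVlt => /predU1P[<-|t0].
  rewrite mul0e leb2_disc; apply: integral0_eq => x _.
  by rewrite ler0_sqrtr ?mulr0// sub0r oppr_le0 sqr_ge0.
pose s := Num.sqrt t; have s0 : 0 < s by rewrite sqrtr_gt0.
have ds : derive1 (fun x => s * x) = fun=> s.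
  apply/funext => x; rewrite derive1E deriveZ//.
  by rewrite derive_id /GRing.scale /= mulr1.
have E x : 2 * Num.sqrt (t - (s * x) ^+ 2) * s = t * (2 * Num.sqrt (1 - x ^+ 2)).
  have -> : t - (s * x) ^+ 2 = t * (1 - x ^+ 2).
    by rewrite exprMn sqr_sqrtr ?(ltW t0)//; ring.
  rewrite sqrtrM ?(ltW t0)// -/s -[t in RHS](@sqr_sqrtr _ t) ?(ltW t0)// -/s.
  ring.
rewrite !leb2_disc (@increasing_ge0_integration_by_substitutionT _ (fun x => s * x)).
- transitivity
    (\int[mu]_x (t%:E * (2 * Num.sqrt (1 - x ^+ 2))%:E))%E; last first.
    rewrite ge0_integralZl//.
    + apply/measurable_EFinP; apply: measurable_fun_continuous; exact: continuous_halfchord.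
    + by rewrite lee_fin ltW.
  apply: eq_integral => x _; rewrite -EFinM; congr EFin.
  by rewrite -E ds.
- by move=> x y xy; rewrite ltr_pM2l.
- by rewrite ds => x; exact: cvg_cst.
- by rewrite ds; exact: is_cvg_cst.
- by rewrite ds; exact: is_cvg_cst.
- by move=> x; exact: derivableZ.
- exact: gt0_cvgMrNy.
- exact: gt0_cvgMry.
- exact: continuous_halfchord.
- by move=> x; rewrite mulr_ge0.
Qed.

Lemma leb2_Theta_fin : (leb2 (@Theta R) < +oo)%E.
Proof.
apply: (@le_lt_trans _ _ (leb2 (`[-1, 1] `*` `[-1, 1])%classic)).
  apply: le_measure; rewrite ?inE.
  - exact: measurable_disc.
  - exact: measurableX.
  - move=> [x y]; rewrite /Theta/= !in_itv/= => h.
    by split; apply/andP; split; nra.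
rewrite /leb2 product_measure1E//= lebesgue_measure_itv/=.
by rewrite lte_fin; case: ifPn => _; rewrite -?EFinB -?EFinM ?mul0e ltry.
Qed.

Lemma leb2_Theta_gt0 : (0 < leb2 (@Theta R))%E.
Proof.
apply: (@lt_le_trans _ _ (leb2 (`[0, 1/2] `*` `[0, 1/2])%classic)).
  rewrite /leb2 product_measure1E//= lebesgue_measure_itv/= lte_fin.
  rewrite ifT ?divr_gt0// -EFinB -EFinM lte_fin; lra.
apply: le_measure; rewrite ?inE.
- exact: measurableX.
- exact: measurable_disc.
- move=> [x y] /=; rewrite !in_itv/= => -[/andP[x0 x1] /andP[y0 y1]].
  rewrite /Theta/=; nra.
Qed.

Definition disc_area : R := fine (leb2 (@Theta R)).

Lemma disc_area_gt0 : 0 < disc_area.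
Proof. by rewrite fine_gt0// leb2_Theta_gt0 leb2_Theta_fin. Qed.

Lemma leb2_ThetaE : leb2 (@Theta R) = disc_area%:E.
Proof.
by rewrite fineK// ge0_fin_numE ?leb2_Theta_fin// ltW// leb2_Theta_gt0.
Qed.

End Polar.

(** * Integration of radial functions *)

Section RadialIntegral.
Variable R : realType.
Implicit Types (t : R).
Local Notation mu := (@lebesgue_measure R).
Local Notation leb2 := (@leb2 R).
Local Notation sqnorm := (@sqnorm R).
Local Notation disc_area := (@disc_area R).

(* The measurable structure on which [leb2] is defined; it is convertible to, but
   not syntactically, the one on [R * R]. *)
Local Notation plane := (measurableTypeR R * measurableTypeR R)%type.

Definition plane_leb : {measure set plane -> \bar R} :=
  (@lebesgue_measure R \x @lebesgue_measure R)%E.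

Definition plane_sqnorm (x : plane) : measurableTypeR R := sqnorm x.

Lemma measurable_plane_sqnorm : measurable_fun setT plane_sqnorm.
Proof. exact: measurable_sqnorm. Qed.

Let disc_area_nng : {nonneg R} := NngNum (ltW (disc_area_gt0 R)).

Let mray : measurable (`[0, +oo[%classic : set (measurableTypeR R)).
Proof. exact: measurable_itv. Qed.

(** The two measures agree on the rays ]-oo, t[ by linearity of the area of discs; the rays are
    stable under intersection and generate the Borel sets. *)
Lemma pushforward_sqnorm (A : set (measurableTypeR R)) : measurable A ->
  plane_leb (plane_sqnorm @^-1` A) = mscale disc_area_nng (mrestr mu mray) A.
Proof.
move=> mA.
pose m1 : {measure set (measurableTypeR R) -> \bar R} :=
  pushforward plane_leb plane_sqnorm.
rewrite -[LHS]/(m1 measurable_plane_sqnorm A).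
apply: (@measure_unique _ _ (measurableTypeR R) (@RGenInftyO.G R)
  (fun k => `]-oo, k%:R[%classic) _ _ _ _ (m1 measurable_plane_sqnorm)) => //.
- exact: RGenInftyO.measurableE.
- move=> _ _ [x ->] [y ->]; exists (Num.min x y); apply/seteqP.
  by split => u /=; rewrite !in_itv/= lt_min => /andP.
- by move=> k; exists k%:R.
- rewrite -subTset => x _; exists (Num.truncn `|x|).+1 => //=.
  by rewrite in_itv/= (le_lt_trans (ler_norm _))// truncnS_gt.
- move=> _ [t ->]; rewrite /m1/= /pushforward /mscale /mrestr/=.
  have [t0|t0] := leP 0 t.
    transitivity (leb2 (disc t)).
      by congr leb2; apply/seteqP; split => x /=; rewrite in_itv.
    rewrite leb2_disc_scale// -leb2_ThetaE muleC; congr (_ * _)%E.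
    rewrite /mrestr (_ : _ `&` _ = `[0, t[%classic); last first.
      by apply/seteqP; split => u /=; rewrite !in_itv/= andbT;
        [move=> [-> ->]|move=> /andP[-> ->]].
    rewrite [RHS](@lebesgue_measure_itv R `[0, t[)/= lte_fin; case: ifPn => [_|]; first by rewrite oppr0 adde0.
    by rewrite -leNgt => t1; congr EFin; apply/eqP; rewrite eq_le t0 t1.
  rewrite (_ : _ @^-1` _ = set0) ?measure0; last first.
    apply/seteqP; split => x //=; rewrite in_itv/= => h.
    by have := lt_le_trans h (ltW t0); rewrite ltNge sqnorm_ge0.
  rewrite /= /mrestr (_ : _ `&` _ = set0) ?measure0 ?mule0//.
  by apply/seteqP; split => x //=; rewrite !in_itv/= andbT => -[? ?]; lra.
- move=> k.
  rewrite [ltLHS](_ : _ = leb2 (disc k%:R)).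
    by rewrite leb2_disc_scale// -ThetaE leb2_ThetaE -EFinM ltry.
  by congr leb2; apply/seteqP; split => x /=; rewrite in_itv.
Qed.

Lemma integral_Theta_radial (F : R -> R) : measurable_fun setT F ->
  (forall t, 0 <= F t) ->
  (\int[leb2]_(x in @Theta R) (F (sqnorm x))%:E =
   disc_area%:E * \int[mu]_(t in `[0%R, 1%R]) (F t)%:E)%E.
Proof.
move=> mF F0.
have -> : @Theta R = plane_sqnorm @^-1` `[0, 1[%classic.
  by apply/seteqP; split => x /=; rewrite in_itv/= sqnorm_ge0.
pose F' (t : measurableTypeR R) := (F t)%:E.
have := @ge0_integral_pushforward _ _ plane (measurableTypeR R) R plane_sqnorm
  measurable_plane_sqnorm plane_leb `[0, 1[%classic F' _ _ _.
move=> <-//.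
- rewrite (@eq_measure_integral _ _ _ _ (mscale disc_area_nng mu)).
    rewrite ge0_integral_mscale//=.
    + rewrite integral_itv_bndo_bndc//.
      by apply/measurable_EFinP/measurable_funTS.
    + by apply/measurable_EFinP/measurable_funTS.
    + by move=> t _; rewrite lee_fin.
    exact: measurable_plane_sqnorm.
  move=> mq A mA A01; transitivity (plane_leb (plane_sqnorm @^-1` A)) => //.
  rewrite pushforward_sqnorm// /mscale /mrestr/=.
  congr (_ * mu _)%E; apply/setIidPl => t /A01/=.
  by rewrite !in_itv/= andbT => /andP[].
- by apply/measurable_EFinP/measurable_funTS.
- by move=> t _; rewrite lee_fin.
Qed.

End RadialIntegral.

(** * Integrability of negative powers at the origin *)

Section EigenfunctionBounds.
Variable R : realType.
Implicit Types (t : R).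
Local Notation mu := (@lebesgue_measure R).
Local Notation leb2 := (@leb2 R).
Local Notation sqnorm := (@sqnorm R).
Local Notation K := (@besselK R).

Lemma integral_powR_itv a eps : 0 < a < 1 -> 0 < eps < 1 ->
  (\int[mu]_(t in `[eps, 1%R]) (t `^ (- a))%:E <= ((1 - a)^-1)%:E)%E.
Proof.
move=> /andP[a0 a1] /andP[e0 e1].
have d (t : R) : 0 < t -> is_derive t 1 (fun u => (1 - a)^-1 * u `^ (1 - a)) (t `^ (- a)).
  move=> t0; have ? := is_derive1_powR (1 - a) t0.
  apply: is_derive_eq; rewrite /GRing.scale /=.
  by rewrite mulKf ?subr_eq0 ?gt_eqF//; congr (_ `^ _); ring.
have c (t : R) : 0 < t -> {for t, continuous (fun u => (1 - a)^-1 * u `^ (1 - a))}.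
  move=> t0; apply/differentiable_continuous/derivable1_diffP.
  by have [] := d t t0.
rewrite (@continuous_FTC2 _ _ (fun u => (1 - a)^-1 * u `^ (1 - a)))//.
- rewrite -EFinB lee_fin powR1 mulr1 lerBlDr lerDl mulr_ge0 ?powR_ge0//.
  by rewrite invr_ge0 subr_ge0 ltW.
- apply: derivable_within_continuous => t; rewrite in_itv/= => /andP[et _].
  have t0 : 0 < t := lt_le_trans e0 et.
  by have [] := is_derive1_powR (- a) t0.
- split.
  + by move=> t; rewrite in_itv/= => /andP[et _]; have [] := d t (lt_trans e0 et).
  + by apply/cvg_at_right_filter; exact: c.
  + by apply/cvg_at_left_filter; exact: c.
- move=> t; rewrite in_itv/= => /andP[et _]; rewrite derive1E.
  by have [] := d t (lt_trans e0 et).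
Qed.

Lemma integral_powR_lty a : 0 < a < 1 ->
  (\int[mu]_(t in `[0%R, 1%R]) (t `^ (- a))%:E < +oo)%E.
Proof.
move=> a01.
have mp (D : set (measurableTypeR R)) : measurable_fun D (fun t => (t `^ (- a))%:E).
  by apply/measurable_EFinP; apply: measurable_funTS; exact: measurable_powR.
rewrite -(@integral_itv_obnd_cbnd _ 0 (BRight 1)); last exact: mp.
(* The offset in k.+2 keeps the left endpoint strictly below 1, as [integral_powR_itv] requires. *)
have -> : `]0, 1]%classic = \bigcup_k `[(k.+2%:R^-1 : R), 1]%classic.
  apply/seteqP; split => t /=; rewrite in_itv/=.
    move=> /andP[t0 t1]; exists (Num.truncn t^-1) => //=; rewrite in_itv/= t1 andbT.
    rewrite invf_ple ?posrE//.
    by rewrite (le_trans (ltW (truncnS_gt _)))// ler_nat.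
  by move=> [k _] /=; rewrite in_itv/= => /andP[kt ->]; rewrite (lt_le_trans _ kt).
apply: (@le_lt_trans _ _ ((1 - a)^-1)%:E); last exact: ltry.
pose I (k : nat) : set (measurableTypeR R) := `[k.+2%:R^-1 : R, 1]%classic.
have C : (fun k => \int[mu]_(t in `[(k.+2%:R^-1)%R, 1%R]) (t `^ (- a))%:E)%E @ \oo -->
    (\int[mu]_(t in \bigcup_k I k) (t `^ (- a))%:E)%E.
  apply: (@ge0_nondecreasing_set_cvg_integral _ (measurableTypeR R) R).
  - apply/nondecreasing_seqP => k; rewrite subsetEset => t; rewrite /I/=.
    rewrite !in_itv/= => /andP[+ ->]; rewrite andbT; apply: le_trans.
    by rewrite lef_pV2 ?posrE ?ltr0n// ler_nat.
  - by move=> k; exact: measurable_itv.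
  - by move=> k; exact: mp.
  - by move=> k t _; rewrite lee_fin powR_ge0.
rewrite -(cvg_lim _ C)//.
apply: lime_le; first by apply/cvg_ex; eexists; exact: C.
apply: nearW => k; apply: integral_powR_itv => //.
by rewrite invr_gt0 ltr0n/= invf_lt1 ?ltr0n// ltr1n.
Qed.

End EigenfunctionBounds.

Section Eigenfunctions.
Variable R : realType.
Implicit Types (t : R).
Local Notation mu := (@lebesgue_measure R).
Local Notation leb2 := (@leb2 R).
Local Notation sqnorm := (@sqnorm R).
Local Notation disc_area := (@disc_area R).
Local Notation K := (@besselK R).
Local Notation plane := (measurableTypeR R * measurableTypeR R)%type.
Variable z : nat -> R.
Hypothesis Hz : J0_zeros z.

Let k n t := K ((z n / 2) ^+ 2 * t).

Lemma cmod_sq (x : R * R) : cmod x ^+ 2 = sqnorm x.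
Proof. by rewrite sqr_sqrtr// sqnorm_ge0. Qed.

Lemma cmod_ge0 (x : R * R) : 0 <= cmod x.
Proof. exact: sqrtr_ge0. Qed.

Lemma J0_cmod n x : J0 (z n * cmod x) = k n (sqnorm x).
Proof. by rewrite J0E -cmod_sq; congr K; field. Qed.

Let norm2 n := Rintegral leb2 (@Theta R) (fun y => J0 (z n * cmod y) ^+ 2).

Let mk n : measurable_fun setT (k n).
Proof. by apply: measurable_fun_continuous; exact: continuous_besselKM. Qed.

Lemma eigen_norm_ge : exists2 c, 0 < c & forall n, c <= z n * norm2 n.
Proof.
have [c c0 H] := zeros_norm Hz.
exists (disc_area * c); first by rewrite mulr_gt0// disc_area_gt0.
move=> n; have [a ca E] := H n.
have -> : norm2 n = disc_area * a.
  rewrite /norm2 /Rintegral.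
  rewrite (eq_integral (fun x : plane => (k n (sqnorm x) ^+ 2)%:E)); last first.
    by move=> x _; rewrite J0_cmod.
  rewrite (integral_Theta_radial (F := fun t => k n t ^+ 2)).
  - by rewrite E.
  - by apply: measurable_funX; exact: mk.
  - by move=> t; exact: sqr_ge0.
by rewrite mulrCA ler_pM2l// disc_area_gt0.
Qed.

Lemma eigen_norm_gt0 n : 0 < norm2 n.
Proof.
have [c c0 /(_ n)] := eigen_norm_ge.
move=> /(lt_le_trans c0); rewrite pmulr_rgt0//; exact: zeros_gt0.
Qed.

Lemma eE n x : e z n x = k n (sqnorm x) / Num.sqrt (norm2 n).
Proof. by rewrite /e J0_cmod. Qed.

Lemma e_sq n x : e z n x ^+ 2 = J0 (z n * cmod x) ^+ 2 / norm2 n.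
Proof. by rewrite /e expr_div_n sqr_sqrtr// ltW// eigen_norm_gt0. Qed.

Lemma measurable_e n : measurable_fun setT (e z n).
Proof.
rewrite (_ : e z n = (fun t => k n t / Num.sqrt (norm2 n)) \o sqnorm); last first.
  by apply/funext => x; rewrite eE.
apply: measurableT_comp; last exact: measurable_sqnorm.
by apply: measurable_funM => //; exact: mk.
Qed.

(** The squared norm of J0(z_n |x|) is at least c / z_n. Dividing J0^2 <= 1 by it loses a factor
    z_n; dividing J0^2 <= C / (z_n |x|) by it cancels z_n and leaves a bound uniform in n. *)
Lemma e_bounds : exists2 B, 0 < B &
  forall n x, e z n x ^+ 2 <= B * z n /\ cmod x * e z n x ^+ 2 <= B.
Proof.
have [c c0 H] := eigen_norm_ge; have [C C0 J0C] := @J0_decay R.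
have cV : 0 < c^-1 by rewrite invr_gt0.
exists (c^-1 + C / c); first by rewrite addr_gt0// divr_gt0.
move=> n x; have n0 := eigen_norm_gt0 n; have z0 := zeros_gt0 Hz n.
have nV : (norm2 n)^-1 <= z n / c.
  by rewrite ler_pdivlMr// mulrC ler_pdivrMr.
rewrite e_sq; split.
  apply: (@le_trans _ _ (1 * (z n / c))).
    by rewrite ler_pM ?sqr_ge0 ?invr_ge0 ?(ltW n0)// J0_sq_le1.
  rewrite mul1r mulrC ler_wpM2r ?(ltW z0)// lerDl.
  by rewrite divr_ge0 ?ltW.
have [x0|x0] := leP (cmod x) 0.
  apply: (@le_trans _ _ 0); last by rewrite addr_ge0 ?divr_ge0 ?ltW.
  by rewrite mulr_le0_ge0// divr_ge0 ?sqr_ge0 ?ltW.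
apply: (@le_trans _ _ (C / c)); last by rewrite lerDr ltW.
have := J0C _ (mulr_gt0 z0 x0); set j := J0 _ ^+ 2 => jC.
have j0 : 0 <= j by exact: sqr_ge0.
apply: (@le_trans _ _ (cmod x * j * (z n / c))).
  by rewrite mulrA ler_wpM2l// mulr_ge0 ?cmod_ge0.
have -> : cmod x * j * (z n / c) = z n * cmod x * j / c by ring.
by rewrite ler_pM2r.
Qed.

Lemma k_le1 n t : 0 <= t -> `|k n t| <= 1.
Proof.
move=> t0; rewrite -(expr_le1 (n := 2))// real_normK ?num_real//.
by rewrite besselK_sq_le1// mulr_ge0 ?sqr_ge0.
Qed.

(** Orthogonality is stated after adding 1 because [integral_Theta_radial] is available for
    nonnegative functions only, and 1 + k_n k_m is nonnegative. *)
Lemma integral_kk n m : n != m -> (\int[leb2]_(x in @Theta R)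
  (1 + k n (sqnorm x) * k m (sqnorm x))%:E = disc_area%:E)%E.
Proof.
move=> nm.
(* The absolute values extend nonnegativity to negative t, where [k_le1] gives nothing. *)
pose F t := 1 + k n `|t| * k m `|t|.
have F0 t : 0 <= F t.
  have : `|k n `|t| * k m `|t| | <= 1.
    by rewrite normrM -[leRHS]mul1r ler_pM// k_le1.
  by move=> /ler_normlP[]; rewrite /F; lra.
have mF : measurable_fun setT F.
  apply: measurable_funD => //; apply: measurable_funM.
  - by apply: measurableT_comp; [exact: mk|exact: normr_measurable].
  - by apply: measurableT_comp; [exact: mk|exact: normr_measurable].
rewrite (eq_integral (fun x : plane => (F (sqnorm x))%:E)); last first.
  by move=> x _; rewrite /F ger0_norm// sqnorm_ge0.
rewrite integral_Theta_radial//.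
have i01 : mu.-integrable `[0, 1] (fun t => (k n t * k m t)%:E).
  apply: continuous_compact_integrable; first exact: segment_compact.
  apply: continuous_subspaceT => t.
  have c1 l : continuous (fun t => K (l * t)) := @continuous_besselKM R l.
  exact: (cvgM (c1 _ t) (c1 _ t)).
have -> : (\int[mu]_(t in `[0%R, 1%R]) (F t)%:E =
    \int[mu]_(t in `[0%R, 1%R]) (1%:E + (k n t * k m t)%:E))%E.
  apply: eq_integral => t.
  by rewrite inE/= in_itv/= => /andP[t0 _]; rewrite /F ger0_norm.
have m01 : mu `[0, 1]%classic = 1%E.
  by rewrite lebesgue_measure_itv/= lte_fin ltr01 -EFinB subr0.
rewrite integralD//; last first.
  apply/integrableP; split; first by [].
  rewrite (eq_integral (cst 1%E)); last by move=> t _ /=; rewrite normr1.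
  by rewrite integral_cst//= m01 mule1 ltry.
rewrite integral_cst//= m01 besselK_orthogonal ?besselK_zeros//.
  by rewrite adde0 !mule1.
apply: contra_neq nm => E; apply: (zeros_inj Hz).
have := E; move=> /eqP; rewrite eqf_sqr => /orP[/eqP|/eqP] E'.
  by apply: (mulIf (x := 2^-1)) => //; rewrite invr_eq0.
have := zeros_gt0 Hz n; have := zeros_gt0 Hz m; lra.
Qed.

End Eigenfunctions.

(** * Lebesgue measure of the disc as a finite measure *)

Section DiscMeasure.
Variable R : realType.
Implicit Types (t : R).
Local Notation leb2 := (@leb2 R).
Local Notation sqnorm := (@sqnorm R).
Local Notation plane := (measurableTypeR R * measurableTypeR R)%type.

Lemma measurable_fun_EFin d (T : measurableType d) (D : set T) (f : T -> R) :
  measurable_fun D f -> measurable_fun D (fun x => (f x)%:E).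
Proof. by move=> mf; apply/measurable_EFinP. Qed.

Lemma le_plane_leb (A B : set plane) : measurable A -> measurable B ->
  A `<=` B -> (plane_leb R A <= plane_leb R B)%E.
Proof. by move=> mA mB AB; apply: le_measure; rewrite ?inE. Qed.

Lemma integral_mrestr d (T : measurableType d) (mu : {measure set T -> \bar R})
    (D : set T) (mD : measurable D) (f : T -> \bar R) : measurable_fun setT f ->
  (\int[mrestr mu mD]_x f x = \int[mu]_(x in D) f x)%E.
Proof.
move=> mf; transitivity (\int[mrestr mu mD]_(x in D) f x)%E; last first.
  by apply: eq_measure_integral => A mA AD; rewrite -[LHS]/(mu (A `&` D)) setIidl.
rewrite [RHS]integral_mkcond.
apply: (@ae_eq_integral _ T R (mrestr mu mD) setT (f \_ D) f) => //.
  by apply/(measurable_restrictT _ _).1 => //; exact: measurable_funTS.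
exists (~` D); split; first exact: measurableC.
  by rewrite -[LHS]/(mu (~` D `&` D)) setICl measure0.
move=> x /= h Dx; apply: h => _; rewrite patchE ifT// inE//.
Qed.

Lemma measurable_Theta : measurable (@Theta R : set plane).
Proof. exact: measurable_disc. Qed.

(** Restricting the measure instead of the domain yields a finite measure on the whole plane, so
    that the probabilistic lemmas below can be stated for an abstract finite measure. *)
Definition disc_leb : set plane -> \bar R := mrestr (plane_leb R) measurable_Theta.

HB.instance Definition _ := Measure.on disc_leb.

Lemma disc_leb_fin : fin_num_fun disc_leb.
Proof.
move=> A mA; rewrite ge0_fin_numE; last exact: measure_ge0.
apply: le_lt_trans (leb2_Theta_fin R); rewrite /disc_leb /mrestr.
rewrite -[leRHS]/(plane_leb R (@Theta R)).
apply: le_plane_leb => //; last exact: measurable_Theta.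
by apply: measurableI => //; exact: measurable_Theta.
Qed.

HB.instance Definition _ := Measure_isFinite.Build _ plane _ disc_leb disc_leb_fin.

Lemma integral_disc_leb (f : plane -> \bar R) : measurable_fun setT f ->
  (\int[leb2]_(x in @Theta R) f x = \int[disc_leb]_x f x)%E.
Proof. by move=> mf; rewrite integral_mrestr. Qed.

Lemma Rintegral_disc_leb (f : plane -> R) : measurable_fun setT f ->
  Rintegral leb2 (@Theta R) f = fine (\int[disc_leb]_x (f x)%:E)%E.
Proof.
by move=> mf; rewrite /Rintegral integral_disc_leb//; apply: measurable_fun_EFin.
Qed.

Lemma measurable_origin : measurable [set x : plane | sqnorm x = 0].
Proof.
have -> : [set x : plane | sqnorm x = 0] = setT `&` @plane_sqnorm R @^-1` [set 0].
  by rewrite setTI.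
exact: (@measurable_plane_sqnorm R).
Qed.

Lemma disc_leb_origin : disc_leb [set x : plane | sqnorm x = 0] = 0%E.
Proof.
apply/eqP; rewrite eq_le measure_ge0 andbT.
have mo := measurable_origin.
apply: (@le_trans _ _ (plane_leb R (@plane_sqnorm R @^-1` [set 0]))).
  apply: le_plane_leb => //.
  by apply: measurableI => //; exact: measurable_Theta.
rewrite pushforward_sqnorm// /mscale /mrestr/=.
rewrite [X in (_ * X)%E](_ : _ = 0%E) ?mule0//.
apply/eqP; rewrite eq_le measure_ge0 andbT -(@lebesgue_measure_set1 R 0).
by apply: le_measure; rewrite ?inE//; apply: measurableI.
Qed.

Lemma disc_leb_ae (f g : plane -> \bar R) : measurable_fun setT f ->
  measurable_fun setT g -> (forall x, sqnorm x != 0 -> f x = g x) ->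
  (\int[disc_leb]_x f x = \int[disc_leb]_x g x)%E.
Proof.
move=> mf mg fg; apply: ae_eq_integral => //.
exists [set x | sqnorm x = 0]; split.
- exact: measurable_origin.
- exact: disc_leb_origin.
- move=> x /= h; apply: contrapT => /eqP x0; apply: h => _; exact: fg.
Qed.

(** A stand-in for 1/|x| that is at least 1, so that its powers increase with the exponent; at the
    origin it takes the value 1. *)
Definition invr_cmod (x : plane) : R := Num.max 1 (cmod x `^ (-1)).

Lemma invr_cmod_ge1 x : 1 <= invr_cmod x.
Proof. by rewrite le_max lexx. Qed.

Lemma measurable_cmod : measurable_fun setT (@cmod R : plane -> R).
Proof.
apply: (measurableT_comp (f := @Num.sqrt R)); last exact: measurable_sqnorm.
by apply: measurable_fun_continuous; exact: sqrt_continuous.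
Qed.

Lemma measurable_invr_cmod : measurable_fun setT invr_cmod.
Proof.
apply: measurable_maxr => //.
apply: (measurableT_comp (f := fun t : R => t `^ (-1))); last exact: measurable_cmod.
exact: measurable_powR.
Qed.

(** In the variable t = |x|^2 the singularity is t^(-q/2), which is integrable at 0 exactly because
    q < 2. *)
Lemma integral_invr_cmod_lty q : 0 <= q < 2 ->
  (\int[disc_leb]_x (invr_cmod x `^ q)%:E < +oo)%E.
Proof.
move=> /andP[q0 q2].
(* The exponent q / 2 is raised to at least 1/2 because q = 0 is allowed and [integral_powR_lty]
   wants a positive exponent. *)
pose a := Num.max (q / 2) (1 / 2).
have a01 : 0 < a < 1 by rewrite lt_max gt_max; apply/andP; split; [apply/orP; right|apply/andP; split]; lra.
pose F t : R := 1 + t `^ (- a).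
have mF : measurable_fun setT F.
  by apply: measurable_funD => //; exact: measurable_powR.
have F0 t : 0 <= F t by rewrite addr_ge0// powR_ge0.
apply: (@le_lt_trans _ _ (\int[disc_leb]_x (F (sqnorm x))%:E)%E).
  apply: ae_ge0_le_integral => //.
  - by move=> x _; rewrite lee_fin powR_ge0.
  - apply: (@measurable_fun_EFin _ plane setT (fun x => invr_cmod x `^ q)).
    apply: (measurableT_comp (f := fun t : R => t `^ q)); last exact: measurable_invr_cmod.
    exact: measurable_powR.
  - by move=> x _; rewrite lee_fin.
  - apply: (@measurable_fun_EFin _ plane setT (fun x => F (sqnorm x))).
    by apply: (measurableT_comp (f := F)); last exact: measurable_sqnorm.
  exists [set x | sqnorm x = 0]; split.
  - exact: measurable_origin.
  - exact: disc_leb_origin.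
  move=> x /= h; apply: contrapT => x0; apply: h => _.
  have s0 : 0 < sqnorm x by rewrite lt_neqAle eq_sym sqnorm_ge0 andbT; apply/eqP.
  rewrite lee_fin /invr_cmod /F /Num.max; case: ifPn => [|_]; last first.
    by rewrite powR1 lerDl powR_ge0.
  rewrite {1}(powR_inv1 (cmod_ge0 _)) => c1.
  apply: (@le_trans _ _ (sqnorm x `^ (- a))); last by rewrite lerDr.
  have -> : ((cmod x) `^ (-1)) `^ q = ((cmod x)^-1 ^+ 2) `^ (q / 2).
    rewrite (powR_inv1 (cmod_ge0 _)).
    by rewrite -powR_mulrn ?invr_ge0 ?cmod_ge0// -powRrM mulrC divfK.
  rewrite exprVn cmod_sq powRN -powR_inv1 ?(ltW s0)// -powRrM mulN1r powRN.
  rewrite lef_pV2 ?posrE ?powR_gt0//.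
  have s1 : sqnorm x < 1.
    rewrite -cmod_sq expr_lt1 ?cmod_ge0// -[ltLHS]invrK invf_lt1//.
    by rewrite (lt_trans _ c1).
  by apply: ger_powR; rewrite ?s0 ?(ltW s1)// le_max lexx.
rewrite -integral_disc_leb; last first.
  apply: (@measurable_fun_EFin _ plane setT (fun x => F (sqnorm x))).
  by apply: (measurableT_comp (f := F)); last exact: measurable_sqnorm.
rewrite integral_Theta_radial//.
rewrite lte_mul_pinfty//; first by rewrite lee_fin ltW// disc_area_gt0.
rewrite /F; under eq_integral do rewrite EFinD.
rewrite ge0_integralD//=; last 2 first.
- by move=> t _; rewrite lee_fin powR_ge0.
- by apply: measurable_fun_EFin; apply: measurable_funTS; exact: measurable_powR.
rewrite lte_add_pinfty//; last exact: integral_powR_lty.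
by rewrite integral_cst//= lebesgue_measure_itv/= lte_fin ltr01 -EFinB -EFinM ltry.
Qed.

End DiscMeasure.

(** * Gaussian sums and random series *)

Section LayerCake.
Variable R : realType.
Local Notation leb := (@lebesgue_measure R).
Local Open Scope ereal_scope.

Section layer_cake.
Context d (T : measurableType d) (mu : {sigma_finite_measure set T -> \bar R}).
Variables (Z Y : T -> R).
Hypotheses (mZ : measurable_fun setT Z) (mY : measurable_fun setT Y).
Hypotheses (Z0 : forall x, (0 <= Z x)%R) (Y0 : forall x, (0 <= Y x)%R).

Let A : set (measurableTypeR R * T) := [set p | (0 <= p.1 < Y p.2)%R].

Let mA : measurable A.
Proof.
have -> : A = ((fun p : measurableTypeR R * T => p.1 : R) @^-1` `[0%R, +oo[) `&`
    ((fun p : measurableTypeR R * T => Y p.2 - p.1)%R @^-1` `]0%R, +oo[).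
  apply/seteqP; split => -[t x]; rewrite /A/= !in_itv/= !andbT subr_gt0.
    by move=> /andP[].
  by move=> [-> ->].
apply: measurableI.
  have h1 : measurable_fun setT (fun p : measurableTypeR R * T => p.1 : R).
    exact: measurable_fst.
  by rewrite -[X in measurable X]setTI; apply: h1.
have h : measurable_fun setT (fun p : measurableTypeR R * T => Y p.2 - p.1)%R.
  apply: measurable_funB; last exact: measurable_fst.
  by apply: measurableT_comp => //; exact: measurable_snd.
by rewrite -[X in measurable X]setTI; apply: h.
Qed.

Let mf : measurable_fun setT
  (fun p : measurableTypeR R * T => (Z p.2 * \1_A p)%:E).
Proof.
apply: measurable_fun_EFin; apply: measurable_funM.
  by apply: measurableT_comp => //; exact: measurable_snd.
exact: measurable_indic.
Qed.

Let f0 (p : measurableTypeR R * T) : 0 <= (Z p.2 * \1_A p)%:E.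
Proof. by rewrite lee_fin mulr_ge0. Qed.

Lemma measurable_layer : measurable_fun setT (fun t : measurableTypeR R =>
  \int[mu]_x (Z x * \1_[set x | (0 <= t < Y x)%R] x)%:E).
Proof. exact: (measurable_fun_fubini_tonelli_F _ mf f0). Qed.

(** Tonelli for Z times the indicator of 0 <= t < Y. The weight Z serves both for densities and for
    an independent factor. *)
Lemma layer_cake : \int[mu]_x (Z x * Y x)%:E =
  \int[leb]_t \int[mu]_x (Z x * \1_[set x | (0 <= t < Y x)%R] x)%:E.
Proof.
have := fubini_tonelli (m1 := leb) (m2 := mu) _ mf f0 => /= E.
transitivity (\int[leb]_x \int[mu]_y (Z y * \1_A (x, y))%:E) => //.
rewrite E; apply: eq_integral => x _.
under eq_integral do rewrite EFinM.
rewrite ge0_integralZl//.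
- rewrite EFinM; congr (_ * _).
  transitivity
      (\int[leb]_t (\1_(`[0%R, Y x[%classic : set (measurableTypeR R)) t)%:E).
    rewrite integral_indic ?setIT//.
    rewrite [RHS](@lebesgue_measure_itv R `[0%R, Y x[)/= lte_fin; case: ifPn => [_|]; first by rewrite -EFinB subr0.
    by rewrite -leNgt => h; congr EFin; apply/eqP; rewrite eq_le h Y0.
  apply: eq_integral => t _; rewrite !indicE.
  suff -> : ((t, x) \in A) = (t \in `[0%R, Y x[%classic) by [].
  by apply/idP/idP => /set_mem h; apply/mem_set; move: h; rewrite /A/= in_itv.
- apply: (@measurable_fun_EFin R _ (measurableTypeR R) setT (fun t => \1_A (t, x))).
  have mI : measurable_fun setT (\1_A : measurableTypeR R * T -> R).
    exact: measurable_indic.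
  have mp : measurable_fun setT (fun t : measurableTypeR R => (t, x)).
    exact: measurable_fun_pair.
  exact: (measurableT_comp mI mp).
- by rewrite lee_fin.
Qed.

End layer_cake.

(** The product rule passes from the events {X in B} to nonnegative functions of X by slicing F(X)
    into its superlevel sets. *)
Lemma independent_integral d (T : measurableType d) (P : probability T R)
    (X Z : T -> R) (F : R -> R) :
  measurable_fun setT X -> measurable_fun setT Z -> (forall w, (0 <= Z w)%R) ->
  (forall B, measurable B -> \int[P]_w (Z w * \1_(X @^-1` B) w)%:E =
     \int[P]_w (Z w)%:E * P (X @^-1` B)) ->
  measurable_fun setT F -> (forall x, (0 <= F x)%R) ->
  \int[P]_w (Z w * F (X w))%:E = \int[P]_w (Z w)%:E * \int[P]_w (F (X w))%:E.
Proof.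
move=> mX mZ Z0 H mF F0.
have mFX : measurable_fun setT (F \o X) by exact: measurableT_comp.
have mB t : measurable [set x | (0 <= t < F x)%R].
  have [t0|t0] := leP 0%R t.
    rewrite (_ : [set _ | _] = F @^-1` `]t, +oo[); last first.
      by apply/seteqP; split => x /=; rewrite in_itv/= andbT.
    by rewrite -[X in measurable X]setTI; apply: mF.
  by rewrite (_ : [set _ | _] = set0)//; apply/seteqP; split.
have mXB t : measurable (X @^-1` [set x | (0 <= t < F x)%R]).
  by rewrite -[X in measurable X]setTI; apply: mX.
have FX0 w : (0 <= (F \o X) w)%R by exact: F0.
have m1 : measurable_fun setT (fun _ : T => 1%R : R) by exact: measurable_cst.
have E1 := layer_cake P m1 mFX (fun=> ler01) FX0.
rewrite [LHS](layer_cake P mZ mFX Z0 FX0).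
have -> : \int[P]_w (F (X w))%:E =
    \int[leb]_t P (X @^-1` [set x | (0 <= t < F x)%R]).
  transitivity (\int[P]_w (1 * F (X w))%:E).
    by apply: eq_integral => w _; rewrite mul1r.
  rewrite [LHS]E1.
  apply: eq_integral => t _; under eq_integral do rewrite mul1r.
  by rewrite integral_indic ?setIT//; exact: mXB.
rewrite -ge0_integralZl//.
- by apply: eq_integral => t _; rewrite -H//; exact: mB.
- apply: (eq_measurable_fun (fun t : measurableTypeR R =>
    \int[P]_x (1 * \1_[set x | (0 <= t < F (X x))%R] x)%:E)).
    move=> t _; under eq_integral do rewrite mul1r.
    by rewrite integral_indic ?setIT//; exact: mXB.
  exact: (measurable_layer P m1 mFX).
- by apply: integral_ge0 => w _; rewrite lee_fin.
Qed.

(** Both sides are sliced along the levels of F: on the left with weight 1 under P, on the right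
    with the normal density as weight under Lebesgue measure. *)
Lemma integral_normal_law d (T : measurableType d) (P : probability T R)
    (X : T -> R) (F : R -> R) : measurable_fun setT X ->
  (forall B, measurable B -> P (X @^-1` B) = normal_prob 0%R 1%R B) ->
  measurable_fun setT F -> (forall x, (0 <= F x)%R) ->
  \int[P]_w (F (X w))%:E = \int[leb]_x (normal_pdf 0 1 x * F x)%:E.
Proof.
move=> mX H mF F0.
have mFX : measurable_fun setT (F \o X) by exact: measurableT_comp.
have mB t : measurable [set x | (0 <= t < F x)%R].
  have [t0|t0] := leP 0%R t.
    rewrite (_ : [set _ | _] = F @^-1` `]t, +oo[); last first.
      by apply/seteqP; split => x /=; rewrite in_itv/= andbT.
    by rewrite -[X in measurable X]setTI; apply: mF.
  by rewrite (_ : [set _ | _] = set0)//; apply/seteqP; split.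
transitivity (\int[P]_w (1 * F (X w))%:E).
  by apply: eq_integral => w _; rewrite mul1r.
have mXB t : measurable (X @^-1` [set x | (0 <= t < F x)%R]).
  by rewrite -[X in measurable X]setTI; apply: mX.
have FX0 w : (0 <= (F \o X) w)%R by exact: F0.
have m1 : measurable_fun setT (fun _ : T => 1%R : R) by exact: measurable_cst.
rewrite [LHS](layer_cake P m1 mFX (fun=> ler01) FX0).
rewrite (@layer_cake _ (measurableTypeR R) leb (normal_pdf 0 1) F)//; last 2 first.
- exact: measurable_normal_pdf.
- exact: normal_pdf_ge0.
apply: eq_integral => t _; under eq_integral do rewrite mul1r.
rewrite integral_indic ?setIT//; last exact: mXB.
transitivity (normal_prob 0%R 1%R [set x | (0 <= t < F x)%R]); first exact: H.
rewrite /normal_prob integral_mkcond; apply: eq_integral => x _.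
rewrite patchE indicE; case: ifPn => _; rewrite ?mulr1 ?mulr0//.
Qed.

Lemma normal_mgf d (T : measurableType d) (P : probability T R)
    (X : T -> R) (c : R) : measurable_fun setT X ->
  (forall B, measurable B -> P (X @^-1` B) = normal_prob 0%R 1%R B) ->
  \int[P]_w (expR (c * X w))%:E = (expR (c ^+ 2 / 2))%:E.
Proof.
move=> mX H; rewrite (@integral_normal_law _ _ _ _ (fun x => expR (c * x))%R)//.
(* Completing the square: exp(cx) times the standard density is exp(c^2/2) times the density centred
   at c. *)
- transitivity (\int[leb]_x ((expR (c ^+ 2 / 2))%:E * (normal_pdf c 1 x)%:E)).
    apply: eq_integral => x _; rewrite -EFinM; congr EFin.
    rewrite !normal_pdfE ?oner_neq0// /normal_fun.
    rewrite -mulrA -expRD mulrCA -expRD; congr (_ * expR _)%R.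
    by rewrite expr1n; field.
  rewrite ge0_integralZl//.
  + by rewrite integral_normal_pdf// mule1.
  + apply: measurable_fun_EFin; exact: measurable_normal_pdf.
  + by move=> x _; rewrite lee_fin normal_pdf_ge0.
- apply: (measurableT_comp (f := expR)); first exact: measurable_expR.
  exact: measurable_funM.
Qed.

Lemma independent_normal_mgf d (T : measurableType d) (P : probability T R)
    (I : eqType) (X : I -> T -> R) (c : I -> R) (J : seq I) :
  (forall i, measurable_fun setT (X i)) ->
  (forall i B, measurable B -> P (X i @^-1` B) = normal_prob 0%R 1%R B) ->
  mutually_independent P X -> uniq J ->
  \int[P]_w (expR (\sum_(i <- J) c i * X i w))%:E =
  (expR ((\sum_(i <- J) c i ^+ 2) / 2))%:E.
Proof.
move=> mX lX iX uJ.
pose S J w := (\sum_(i <- J) c i * X i w)%R.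
have mS s : measurable_fun setT (S s).
  by apply: measurable_sum => i; exact: measurable_funM.
have mE s : measurable_fun setT (fun w => expR (S s w)).
  by apply: (measurableT_comp (f := expR)) => //; exact: measurable_expR.
pose C (s : seq I) (B : I -> set R) := \bigcap_(i in [set` s]) (X i @^-1` B i).
have mC s B : (forall i, measurable (B i)) -> measurable (C s B).
  move=> mB; apply: fin_bigcap_measurable; first exact: finite_seq.
  move=> i _.
  by rewrite -[X in measurable X]setTI; apply: mX.
(* The statement is strengthened so that the induction closes: the indices in s1 carry exponentials,
   those in s2 still carry events, and each step turns one event into an exponential. *)
suff H s1 s2 B : (forall i, measurable (B i)) -> uniq (s1 ++ s2) ->
    \int[P]_w (expR (S s1 w) * \1_(C s2 B) w)%:E =
    (expR ((\sum_(i <- s1) c i ^+ 2) / 2))%:E * P (C s2 B).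
  have := H J [::] (fun=> setT) _ _; rewrite cats0 => /(_ _ uJ) E.
  have C0 : C [::] (fun=> setT) = setT by rewrite /C set_nil bigcap_set0.
  rewrite C0 probability_setT mule1 in E.
  rewrite -E//; apply: eq_integral => w _.
  by rewrite indicT mulr1.
elim: s1 s2 B => [|i s1 IH] s2 B mB.
  move=> _; rewrite big_nil mul0r expR0 mul1e.
  under eq_integral do rewrite /S big_nil expR0 mul1r.
  by rewrite integral_indic ?setIT//; exact: mC.
rewrite cat_cons cons_uniq mem_cat negb_or => /andP[/andP[i1 i2] u12].
pose Z w := (expR (S s1 w) * \1_(C s2 B) w)%R.
have -> : \int[P]_w (expR (S (i :: s1) w) * \1_(C s2 B) w)%:E =
    \int[P]_w (Z w * expR (c i * X i w))%:E.
  apply: eq_integral => w _; congr EFin.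
  by rewrite /S big_cons expRD /Z; ring.
rewrite (@independent_integral _ _ P (X i) Z (fun x => expR (c i * x)))//; first last.
- apply: (measurableT_comp (f := expR)); first exact: measurable_expR.
  exact: measurable_funM.
- move=> A mA.
  (* The event {X i in A} joins those of s2, so the induction hypothesis for i :: s2 supplies the
     product rule that [independent_integral] asks for. *)
  pose B' j := if j == i then A else B j.
  have mB' j : measurable (B' j) by rewrite /B'; case: ifP.
  have CE : C (i :: s2) B' = (X i @^-1` A) `&` C s2 B.
    apply/seteqP; split => w.
      move=> hw; split; first by have := hw i (mem_head _ _); rewrite /B' /= eqxx.
      move=> j js; have := hw j; rewrite /B' /= in_cons js orbT ifN; first exact.
      by apply: contraNneq i2 => <-.
    move=> [hi hs] j; rewrite /= in_cons /B'.
    by case: eqP => [-> _|_ /= js]; [exact: hi|exact: hs].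
  have u : uniq (s1 ++ i :: s2).
    by rewrite -cat1s uniq_catCA /= mem_cat negb_or i1 i2.
  rewrite /Z IH//.
  have := IH _ _ mB' u; rewrite CE => E.
  transitivity (\int[P]_w (expR (S s1 w) * \1_(X i @^-1` A `&` C s2 B) w)%:E).
    apply: eq_integral => w _; congr EFin.
    by rewrite indicI /= mulrAC mulrA.
  rewrite E -muleA; congr (_ * _).
  rewrite -CE muleC; rewrite /C (iX _ _ _ mB'); last by rewrite /= i2; move: u12; rewrite cat_uniq => /and3P[].
  rewrite big_cons {1}/B' eqxx; congr (_ * _).
  rewrite (iX _ _ _ mB); last by move: u12; rewrite cat_uniq => /and3P[].
  rewrite big_seq [RHS]big_seq; apply: eq_bigr => j js.
  by rewrite /B' ifN//; apply: contraNneq i2 => <-.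
- by move=> w; rewrite mulr_ge0 ?expR_ge0.
- by apply: measurable_funM => //; apply: measurable_indic; exact: mC.
rewrite /Z IH// (normal_mgf _ (mX i) (lX i)) muleAC -EFinM -expRD.
by congr (EFin (expR _) * _); rewrite big_cons; ring.
Qed.

End LayerCake.

(** * Moments of finite Gaussian sums *)

Section GaussianSums.
Variable R : realType.
Local Notation leb := (@lebesgue_measure R).

Lemma powR_expR_ln (a x : R) : 0 < a -> a `^ x = expR (x * ln a).
Proof. by move=> a0; rewrite /powR gt_eqF. Qed.

Lemma powR_diff_le (q d : R) : 0 < q -> 0 < d ->
  q `^ (- d) - (q + 1) `^ (- d) <= d * q `^ (- d - 1).
Proof.
move=> q0 d0; have q1 : 0 < q + 1 by lra.
have -> : (q + 1) `^ (- d) = q `^ (- d) * (1 + q^-1) `^ (- d).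
  rewrite -powRM ?ltW ?addr_gt0 ?invr_gt0//.
  by congr (_ `^ _); field; rewrite gt_eqF.
have -> : q `^ (- d - 1) = q `^ (- d) * q^-1.
  by rewrite powRD ?(gt_eqF q0) ?implybT// powR_inv1// ltW.
have u0 : 0 < q^-1 by rewrite invr_gt0.
have : 1 - d * q^-1 <= (1 + q^-1) `^ (- d).
  rewrite powR_expR_ln ?addr_gt0//.
  apply: le_trans (expR_ge1Dx _).
  rewrite lerD2l mulNr lerN2 ler_pM2l//.
  by apply: le_ln1Dx; lra.
have p0 : 0 < q `^ (- d) by rewrite powR_gt0.
move=> h; have : q `^ (- d) * (1 - d * q^-1) <= q `^ (- d) * (1 + q^-1) `^ (- d).
  by rewrite ler_pM2l.
lra.
Qed.

Lemma powR_diff_ge (q e : R) : 0 < q -> 0 < e ->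
  e * (q + 1) `^ (- e - 1) <= q `^ (- e) - (q + 1) `^ (- e).
Proof.
move=> q0 e0; have q1 : 0 < q + 1 by lra.
have -> : q `^ (- e) = (q + 1) `^ (- e) * (1 - (q + 1)^-1) `^ (- e).
  rewrite -powRM ?ltW ?subr_gt0 ?invf_lt1//; last by lra.
  by congr (_ `^ _); field; rewrite gt_eqF.
have -> : (q + 1) `^ (- e - 1) = (q + 1) `^ (- e) * (q + 1)^-1.
  by rewrite powRD ?(gt_eqF q1) ?implybT// powR_inv1// ltW.
have u0 : 0 < (q + 1)^-1 by rewrite invr_gt0.
have u1 : (q + 1)^-1 < 1 by rewrite invf_lt1//; lra.
have : 1 + e * (q + 1)^-1 <= (1 - (q + 1)^-1) `^ (- e).
  rewrite powR_expR_ln ?subr_gt0//.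
  apply: le_trans (expR_ge1Dx _).
  rewrite lerD2l mulNr -mulrN ler_pM2l// lerNr.
  by apply: le_ln1Dx; lra.
have p0 : 0 < (q + 1) `^ (- e) by rewrite powR_gt0.
move=> h; have : (q + 1) `^ (- e) * (1 + e * (q + 1)^-1) <=
    (q + 1) `^ (- e) * (1 - (q + 1)^-1) `^ (- e) by rewrite ler_pM2l.
lra.
Qed.

(** Each term is at most e^(-1) times an increment of j^(-e), by [powR_diff_ge], and the increments
    telescope. *)
Lemma zeta_le (e : R) n : 0 < e ->
  \sum_(j < n) j.+1%:R `^ (- e - 1) <= 1 + e^-1.
Proof.
move=> e0; have eV : 0 < e^-1 by rewrite invr_gt0.
case: n => [|n]; first by rewrite big_ord0 addr_ge0// ltW.
suff : \sum_(j < n.+1) j.+1%:R `^ (- e - 1) <= 1 + e^-1 * (1 - n.+1%:R `^ (- e)).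
  move=> /le_trans; apply; by rewrite lerD2l ler_piMr ?(ltW eV)// lerBlDr lerDl powR_ge0.
elim: n => [|n IHn]; first by rewrite big_ord1 !powR1 subrr mulr0 addr0.
rewrite big_ord_recr/=.
have := @powR_diff_ge n.+1%:R e (ltr0Sn _ _) e0.
rewrite natr1 => h.
have : n.+2%:R `^ (- e - 1) <= e^-1 * (n.+1%:R `^ (- e) - n.+2%:R `^ (- e)).
  by rewrite ler_pdivlMl.
rewrite !mulrBr in IHn *; lra.
Qed.

(** Nonnegativity of the variance around m. The weights may sum to less than 1, which only helps
    because the missing mass can be placed at 0. *)
Lemma jensen_sq n (lam t : nat -> R) : (forall j, 0 <= lam j) ->
  \sum_(j < n) lam j <= 1 ->
  (\sum_(j < n) lam j * t j) ^+ 2 <= \sum_(j < n) lam j * t j ^+ 2.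
Proof.
move=> lam0 lam1; set m := \sum_(j < n) _ * t _.
have : 0 <= \sum_(j < n) lam j * (t j - m) ^+ 2.
  by apply: sumr_ge0 => j _; rewrite mulr_ge0 ?sqr_ge0.
have -> : \sum_(j < n) lam j * (t j - m) ^+ 2 =
    \sum_(j < n) lam j * t j ^+ 2 - 2 * m * m + m ^+ 2 * \sum_(j < n) lam j.
  have E k : \sum_(j < n) lam j * (t j - k) ^+ 2 =
      \sum_(j < n) lam j * t j ^+ 2 - 2 * k * (\sum_(j < n) lam j * t j)
      + k ^+ 2 * \sum_(j < n) lam j.
    rewrite !mulr_sumr -sumrB -big_split/=.
    by apply: eq_bigr => j _; ring.
  exact: E.
have : m ^+ 2 * \sum_(j < n) lam j <= m ^+ 2 by rewrite ler_piMr ?sqr_ge0.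
lra.
Qed.

(** Three applications of the inequality for squares; the exponent is a power of two for this
    reason. *)
Lemma jensen_pow8 n (lam t : nat -> R) : (forall j, 0 <= lam j) ->
  \sum_(j < n) lam j <= 1 ->
  (\sum_(j < n) lam j * t j) ^+ 8 <= \sum_(j < n) lam j * t j ^+ 8.
Proof.
move=> lam0 lam1.
have h2 u := @jensen_sq n lam u lam0 lam1.
rewrite (_ : 8 = 2 * 4)%N// exprM.
have p0 u : 0 <= \sum_(j < n) lam j * u j ^+ 2.
  by apply: sumr_ge0 => j _; rewrite mulr_ge0 ?sqr_ge0.
apply: (@le_trans _ _ ((\sum_(j < n) lam j * t j ^+ 2) ^+ 4)).
  by rewrite lerXn2r ?nnegrE ?sqr_ge0.
rewrite (_ : 4 = 2 * 2)%N// exprM.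
apply: (@le_trans _ _ ((\sum_(j < n) lam j * (t j ^+ 2) ^+ 2) ^+ 2)).
  by rewrite lerXn2r ?nnegrE ?sqr_ge0// (h2 (fun j => t j ^+ 2)).
apply: le_trans (h2 (fun j => (t j ^+ 2) ^+ 2)) _.
by apply: ler_sum => j _; rewrite -!exprM.
Qed.

(** For y >= 0, y <= 8 exp(y/8), raised to the eighth power; the other sign follows by symmetry. *)
Lemma pow8_le_expR (y : R) : y ^+ 8 <= 8 ^+ 8 * (expR y + expR (- y)).
Proof.
wlog y0 : y / 0 <= y.
  move=> H; have [/H//|/ltW y0] := leP 0 y.
  have := H (- y); rewrite oppr_ge0 opprK (addrC (expR _)) => /(_ y0).
  by rewrite -[in X in X <= _]mulN1r exprMn -signr_odd/= expr0 mul1r.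
apply: (@le_trans _ _ (8 ^+ 8 * expR y)); last first.
  by rewrite ler_pM2l ?exprn_gt0// lerDl expR_ge0.
have -> : expR y = expR (y / 8) ^+ 8 by rewrite -expRM_natl; congr expR; field.
rewrite -exprMn lerXn2r ?nnegrE ?mulr_ge0 ?expR_ge0//.
by have := expR_ge1Dx (y / 8); lra.
Qed.

Context d (T : measurableType d) (P : probability T R) (X : nat -> T -> R).
Hypotheses (mX : forall i, measurable_fun setT (X i))
  (lX : forall i B, measurable B -> P (X i @^-1` B) = normal_prob 0 1 B)
  (iX : mutually_independent P X).

Definition gauss_sum N (c : nat -> R) (w : T) : R := \sum_(n < N) c n * X n w.

Lemma measurable_gauss_sum N c : measurable_fun setT (gauss_sum N c).
Proof. by apply: measurable_sum => i; exact: measurable_funM. Qed.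

Lemma gauss_sum_mgf N c : (\int[P]_w (expR (gauss_sum N c w))%:E =
  (expR ((\sum_(n < N) c n ^+ 2) / 2))%:E)%E.
Proof.
have := @independent_normal_mgf R _ T P nat X c (index_iota 0 N) mX lX iX
  (iota_uniq _ _).
rewrite big_mkord => <-; apply: eq_integral => w _.
by rewrite /gauss_sum big_mkord.
Qed.

Lemma gauss_sumZ N c a w : a * gauss_sum N c w = gauss_sum N (fun n => a * c n) w.
Proof.
by rewrite /gauss_sum mulr_sumr; apply: eq_bigr => i _; rewrite mulrA.
Qed.

(** The sum of the two exponentials stands for the exponential of the absolute value while remaining
    directly computable. *)
Lemma gauss_sum_abs_mgf N (c : nat -> R) m v : \sum_(n < N) c n ^+ 2 <= v ->
  (\int[P]_w (expR (m * gauss_sum N c w) + expR (- (m * gauss_sum N c w)))%:E <=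
   (2 * expR (m ^+ 2 * v / 2))%:E)%E.
Proof.
move=> cv.
have H e : e ^+ 2 = m ^+ 2 -> (\int[P]_w (expR (e * gauss_sum N c w))%:E <=
    (expR (m ^+ 2 * v / 2))%:E)%E.
  move=> em; under eq_integral do rewrite gauss_sumZ.
  rewrite gauss_sum_mgf lee_fin ler_expR ler_pM2r ?invr_gt0//.
  under eq_bigr do rewrite exprMn em.
  by rewrite -mulr_sumr ler_wpM2l ?sqr_ge0.
have mE e : measurable_fun setT (fun w => (expR (e * gauss_sum N c w))%:E).
  apply: measurable_fun_EFin; apply: (measurableT_comp (f := expR)).
    exact: measurable_expR.
  by apply: measurable_funM => //; exact: measurable_gauss_sum.
under eq_integral do rewrite EFinD -mulNr.
rewrite ge0_integralD//; [|by move=> w _; rewrite lee_fin expR_ge0..].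
rewrite (_ : 2 * _ = expR (m ^+ 2 * v / 2) + expR (m ^+ 2 * v / 2)); last by ring.
by rewrite EFinD leeD// H// sqrrN.
Qed.

(** The sum is normalised by sqrt(v), so that its exponential moment is a pure number and v^4 comes
    out by homogeneity. *)
Lemma gauss_sum_pow8 N (c : nat -> R) v : 0 < v -> \sum_(n < N) c n ^+ 2 <= v ->
  (\int[P]_w (gauss_sum N c w ^+ 8)%:E <=
   (2 * 8 ^+ 8 * expR (1 / 2) * v ^+ 4)%:E)%E.
Proof.
move=> v0 cv; pose s := Num.sqrt v.
have s0 : 0 < s by rewrite sqrtr_gt0.
have s2 : s ^+ 2 = v by rewrite sqr_sqrtr// ltW.
pose g w := expR (s^-1 * gauss_sum N c w) + expR (- (s^-1 * gauss_sum N c w)).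
have mg : measurable_fun setT g.
  have mE e : measurable_fun setT (fun w => expR (e * gauss_sum N c w)).
    apply: (measurableT_comp (f := expR)); first exact: measurable_expR.
    by apply: measurable_funM => //; exact: measurable_gauss_sum.
  apply: measurable_funD => //.
  by under eq_fun do rewrite -mulNr; exact: mE.
apply: (@le_trans _ _ (\int[P]_w ((8 ^+ 8 * v ^+ 4) * g w)%:E)%E).
  apply: ge0_le_integral => //.
  - by move=> w _; rewrite lee_fin exprn_even_ge0.
  - by apply: measurable_fun_EFin; apply: measurable_funX; exact: measurable_gauss_sum.
  - by apply: measurable_fun_EFin; apply: measurable_funM.
  move=> w _; rewrite lee_fin.
  have -> : gauss_sum N c w ^+ 8 = v ^+ 4 * (s^-1 * gauss_sum N c w) ^+ 8.
    rewrite exprMn exprVn -s2 -exprM mulrA divff ?mul1r//.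
    by rewrite expf_neq0// gt_eqF.
  rewrite -[leRHS]mulrA [leRHS]mulrCA ler_wpM2l ?exprn_ge0 ?(ltW v0)//.
  exact: pow8_le_expR.
under eq_integral do rewrite EFinM.
rewrite ge0_integralZl//.
- have := gauss_sum_abs_mgf s^-1 cv.
  rewrite exprVn s2 mulVf ?gt_eqF// => H.
  have -> : (2 * 8 ^+ 8 * expR (1 / 2) * v ^+ 4)%:E =
      ((8 ^+ 8 * v ^+ 4)%:E * (2 * expR (1 / 2))%:E)%E.
    by rewrite -EFinM; congr EFin; ring.
  by rewrite lee_wpmul2l// lee_fin mulr_ge0 ?exprn_ge0 ?ltW.
- exact: measurable_fun_EFin.
- by move=> w _; rewrite lee_fin addr_ge0 ?expR_ge0.
- by rewrite lee_fin mulr_ge0 ?exprn_ge0 ?ltW.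
Qed.

End GaussianSums.

(** * Summation by parts with a single majorant *)

Section AbelSummation.
Variable R : realType.

Let q (j : nat) : R := j.+1%:R.
(** Two constraints meet here. Weighted variances of order n^(2d - 7/5) must be summable, so d <
    1/5; and the boundary term n^(-8d) must be below n^(-11/10), so d >= 11/80. *)
Let d : R := 3 / 20.
Let lam j : R := q j `^ (- d) - q j.+1 `^ (- d).

Let q_gt0 j : 0 < q j. Proof. exact: ltr0Sn. Qed.
Let q_ge1 j : 1 <= q j. Proof. by rewrite ler1n. Qed.
Let d_gt0 : 0 < d. Proof. by rewrite divr_gt0. Qed.

Let lam_ge0 j : 0 <= lam j.
Proof.
rewrite subr_ge0 !powRN lef_pV2 ?posrE ?powR_gt0//.
by apply: ge0_ler_powR; rewrite ?nnegrE ?(ltW d_gt0) ?(ltW (q_gt0 _))// ler_nat.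
Qed.

Let sum_lam n : \sum_(j < n) lam j = 1 - q n `^ (- d).
Proof.
elim: n => [|n IHn]; first by rewrite big_ord0 powR1 subrr.
by rewrite big_ord_recr/= IHn /lam; ring.
Qed.

Let sum_lam_le1 n : \sum_(j < n) lam j <= 1.
Proof. by rewrite sum_lam lerBlDr lerDl powR_ge0. Qed.

Let lam_le j : lam j <= q j `^ (- (11 / 10)).
Proof.
have := powR_diff_le (q_gt0 j) d_gt0.
have -> : q j + 1 = q j.+1 by rewrite /q natr1.
rewrite -/(lam j) => /le_trans; apply.
apply: (@le_trans _ _ (1 * q j `^ (- d - 1))).
  by rewrite ler_wpM2r ?powR_ge0// /d; lra.
by rewrite mul1r ler_powR// /d; lra.
Qed.

(* If (y n)^2 = O(n^(-7/5)), the weight makes the squares summable, since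
   3/10 - 7/5 = -11/10. *)
Definition weighted_sum (y : nat -> R) j : R :=
  \sum_(n < j) (n.+1%:R `^ (3 / 20) * y n).

Definition abel_term (y : nat -> R) j : R :=
  j.+1%:R `^ (- (11 / 10)) * weighted_sum y j.+1 ^+ 8.

(* Summation by parts bounds every partial sum of y by this single quantity. *)
Definition abel_majorant (y : nat -> R) : \bar R :=
  (\sum_(0 <= j <oo) (abel_term y j)%:E)%E.

Variable y : nat -> R.
Local Notation T := (weighted_sum y).
Local Notation Dt := (abel_term y).

Lemma abel_term_ge0 j : 0 <= Dt j.
Proof. by rewrite mulr_ge0 ?powR_ge0// exprn_even_ge0. Qed.

Let abel N : \sum_(n < N) y n = q N `^ (- d) * T N + \sum_(j < N) lam j * T j.+1.
Proof.
elim: N => [|N IHN].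
  by rewrite /weighted_sum !big_ord0 mulr0 addr0.
rewrite big_ord_recr/= IHN [in RHS]big_ord_recr/=.
have TS : T N.+1 = T N + q N `^ d * y N by rewrite /weighted_sum big_ord_recr.
have qK : q N `^ (- d) * (q N `^ d * y N) = y N.
  by rewrite powRN mulKf// gt_eqF// powR_gt0.
rewrite /lam TS -[in LHS]qK; ring.
Qed.

(** The boundary term is absorbed by a single term of the majorant, since 8d = 6/5 exceeds 11/10. *)
Let last_term N : (q N.+1 `^ (- d) * T N.+1) ^+ 8 <= Dt N.
Proof.
rewrite exprMn /abel_term ler_wpM2r ?exprn_even_ge0//.
rewrite -powR_mulrn ?powR_ge0// -powRrM.
apply: (@le_trans _ _ (q N `^ (- (6 / 5)))).
  have -> : - d * 8%:R = - (6 / 5) by rewrite /d; field.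
  rewrite !powRN lef_pV2 ?posrE ?powR_gt0//.
  by apply: ge0_ler_powR; rewrite ?nnegrE ?(ltW (q_gt0 _)) ?ler_nat//; lra.
by rewrite ler_powR//; lra.
Qed.

Let pow8_add (u v : R) : (u + v) ^+ 8 <= 128 * (u ^+ 8 + v ^+ 8).
Proof.
have h (s t : R) : (s + t) ^+ 2 <= 2 * (s ^+ 2 + t ^+ 2).
  by have := sqr_ge0 (s - t); nra.
have h0 (s t : R) : 0 <= 2 * (s ^+ 2 + t ^+ 2).
  by rewrite mulr_ge0// addr_ge0 ?sqr_ge0.
have e8 (s : R) : s ^+ 8 = ((s ^+ 2) ^+ 2) ^+ 2 by rewrite -!exprM.
rewrite !e8.
apply: (@le_trans _ _ ((2 * (2 * ((u ^+ 2) ^+ 2 + (v ^+ 2) ^+ 2)) * 2) ^+ 2)).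
  rewrite lerXn2r ?nnegrE ?sqr_ge0 ?mulr_ge0 ?addr_ge0 ?sqr_ge0//.
  apply: (@le_trans _ _ ((2 * (u ^+ 2 + v ^+ 2)) ^+ 2)).
    by rewrite lerXn2r ?nnegrE ?sqr_ge0.
  rewrite exprMn; have := h (u ^+ 2) (v ^+ 2); lra.
have := h ((u ^+ 2) ^+ 2) ((v ^+ 2) ^+ 2); lra.
Qed.

(** In the identity [abel] the boundary term is below one term of the majorant, and the remaining
    sum is below the majorant by Jensen with the weights [lam]. The constant 256 is twice the 2^7 of
    [pow8_add]. *)
Lemma abel_majorant_ge N :
  (((\sum_(n < N) y n) ^+ 8)%:E <= 256%:E * abel_majorant y)%E.
Proof.
have D0 n : (0 <= (Dt n)%:E)%E by rewrite lee_fin abel_term_ge0.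
case: N => [|N].
  rewrite big_ord0 expr0n/= mule_ge0//; exact: nneseries_ge0.
apply: (@le_trans _ _ (256 * \sum_(j < N.+1) Dt j)%:E).
  rewrite lee_fin abel; apply: le_trans (pow8_add _ _) _.
  have -> : 256 = 128 * 2 :> R by ring.
  rewrite -mulrA ler_pM2l// mulrDl mul1r -[X in _ <= X + _]mul1r.
  apply: lerD.
    apply: le_trans (last_term _) _; rewrite mul1r big_ord_recr/= lerDr.
    by apply: sumr_ge0 => j _; exact: abel_term_ge0.
  apply: le_trans (jensen_pow8 (fun j => T j.+1) lam_ge0 (sum_lam_le1 _)) _.
  apply: ler_sum => j _; rewrite ler_wpM2r ?exprn_even_ge0//; exact: lam_le.
rewrite EFinM lee_pmul2l//.
rewrite -sumEFin -(big_mkord xpredT (fun j => (Dt j)%:E)).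
exact: nneseries_lim_ge.
Qed.

(** A finite majorant has terms tending to 0, which kills the boundary term; and |T| <= 1 + T^8
    makes the series of lam T absolutely convergent. *)
Lemma abel_majorant_cvg : (abel_majorant y < +oo)%E ->
  cvgn (fun N => \sum_(n < N) y n).
Proof.
move=> Dfin.
have D0 n : (0 <= (Dt n)%:E)%E by rewrite lee_fin abel_term_ge0.
have cD : cvgn (series Dt).
  apply: nondecreasing_is_cvgn.
    apply/nondecreasing_seqP => n.
    by rewrite /series/= big_nat_recr//= lerDl abel_term_ge0.
  exists (fine (abel_majorant y)) => _ [n _ <-].
  rewrite -lee_fin fineK; last first.
    by rewrite ge0_fin_numE//; exact: nneseries_ge0.
  by rewrite /series/= -sumEFin; exact: nneseries_lim_ge.
have D_0 : Dt n @[n --> \oo] --> (0 : R) := cvg_series_cvg_0 cD.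
have l_0 : q N.+1 `^ (- d) * T N.+1 @[N --> \oo] --> (0 : R).
  apply/cvgr0Pnorm_lt => e e0.
  have e8 : 0 < e ^+ 8 by rewrite exprn_gt0.
  have /cvgr0Pnorm_lt/(_ _ e8) := D_0.
  apply: filterS => N; rewrite ger0_norm ?abel_term_ge0// => DN.
  rewrite -(ltr_pXn2r (n := 8))// ?nnegrE ?(ltW e0)//.
  apply: le_lt_trans DN; apply: le_trans (last_term _).
  by rewrite -normrX ger0_norm// exprn_even_ge0.
have clam : cvgn (series lam).
  apply: nondecreasing_is_cvgn.
    apply/nondecreasing_seqP => n.
    by rewrite /series/= big_nat_recr//= lerDl lam_ge0.
  by exists 1 => _ [n _ <-]; rewrite /series/= big_mkord sum_lam_le1.
have cS : cvgn (series (fun j => lam j * T j.+1)).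
  apply: normed_cvg.
  apply: (@series_le_cvg _ _ (fun j => lam j + Dt j)).
  - by move=> n /=.
  - by move=> n; rewrite addr_ge0 ?lam_ge0 ?abel_term_ge0.
  - move=> n /=; rewrite normrM ger0_norm ?lam_ge0//.
    apply: (@le_trans _ _ (lam n * (1 + T n.+1 ^+ 8))).
      rewrite ler_wpM2l ?lam_ge0//.
      have [h|h] := leP `|T n.+1| 1.
        by apply: le_trans h _; rewrite lerDl exprn_even_ge0.
      rewrite -(ger0_norm (x := T n.+1 ^+ 8)) ?exprn_even_ge0// normrX.
      apply: (@le_trans _ _ (`|T n.+1| ^+ 8)); last by rewrite lerDr.
      by rewrite ler_eXnr// ltW.
    rewrite mulrDr mulr1 lerD2l ler_wpM2r ?exprn_even_ge0//; exact: lam_le.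
  - rewrite (_ : series _ = series lam + series Dt).
      exact: is_cvgD.
    by apply/funext => n; rewrite /series/= !fctE/= big_split.
apply/cvg_ex; case/cvg_ex : cS => L cL; exists (0 + L).
rewrite -cvg_shiftS /=.
have cL' : [sequence series (fun j => lam j * T j.+1) n.+1]_n @ \oo --> L.
  by rewrite cvg_shiftS.
rewrite (_ : (fun N => _) = (fun N => q N.+1 `^ (- d) * T N.+1 +
    series (fun j => lam j * T j.+1) N.+1)); first exact: cvgD.
by apply/funext => N; rewrite abel /series/= big_mkord.
Qed.

End AbelSummation.

(** * Expected size of the majorant of a Gaussian series *)

Section MajorantMoment.
Variable R : realType.
Context d (Omega : measurableType d) (P : probability Omega R).
Variable X : nat -> Omega -> R.
Hypotheses (mX : forall i, measurable_fun setT (X i))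
  (lX : forall i B, measurable B -> P (X i @^-1` B) = normal_prob 0 1 B)
  (iX : mutually_independent P X).
Context d' (D : measurableType d') (nu : {finite_measure set D -> \bar R}).
Variables (a : nat -> D -> R) (A : R) (rho : D -> R).
Hypotheses (ma : forall n, measurable_fun setT (a n)) (A0 : 0 < A)
  (rho1 : forall x, 1 <= rho x) (mrho : measurable_fun setT rho).
Hypothesis a_le : forall n x,
  a n x ^+ 2 <= A * n.+1%:R `^ (- (7 / 5)) * rho x `^ (2 / 5).
Hypothesis rho_int : (\int[nu]_x (rho x `^ (8 / 5))%:E < +oo)%E.

Let y x w n := a n x * X n w.

Let TE j x w : weighted_sum (y x w) j =
  gauss_sum X j (fun n => n.+1%:R `^ (3 / 20) * a n x) w.
Proof. by apply: eq_bigr => n _; rewrite /y mulrA. Qed.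

(** The exponents add up to 3/10 - 7/5 = -1/10 - 1, and [zeta_le] with e = 1/10 gives the factor 1 +
    10 = 11. *)
Let var_le j x : \sum_(n < j) (n.+1%:R `^ (3 / 20) * a n x) ^+ 2 <=
  11 * A * rho x `^ (2 / 5).
Proof.
apply: (@le_trans _ _ (\sum_(n < j) A * rho x `^ (2 / 5) * n.+1%:R `^ (- (1 / 10) - 1))).
  apply: ler_sum => n _; rewrite exprMn.
  apply: (@le_trans _ _ ((n.+1%:R `^ (3 / 20)) ^+ 2 *
      (A * n.+1%:R `^ (- (7 / 5)) * rho x `^ (2 / 5)))).
    by rewrite ler_wpM2l ?sqr_ge0.
  have -> : (n.+1%:R `^ (- (1 / 10) - 1) : R) =
      (n.+1%:R `^ (3 / 20)) ^+ 2 * n.+1%:R `^ (- (7 / 5)).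
    rewrite -powR_mulrn ?powR_ge0// -powRrM -powRD ?pnatr_eq0 ?implybT//.
    by congr (_ `^ _); field.
  by rewrite le_eqVlt; apply/orP; left; apply/eqP; ring.
rewrite -mulr_sumr mulrC -mulrA ler_wpM2r ?mulr_ge0 ?powR_ge0 ?(ltW A0)//.
have /(zeta_le j) : 0 < 1 / 10 :> R by rewrite divr_gt0.
move=> /le_trans; apply; lra.
Qed.

Lemma measurable_series_majorant :
  measurable_fun setT (fun p : D * Omega => abel_majorant (y p.1 p.2)).
Proof.
apply: ge0_emeasurable_sum => [j p _ _|j _].
  by rewrite lee_fin abel_term_ge0.
apply: measurable_fun_EFin; apply: measurable_funM => //.
apply: measurable_funX; apply: measurable_sum => n.
apply: measurable_funM => //; apply: measurable_funM.
- by apply: measurableT_comp => //; exact: measurable_fst.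
- by apply: measurableT_comp => //; exact: measurable_snd.
Qed.

Let C : R := 2 * 8 ^+ 8 * expR (1 / 2) * (11 * A) ^+ 4.

Let C_ge0 : 0 <= C.
Proof.
have A4 : 0 <= (11 * A) ^+ 4 by rewrite exprn_even_ge0.
by rewrite /C mulr_ge0// mulr_ge0 ?expR_ge0// mulr_ge0 ?exprn_ge0.
Qed.

(** The eighth moment is the fourth power of the variance, so rho^(2/5) becomes rho^(8/5). The
    second factor 11 is again [zeta_le], applied to the weights j^(-11/10). *)
Let moment x : (\int[P]_w abel_majorant (y x w) <= (11 * C * rho x `^ (8 / 5))%:E)%E.
Proof.
have mt j : measurable_fun setT (fun w => (abel_term (y x w) j)%:E).
  apply: measurable_fun_EFin; apply: measurable_funM => //.
  apply: measurable_funX; under eq_fun do rewrite TE.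
  exact: measurable_gauss_sum.
rewrite integral_nneseries//; last by move=> j w _; rewrite lee_fin abel_term_ge0.
have r0 : 0 < rho x by apply: lt_le_trans (rho1 x).
have v0 : 0 < 11 * A * rho x `^ (2 / 5) by rewrite mulr_gt0 ?powR_gt0// mulr_gt0.
have H j : (\int[P]_w (abel_term (y x w) j)%:E <=
    (C * rho x `^ (8 / 5) * j.+1%:R `^ (- (1 / 10) - 1))%:E)%E.
  under eq_integral do rewrite /abel_term TE EFinM.
  rewrite ge0_integralZl//.
  - have := gauss_sum_pow8 mX lX iX
      (c := fun n => n.+1%:R `^ (3 / 20) * a n x) v0 (var_le j.+1 x).
    move=> /(@lee_wpmul2l _ (j.+1%:R `^ (- (11 / 10)))%:E) => /(_ _) h.
    apply: le_trans (h _) _; first by rewrite lee_fin powR_ge0.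
    rewrite -EFinM lee_fin le_eqVlt; apply/orP; left; apply/eqP.
    rewrite exprMn.
    have -> : rho x `^ (2 / 5) ^+ 4 = rho x `^ (8 / 5).
      by rewrite -powR_mulrn ?powR_ge0// -powRrM; congr (_ `^ _); field.
    have -> : - (1 / 10) - 1 = - (11 / 10) :> R by field.
    by rewrite /C; ring.
  - apply: measurable_fun_EFin; apply: measurable_funX; exact: measurable_gauss_sum.
  - by move=> w _; rewrite lee_fin exprn_even_ge0.
apply: lime_le.
  by apply: is_cvg_nneseries => j _ _; apply: integral_ge0 => w _; rewrite lee_fin abel_term_ge0.
apply: nearW => n.
apply: (@le_trans _ _ (\sum_(0 <= j < n)
    (C * rho x `^ (8 / 5) * j.+1%:R `^ (- (1 / 10) - 1))%:E)%E).
  by apply: lee_sum.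
rewrite sumEFin lee_fin big_mkord -mulr_sumr.
rewrite -[11 * C * _]mulrA [leRHS]mulrC ler_wpM2l ?(mulr_ge0 C_ge0) ?powR_ge0//.
have /(zeta_le n) : 0 < 1 / 10 :> R by rewrite divr_gt0.
move=> /le_trans; apply; lra.
Qed.

Lemma series_majorant_integrable :
  (\int[P]_w \int[nu]_x abel_majorant (y x w) < +oo)%E.
Proof.
have D0 (p : D * Omega) : (0 <= abel_majorant (y p.1 p.2))%E.
  by apply: nneseries_ge0 => j _ _; rewrite lee_fin abel_term_ge0.
have := fubini_tonelli (m1 := nu) (m2 := P) _ measurable_series_majorant D0.
move=> /= <-.
apply: (@le_lt_trans _ _ (\int[nu]_x ((11 * C)%:E * (rho x `^ (8 / 5))%:E))%E).
  apply: ge0_le_integral => //.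
  - by move=> x _; apply: integral_ge0 => w _; exact: (D0 (x, w)).
  - exact: (measurable_fun_fubini_tonelli_F _ measurable_series_majorant D0).
  - apply: emeasurable_funM => //; apply: measurable_fun_EFin.
    by apply: (measurableT_comp (f := fun t : R => t `^ (8 / 5))).
rewrite ge0_integralZl//.
- by rewrite lte_mul_pinfty// lee_fin mulr_ge0.
- apply: measurable_fun_EFin.
  by apply: (measurableT_comp (f := fun t : R => t `^ (8 / 5))).
- by move=> x _; rewrite lee_fin powR_ge0.
- by rewrite lee_fin mulr_ge0.
Qed.

End MajorantMoment.

(** * Exponential moments *)

Section OrthonormalSums.
Variable R : realType.

Lemma cauchy_schwarz_sum M (a b : nat -> R) :
  (\sum_(n < M) a n * b n) ^+ 2 <=
  (\sum_(n < M) a n ^+ 2) * \sum_(n < M) b n ^+ 2.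
Proof.
set Sab := \sum_(n < M) a n * b n; set Saa := \sum_(n < M) a n ^+ 2.
set Sbb := \sum_(n < M) b n ^+ 2.
have Sbb0 : 0 <= Sbb by apply: sumr_ge0 => n _; exact: sqr_ge0.
have E p q : \sum_(n < M) (a n * p - b n * q) ^+ 2 =
    p ^+ 2 * Saa - 2 * p * q * Sab + q ^+ 2 * Sbb.
  rewrite /Saa /Sab /Sbb !mulr_sumr -sumrB -big_split/=.
  by apply: eq_bigr => n _; ring.
have [Sbbp|Sbbn] := ltP 0 Sbb; last first.
  have Sbb_0 : Sbb = 0 by apply/eqP; rewrite eq_le Sbbn.
  suff -> : Sab = 0 by rewrite expr0n/= Sbb_0 mulr0.
  apply: big1 => n _; move/eqP: Sbb_0; rewrite psumr_eq0; last first.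
    by move=> i _; exact: sqr_ge0.
  by move=> /allP/(_ n (mem_index_enum _)); rewrite sqrf_eq0 => /eqP ->; rewrite mulr0.
have : 0 <= \sum_(n < M) (a n * Sbb - b n * Sab) ^+ 2.
  by apply: sumr_ge0 => n _; exact: sqr_ge0.
rewrite E.
have -> : Sbb ^+ 2 * Saa - 2 * Sbb * Sab * Sab + Sab ^+ 2 * Sbb =
    Sbb * (Saa * Sbb - Sab ^+ 2) by ring.
by rewrite pmulr_rge0// subr_ge0.
Qed.

Context d (D : measurableType d) (nu : {finite_measure set D -> \bar R}).

Lemma bounded_integrable (f : D -> R) b : measurable_fun setT f ->
  (forall x, `|f x| <= b) -> nu.-integrable setT (EFin \o f).
Proof.
move=> mf fb; apply: measurable_bounded_integrable => //.
  by rewrite -ge0_fin_numE// fin_num_measure.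
by exists b; split; [exact: num_real|move=> x bx y _]; rewrite /= (le_trans (fb y))// ltW.
Qed.

Variables (E : nat -> D -> R) (beta : nat -> R).
Hypotheses (mE : forall n, measurable_fun setT (E n))
  (Eb : forall n x, `|E n x| <= beta n)
  (onE : forall n m, (\int[nu]_x (E n x * E m x)%:E = ((n == m)%:R)%:E)%E).

Definition ortho_sum M (u : nat -> R) x : R := \sum_(n < M) u n * E n x.

Lemma measurable_ortho_sum M u : measurable_fun setT (ortho_sum M u).
Proof. by apply: measurable_sum => n; exact: measurable_funM. Qed.

Lemma ortho_sum_le M u x : `|ortho_sum M u x| <= \sum_(n < M) `|u n| * beta n.
Proof.
apply: le_trans (ler_norm_sum _ _ _) _; apply: ler_sum => n _.
by rewrite normrM ler_wpM2l.
Qed.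

Lemma EE_integrable n m (k : R) :
  nu.-integrable setT (fun x => (k * (E n x * E m x))%:E).
Proof.
apply: (@bounded_integrable (fun x => k * (E n x * E m x)) (`|k| * (beta n * beta m))).
  by apply: measurable_funM => //; exact: measurable_funM.
by move=> x; rewrite !normrM ler_wpM2l// ler_pM.
Qed.

Lemma ortho_sum_norm M u :
  (\int[nu]_x (ortho_sum M u x ^+ 2)%:E = (\sum_(n < M) u n ^+ 2)%:E)%E.
Proof.
transitivity (\int[nu]_x (\sum_(i < M) \sum_(j < M)
    (u i * u j * (E i x * E j x))%:E))%E.
  apply: eq_integral => x _; rewrite expr2 /ortho_sum big_distrlr/= -sumEFin.
  apply: eq_bigr => i _; rewrite -sumEFin; apply: eq_bigr => j _.
  by congr EFin; ring.
rewrite integral_sum//; last first.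
  move=> i; apply: integrable_sum => //= j *.
  exact: (EE_integrable i j (u i * u j)).
rewrite -sumEFin; apply: eq_bigr => i _.
rewrite integral_sum//; last by move=> j; exact: (EE_integrable i j (u i * u j)).
rewrite (bigD1 i)//= big1 ?adde0 => [|j ji].
  under eq_integral do rewrite EFinM.
  rewrite integralZl//.
    by rewrite onE eqxx mule1 expr2.
  by have := EE_integrable i i 1; under eq_fun do rewrite mul1r.
under eq_integral do rewrite EFinM.
rewrite integralZl//.
  rewrite onE (_ : _ == _ = false) ?mule0//.
  by apply/negP => /eqP/val_inj ij; rewrite ij eqxx in ji.
by have := EE_integrable i j 1; under eq_fun do rewrite mul1r.
Qed.

Variables (z : nat -> R) (c B : R) (rho : D -> R).
Hypotheses (c01 : 0 < c <= 1) (zc : forall n, c * n.+1%:R <= z n) (B0 : 0 < B)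
  (rho1 : forall x, 1 <= rho x)
  (Ez : forall n x, E n x ^+ 2 <= B * z n)
  (Erho : forall n x, E n x ^+ 2 <= B * rho x).

Let c0 : 0 < c. Proof. by case/andP: c01. Qed.

Definition low (L : nat) (u : nat -> R) n : R := if z n <= L%:R then u n else 0.
Definition high (L : nat) (u : nat -> R) n : R := if z n <= L%:R then 0 else u n.

Lemma low_high M L u x :
  ortho_sum M u x = ortho_sum M (low L u) x + ortho_sum M (high L u) x.
Proof.
rewrite /ortho_sum -big_split/=; apply: eq_bigr => n _.
by rewrite /low /high; case: ifP => _; rewrite mul0r ?addr0 ?add0r.
Qed.

Lemma count_le M (t : R) : 0 <= t ->
  \sum_(n < M) (if n.+1%:R <= t then 1 else 0) <= t.
Proof.
move=> t0; suff : \sum_(n < M) (if n.+1%:R <= t then 1 else 0) <= Num.min M%:R t.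
  by move=> /le_trans; apply; rewrite ge_min lexx orbT.
elim: M => [|M IHM]; first by rewrite big_ord0 le_min lexx.
rewrite big_ord_recr/= le_min; move: IHM; rewrite le_min => /andP[h1 h2].
case: (leP M.+1%:R t) => [Mt|Mt] /=.
  have h : \sum_(i < M) (if i.+1%:R <= t then 1 else 0) + 1 <= M.+1%:R :> R.
    by rewrite -natr1 lerD2r.
  by rewrite h (le_trans h).
by rewrite addr0 h2 andbT (le_trans h1)// ler_nat.
Qed.

(** At most L / c indices satisfy z n <= L and each contributes at most B L, so Cauchy-Schwarz
    against the energy K gives a square of order L^2. *)
Lemma low_sup M L (u : nat -> R) K x : \sum_(n < M) u n ^+ 2 <= K ->
  ortho_sum M (low L u) x ^+ 2 <= K * (B / c) * L%:R ^+ 2.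
Proof.
move=> uK; pose F n := if z n <= L%:R then E n x else 0.
have -> : ortho_sum M (low L u) x = \sum_(n < M) u n * F n.
  apply: eq_bigr => n _; rewrite /low /F; case: ifP => //.
  by rewrite mul0r mulr0.
apply: le_trans (cauchy_schwarz_sum _ _ _) _.
rewrite -mulrA ler_pM//; first by apply: sumr_ge0 => n _; exact: sqr_ge0.
  by apply: sumr_ge0 => n _; exact: sqr_ge0.
apply: (@le_trans _ _ (\sum_(n < M) B * L%:R * (if n.+1%:R <= L%:R / c then 1 else 0))).
  apply: ler_sum => n _; rewrite /F; case: ifPn => zL; last first.
    by rewrite expr0n/= mulr_ge0 ?mulr_ge0 ?(ltW B0)//; case: ifP.
  have -> : n.+1%:R <= L%:R / c.
    by rewrite ler_pdivlMr// mulrC (le_trans (zc n) zL).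
  rewrite mulr1.
  by apply: le_trans (Ez _ _) _; rewrite ler_pM2l.
rewrite -mulr_sumr.
have -> : B / c * L%:R ^+ 2 = B * L%:R * (L%:R / c).
  by field; rewrite gt_eqF.
rewrite ler_wpM2l ?mulr_ge0 ?(ltW B0)//.
by apply: count_le; rewrite divr_ge0// ltW.
Qed.

Lemma tail_inv_sq M (L : nat) : (0 < L)%N ->
  \sum_(n < M) (if z n <= L%:R then 0 else (z n)^-1 ^+ 2) <= (1 + c^-1 ^+ 2) / L%:R.
Proof.
move=> L0; have L0' : 0 < L%:R :> R by rewrite ltr0n.
pose t n := if z n <= L%:R then 0 else (z n)^-1 ^+ 2.
have t0 n : 0 <= t n by rewrite /t; case: ifP => // _; exact: sqr_ge0.
have zp n : 0 < z n by apply: lt_le_trans (zc n); rewrite mulr_gt0.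
have t1 n : t n <= L%:R^-1 ^+ 2.
  rewrite /t; case: ifPn => [_|]; first by rewrite sqr_ge0.
  rewrite -ltNge => Lz; rewrite lerXn2r ?nnegrE ?invr_ge0 ?(ltW L0') ?(ltW (zp _))//.
  by rewrite lef_pV2 ?posrE// ltW.
have t2 n : t n <= c^-1 ^+ 2 * (n.+1%:R^-1 ^+ 2).
  rewrite /t; case: ifPn => [_|_]; first by rewrite mulr_ge0 ?sqr_ge0.
  rewrite -exprMn -invfM lerXn2r ?nnegrE ?invr_ge0 ?mulr_ge0 ?(ltW c0) ?(ltW (zp _))//.
  by rewrite lef_pV2 ?posrE ?mulr_gt0.
(* The first L terms are bounded by 1/L^2 each and total 1/L; the later ones are bounded by (c
   n)^(-2), whose sum telescopes. *)
have H N : \sum_(n < L + N) t n <=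
    L%:R^-1 + c^-1 ^+ 2 * (L%:R^-1 - (L + N)%:R^-1).
  elim: N => [|N IHN].
    rewrite addn0 subrr mulr0 addr0.
    apply: (@le_trans _ _ (\sum_(n < L) L%:R^-1 ^+ 2)); first exact: ler_sum.
    rewrite sumr_const card_ord -[leLHS]mulr_natl le_eqVlt; apply/orP; left.
    by apply/eqP; field; rewrite gt_eqF.
  rewrite addnS big_ord_recr/=.
  have LN0 : 0 < (L + N)%:R :> R by rewrite ltr0n addn_gt0 L0.
  have : (L + N).+1%:R^-1 ^+ 2 <= (L + N)%:R^-1 - (L + N).+1%:R^-1 :> R.
    have -> : (L + N)%:R^-1 - (L + N).+1%:R^-1 = ((L + N)%:R * (L + N).+1%:R)^-1 :> R.
      rewrite -natr1; field; rewrite gt_eqF//= gt_eqF//; lra.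
    rewrite expr2 -invfM lef_pV2 ?posrE ?mulr_gt0//.
    by rewrite ler_pM2r// ler_nat.
  have := t2 (L + N)%N.
  have cV : 0 <= c^-1 ^+ 2 by exact: sqr_ge0.
  move=> h1 /(ler_wpM2l cV) h2.
  apply: le_trans (lerD IHN (le_trans h1 h2)) _.
  rewrite -addrA lerD2l -mulrDr ler_wpM2l//.
  by rewrite addrA subrK.
apply: (@le_trans _ _ (\sum_(n < L + M) t n)).
  rewrite -(big_mkord xpredT t) -(big_mkord xpredT (fun n => t n)).
  by rewrite [leRHS](@big_cat_nat _ _ _ M) ?leq_addl//= lerDl sumr_ge0.
apply: le_trans (H M) _.
rewrite mulrDl mul1r lerD2l ler_wpM2l ?sqr_ge0//.
by rewrite lerBlDr lerDl invr_ge0.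
Qed.

(** The gain 1/L is the tail of the sum of z_n^(-2); here the eigenfunctions are bounded by [rho],
    without any power of z_n. *)
Lemma high_variance M (L : nat) x : (0 < L)%N ->
  \sum_(n < M) (high L (fun n => (Num.sqrt 2 * z n)^-1) n * E n x) ^+ 2 <=
  B * (1 + c^-1 ^+ 2) / 2 * rho x / L%:R.
Proof.
move=> L0.
apply: (@le_trans _ _ (\sum_(n < M) B * rho x / 2 *
    (if z n <= L%:R then 0 else (z n)^-1 ^+ 2))).
  apply: ler_sum => n _; rewrite exprMn /high; case: ifP => _.
    by rewrite expr0n/= mul0r mulr0.
  rewrite invfM exprMn [(Num.sqrt 2)^-1 ^+ 2]exprVn sqr_sqrtr//.
  have -> : B * rho x / 2 * (z n)^-1 ^+ 2 = (z n)^-1 ^+ 2 / 2 * (B * rho x) by ring.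
  rewrite [2^-1 * _]mulrC.
  by rewrite ler_wpM2l// divr_ge0// sqr_ge0.
rewrite -mulr_sumr.
have -> : B * (1 + c^-1 ^+ 2) / 2 * rho x / L%:R =
  B * rho x / 2 * ((1 + c^-1 ^+ 2) / L%:R) by ring.
rewrite ler_wpM2l ?tail_inv_sq//.
by rewrite divr_ge0// mulr_ge0// ?(ltW B0)// (le_trans _ (rho1 x)).
Qed.

End OrthonormalSums.

Section PowerInequalities.
Variable R : realType.

Lemma powR_le_expR (b x : R) : 0 < b -> 0 <= x -> x `^ b <= expR (b * x).
Proof.
move=> b0; rewrite le_eqVlt => /predU1P[<-|x0].
  by rewrite powR0 ?expR_ge0// gt_eqF.
rewrite powR_expR_ln// ler_expR ler_pM2l//.
rewrite -ler_expR lnK ?posrE//; apply: le_trans (expR_ge1Dx x); lra.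
Qed.

Lemma powR_add_le (b s t : R) : 0 < b ->
  `|s + t| `^ b <= 2 `^ b * (`|s| `^ b + `|t| `^ b).
Proof.
move=> b0.
have H (x y : R) : `|x| <= `|y| -> `|x + y| `^ b <= 2 `^ b * `|y| `^ b.
  move=> xy; rewrite -powRM//; apply: ge0_ler_powR; rewrite ?nnegrE ?(ltW b0)//.
  by apply: le_trans (ler_normD _ _) _; lra.
have [st|/ltW ts] := leP `|s| `|t|.
  by apply: le_trans (H _ _ st) _; rewrite ler_wpM2l ?powR_ge0// lerDr powR_ge0.
rewrite addrC; apply: le_trans (H _ _ ts) _.
by rewrite ler_wpM2l ?powR_ge0// lerDl powR_ge0.
Qed.

(* For |U| > l the factor e^(l (|U| - l)) >= 1 has been inserted into |U|^b <= e^(b |U|). *)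
Lemma powR_truncate (b l U : R) : 0 < b -> 0 <= l ->
  `|U| `^ b <= l `^ b + expR (- l ^+ 2) * (expR ((b + l) * U) + expR (- ((b + l) * U))).
Proof.
move=> b0 l0; have p0 x y : 0 <= expR x * y -> 0 <= expR x * y by [].
have [Ul|lU] := leP `|U| l.
  apply: (@le_trans _ _ (l `^ b)).
    by apply: ge0_ler_powR; rewrite ?nnegrE ?(ltW b0).
  by rewrite lerDl mulr_ge0 ?addr_ge0 ?expR_ge0.
apply: (@le_trans _ _ (expR (- l ^+ 2) * expR ((b + l) * `|U|))); last first.
  apply: ler_wpDl; first exact: powR_ge0.
  rewrite ler_wpM2l ?expR_ge0//.
  case: (ler0P U) => _; first by rewrite mulrN lerDr expR_ge0.
  by rewrite lerDl expR_ge0.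
apply: le_trans (powR_le_expR b0 (normr_ge0 _)) _.
rewrite -expRD ler_expR.
have -> : - l ^+ 2 + (b + l) * `|U| = b * `|U| + l * (`|U| - l) by ring.
by rewrite lerDl mulr_ge0// subr_ge0 ltW.
Qed.

End PowerInequalities.

(** * Tail of the L^b mass on an L^2 ball *)

Section ExponentialTail.
Variable R : realType.
Context d (Omega : measurableType d) (P : probability Omega R).
Variable X : nat -> Omega -> R.
Hypotheses (mX : forall i, measurable_fun setT (X i))
  (lX : forall i B, measurable B -> P (X i @^-1` B) = normal_prob 0 1 B)
  (iX : mutually_independent P X).
Context d' (D : measurableType d') (nu : {finite_measure set D -> \bar R}).
Variables (E : nat -> D -> R) (beta : nat -> R).
Hypotheses (mE : forall n, measurable_fun setT (E n))
  (Eb : forall n x, `|E n x| <= beta n)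
  (onE : forall n m, (\int[nu]_x (E n x * E m x)%:E = ((n == m)%:R)%:E)%E).
Variables (z : nat -> R) (c B : R) (rho : D -> R).
Hypotheses (c01 : 0 < c <= 1) (zc : forall n, c * n.+1%:R <= z n) (B0 : 0 < B)
  (rho1 : forall x, 1 <= rho x) (mrho : measurable_fun setT rho)
  (Ez : forall n x, E n x ^+ 2 <= B * z n)
  (Erho : forall n x, E n x ^+ 2 <= B * rho x).
Variable b : R.
Hypotheses (b24 : 2 < b < 4)
  (rho_int : (\int[nu]_x (rho x `^ (b / 2))%:E < +oo)%E).

Definition series_coef (w : Omega) (n : nat) : R := (Num.sqrt 2 * z n)^-1 * X n w.
Local Notation u := series_coef.

Definition energy M w : R := \sum_(n < M) u w n ^+ 2.
Definition lp_mass M w : \bar R :=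
  (\int[nu]_x (`|ortho_sum E M (u w) x| `^ b)%:E)%E.

Let b2 : 2 < b. Proof. by case/andP: b24. Qed.
Let b4 : b < 4. Proof. by case/andP: b24. Qed.
Let b0 : 0 < b. Proof. exact: lt_trans b2. Qed.
Let c0 : 0 < c. Proof. by case/andP: c01. Qed.
Let th := b - 2.
(** With Q of order L^(-b/2), the requirement that Q l^b be of order L^th forces l^2 to be of order
    L^(3 - 4/b). *)
Let gam := 3 - 4 / b.
Let C2 := B * (1 + c^-1 ^+ 2) / 2.
Let C2_gt0 : 0 < C2.
Proof. by rewrite divr_gt0// mulr_gt0// ltr_wpDr ?sqr_ge0. Qed.
Let I := fine (\int[nu]_x (rho x `^ (b / 2))%:E)%E.
Let IE : (\int[nu]_x (rho x `^ (b / 2))%:E)%E = I%:E.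
Proof.
by rewrite fineK// ge0_fin_numE// integral_ge0// => x _; rewrite lee_fin powR_ge0.
Qed.
Let I_ge0 : 0 <= I.
Proof. by rewrite fine_ge0// integral_ge0// => x _; rewrite lee_fin powR_ge0. Qed.
(** The integral I may be 0 for an abstract measure, whereas c3 divides by it; hence the shift. *)
Let I' := I + 1.
Let I'_gt0 : 0 < I'. Proof. by rewrite ltr_wpDl. Qed.
(** The constant is calibrated so that Q l^b I' is exactly half of L^th, as [lb] records. *)
Let c3 := (2 * C2 `^ (b / 2) * I')^-1 `^ b^-1.
Let c3_gt0 : 0 < c3.
Proof. by rewrite powR_gt0// invr_gt0 !mulr_gt0// powR_gt0. Qed.

Section fixed_scale.
Variables (M L : nat).
Hypothesis L0 : (0 < L)%N.
Let Lp : 0 < L%:R :> R. Proof. by rewrite ltr0n. Qed.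
Let L1 : 1 <= L%:R :> R. Proof. by rewrite ler1n. Qed.
Let l := c3 * L%:R `^ (gam / 2).
Let l_gt0 : 0 < l. Proof. by rewrite mulr_gt0// powR_gt0. Qed.
Let Q := (C2 / L%:R) `^ (b / 2).
Let Q_gt0 : 0 < Q. Proof. by rewrite powR_gt0// divr_gt0. Qed.

Let lb : Q * (l `^ b * I') = L%:R `^ th / 2.
Proof.
have c3b : c3 `^ b = (2 * C2 `^ (b / 2) * I')^-1.
  by rewrite /c3 -powRrM mulVf ?gt_eqF// powRr1// invr_ge0 !mulr_ge0 ?powR_ge0 ?ltW.
have e1 : L%:R `^ (gam / 2 * b) = L%:R `^ th * L%:R `^ (b / 2) :> R.
  rewrite -powRD ?(gt_eqF Lp) ?implybT//; congr (_ `^ _).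
  by rewrite /gam /th; field; rewrite gt_eqF.
have Lb : L%:R `^ (b / 2) != 0 :> R by rewrite gt_eqF ?powR_gt0.
have Cb : C2 `^ (b / 2) != 0 by rewrite gt_eqF ?powR_gt0.
have -> : l `^ b = (2 * C2 `^ (b / 2) * I')^-1 * (L%:R `^ th * L%:R `^ (b / 2)).
  by rewrite /l powRM ?powR_ge0 ?(ltW c3_gt0)// c3b -powRrM e1.
have -> : Q = C2 `^ (b / 2) / L%:R `^ (b / 2).
  rewrite /Q powRM ?invr_ge0 ?(ltW Lp) ?(ltW C2_gt0)//; congr (_ * _).
  by rewrite -(powR_inv1 (ltW Lp)) -powRrM mulN1r powRN.
by field; rewrite Lb Cb gt_eqF.
Qed.

Let v x := C2 * rho x / L%:R.
Let v_gt0 x : 0 < v x.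
Proof. by rewrite divr_gt0// mulr_gt0// (lt_le_trans ltr01). Qed.
Let kap n := high z L (fun n => (Num.sqrt 2 * z n)^-1) n.
(** Coefficients of the high-frequency part divided by its standard deviation bound, so that U below
    has variance at most 1 at every point. *)
Let hi x n := (Num.sqrt (v x))^-1 * (kap n * E n x).
Let U x w := gauss_sum X M (hi x) w.

Let U_var x : \sum_(n < M) hi x n ^+ 2 <= 1.
Proof.
under eq_bigr do rewrite exprMn exprVn sqr_sqrtr ?(ltW (v_gt0 x))//.
rewrite -mulr_sumr ler_pdivrMl ?v_gt0// mulr1.
have := high_variance c01 zc B0 rho1 Erho M x L0.
by move=> /le_trans; apply; rewrite /v /C2; lra.
Qed.

Let highE x w : ortho_sum E M (high z L (u w)) x = Num.sqrt (v x) * U x w.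
Proof.
have s0 : Num.sqrt (v x) != 0 by rewrite gt_eqF// sqrtr_gt0.
rewrite /ortho_sum /U /gauss_sum mulr_sumr; apply: eq_bigr => n _.
rewrite /hi /kap !mulrA mulfV// mul1r /high /u; case: ifP => _.
  by rewrite !mul0r.
by ring.
Qed.

(** This dominates exp((b + l)|U|); the rate b + l is the one produced by [powR_truncate] at
    threshold l. *)
Let f x w := expR ((b + l) * U x w) + expR (- ((b + l) * U x w)).
Let F w : \bar R := (\int[nu]_x (rho x `^ (b / 2) * f x w)%:E)%E.

Let msqrtv : measurable_fun setT (fun x => (Num.sqrt (v x))^-1).
Proof.
under eq_fun do rewrite -powR_inv1//.
apply: (measurableT_comp (f := fun t : R => t `^ (-1))); first exact: measurable_powR.
apply: (measurableT_comp (f := @Num.sqrt R)).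
  by apply: measurable_fun_continuous; exact: sqrt_continuous.
by apply: measurable_funM => //; apply: measurable_funM.
Qed.

Let mUj : measurable_fun setT (fun p : D * Omega => U p.1 p.2).
Proof.
apply: measurable_sum => n; apply: measurable_funM; last first.
  by apply: measurableT_comp => //; exact: measurable_snd.
apply: measurable_funM.
  by apply: (measurableT_comp msqrtv); exact: measurable_fst.
apply: measurable_funM => //.
by apply: measurableT_comp => //; exact: measurable_fst.
Qed.

Let mrhob : measurable_fun setT (fun x => rho x `^ (b / 2)).
Proof. by apply: (measurableT_comp (f := fun t : R => t `^ (b / 2))). Qed.

Let mf : measurable_fun setT (fun p : D * Omega => (rho p.1 `^ (b / 2) * f p.1 p.2)%:E).
Proof.
have me k : measurable_fun setT (fun p : D * Omega => expR (k * U p.1 p.2)).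
  by apply: (measurableT_comp (f := expR)); [exact: measurable_expR|exact: measurable_funM].
apply: measurable_fun_EFin; apply: measurable_funM.
  by apply: (measurableT_comp mrhob); exact: measurable_fst.
apply: measurable_funD => //.
by under eq_fun do rewrite -mulNr; exact: me.
Qed.

Let f_ge0 x w : 0 <= f x w. Proof. by rewrite addr_ge0 ?expR_ge0. Qed.

Let f0 (p : D * Omega) : (0 <= (rho p.1 `^ (b / 2) * f p.1 p.2)%:E)%E.
Proof. by rewrite lee_fin mulr_ge0 ?powR_ge0. Qed.

Let mF : measurable_fun setT F.
Proof. exact: (measurable_fun_fubini_tonelli_G (m1 := nu) _ mf f0). Qed.

Let F_ge0 w : (0 <= F w)%E.
Proof. by apply: integral_ge0 => x _; exact: (f0 (x, w)). Qed.

Let F_mean : (\int[P]_w F w <= (2 * expR ((b + l) ^+ 2 / 2) * I)%:E)%E.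
Proof.
have := fubini_tonelli (m1 := nu) (m2 := P) _ mf f0 => /= <-.
apply: (@le_trans _ _ (\int[nu]_x
    ((2 * expR ((b + l) ^+ 2 / 2))%:E * (rho x `^ (b / 2))%:E))%E).
  apply: ge0_le_integral => //.
  - by move=> x _; apply: integral_ge0 => w _; exact: (f0 (x, w)).
  - exact: (measurable_fun_fubini_tonelli_F _ mf f0).
  - by apply: emeasurable_funM => //; exact: measurable_fun_EFin.
  move=> x _; under eq_integral do rewrite EFinM.
  rewrite ge0_integralZl//.
  - rewrite muleC lee_wpmul2r ?lee_fin ?powR_ge0//.
    have := @gauss_sum_abs_mgf _ _ _ _ _ mX lX iX M (hi x) (b + l) 1 (U_var x).
    by rewrite mulr1.
  - apply: measurable_fun_EFin.
    have me k : measurable_fun setT (fun w => expR (k * U x w)).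
      apply: (measurableT_comp (f := expR)); first exact: measurable_expR.
      by apply: measurable_funM => //; exact: measurable_gauss_sum.
    apply: measurable_funD => //.
    by under eq_fun do rewrite -mulNr; exact: me.
  - by move=> w _; rewrite lee_fin f_ge0.
  - by rewrite lee_fin powR_ge0.
rewrite ge0_integralZl//.
- by rewrite IE.
- exact: measurable_fun_EFin.
- by move=> x _; rewrite lee_fin powR_ge0.
Qed.

(** A pathwise bound: [powR_truncate] is integrated against the weight v^(b/2), which factors as Q
    rho^(b/2). All randomness is left in F. *)
Let high_le w : (\int[nu]_x (`|ortho_sum E M (high z L (u w)) x| `^ b)%:E <=
  (Q * (l `^ b * I))%:E + (Q * expR (- l ^+ 2))%:E * F w)%E.
Proof.
have vb x : Num.sqrt (v x) `^ b = Q * rho x `^ (b / 2).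
  rewrite -powR12_sqrt ?(ltW (v_gt0 x))// -powRrM mulrC.
  rewrite /v mulrAC powRM ?(le_trans _ (rho1 x))//.
  by rewrite ltW// divr_gt0.
apply: (@le_trans _ _ (\int[nu]_x ((Q * l `^ b)%:E * (rho x `^ (b / 2))%:E +
    (Q * expR (- l ^+ 2))%:E * (rho x `^ (b / 2) * f x w)%:E))%E).
  have mS : measurable_fun setT (fun x => `|ortho_sum E M (high z L (u w)) x| `^ b).
    apply: (measurableT_comp (f := fun t : R => t `^ b)) => //.
    by apply: measurableT_comp => //; exact: measurable_ortho_sum.
  apply: ge0_le_integral => //.
  - exact: measurable_fun_EFin.
  - apply: emeasurable_funD; apply: emeasurable_funM => //.
      exact: measurable_fun_EFin.
    exact: (measurable_fun_pair1 (f := fun p : D * Omega => (rho p.1 `^ (b / 2) * f p.1 p.2)%:E)).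
  move=> x _; rewrite -!EFinM -EFinD lee_fin highE normrM.
  rewrite powRM// ger0_norm ?sqrtr_ge0// vb.
  have := powR_truncate (U x w) b0 (ltW l_gt0); rewrite -/(f x w) => h.
  have -> : Q * l `^ b * rho x `^ (b / 2) +
      Q * expR (- l ^+ 2) * (rho x `^ (b / 2) * f x w) =
      Q * rho x `^ (b / 2) * (l `^ b + expR (- l ^+ 2) * f x w) by ring.
  by rewrite ler_wpM2l// mulr_ge0 ?powR_ge0.
rewrite ge0_integralD//; first last.
- apply: emeasurable_funM => //.
  exact: (measurable_fun_pair1 (f := fun p : D * Omega => (rho p.1 `^ (b / 2) * f p.1 p.2)%:E)).
- by move=> x _; rewrite mule_ge0// lee_fin ?mulr_ge0 ?powR_ge0 ?expR_ge0.
- by apply: emeasurable_funM => //; exact: measurable_fun_EFin.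
- by move=> x _; rewrite mule_ge0// lee_fin ?mulr_ge0 ?powR_ge0.
rewrite !ge0_integralZl//; first last.
- by rewrite lee_fin mulr_ge0 ?powR_ge0.
- by move=> x _; rewrite lee_fin powR_ge0.
- exact: measurable_fun_EFin.
- by rewrite lee_fin mulr_ge0 ?powR_ge0 ?expR_ge0.
- by move=> x _; rewrite lee_fin mulr_ge0 ?powR_ge0.
- exact: (measurable_fun_pair1 (f := fun p : D * Omega => (rho p.1 `^ (b / 2) * f p.1 p.2)%:E)).
by rewrite IE -EFinM mulrA.
Qed.

Variable K : R.
Hypothesis K0 : 0 <= K.
Let K' := K * (B / c).
Let K'_ge0 : 0 <= K'.
Proof. by rewrite mulr_ge0// divr_ge0 ?(ltW B0) ?(ltW c0). Qed.
Let klow := K'  `^ (th / 2) * L%:R `^ th.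
Let klow_ge0 : 0 <= klow. Proof. by rewrite mulr_ge0 ?powR_ge0. Qed.
Let th0 : 0 < th. Proof. by rewrite subr_gt0. Qed.

(** Of the b powers, b - 2 are bounded uniformly by [low_sup] and the other two are integrated
    exactly by orthonormality. *)
Let low_le w : energy M w <= K ->
  (\int[nu]_x (`|ortho_sum E M (low z L (u w)) x| `^ b)%:E <= (klow * K)%:E)%E.
Proof.
move=> eK; set S := ortho_sum E M _.
have mS : measurable_fun setT S by exact: measurable_ortho_sum.
apply: (@le_trans _ _ (\int[nu]_x (klow%:E * (S x ^+ 2)%:E))%E).
  apply: ge0_le_integral => //.
  - apply: measurable_fun_EFin.
    apply: (measurableT_comp (f := fun t : R => t `^ b)) => //.
    exact: measurableT_comp.
  - apply: emeasurable_funM => //.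
    by apply: measurable_fun_EFin; exact: measurable_funX.
  move=> x _; rewrite -EFinM lee_fin.
  have Sb : `|S x| `^ b = S x ^+ 2 * (S x ^+ 2) `^ (th / 2).
    rewrite -(real_normK (num_real (S x))) -powR_mulrn// -powRrM -powRD.
      by congr (_ `^ _); rewrite /th; field.
    by rewrite gt_eqF//; have := th0; lra.
  rewrite Sb mulrC ler_wpM2r ?sqr_ge0//.
  have h := low_sup c01 zc B0 Ez L x eK.
  apply: (@le_trans _ _ ((K' * L%:R ^+ 2) `^ (th / 2))).
    apply: ge0_ler_powR; rewrite ?nnegrE ?sqr_ge0 ?(divr_ge0 (ltW th0))//.
    by rewrite mulr_ge0// sqr_ge0.
  rewrite powRM ?sqr_ge0// -powR_mulrn// -powRrM.
  by rewrite (_ : 2%:R * (th / 2) = th)//; field.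
rewrite ge0_integralZl//; last 2 first.
- by apply: measurable_fun_EFin; exact: measurable_funX.
- by move=> x _; rewrite lee_fin sqr_ge0.
rewrite (ortho_sum_norm mE Eb onE) -EFinM lee_fin ler_wpM2l//.
apply: le_trans eK; apply: ler_sum => n _; rewrite /low; case: ifP => // _.
by rewrite expr0n/= sqr_ge0.
Qed.

(** The factor 2^b pays for splitting the sum, the first summand covers the low frequencies, and the
    1 leaves a full L^th to be accounted for by the high ones. *)
Definition tail_level := 2 `^ b * (K * K' `^ (th / 2) + 1).
Definition tail_event := [set w | energy M w <= K /\
  ((tail_level * L%:R `^ th)%:E <= lp_mass M w)%E].

Lemma measurable_energy : measurable_fun setT (energy M).
Proof.
by apply: measurable_sum => n; apply: measurable_funX; exact: measurable_funM.
Qed.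

Lemma measurable_ortho_series :
  measurable_fun setT (fun p : D * Omega => ortho_sum E M (u p.2) p.1).
Proof.
apply: measurable_sum => n; apply: measurable_funM.
  apply: measurable_funM => //.
  by apply: measurableT_comp => //; exact: measurable_snd.
by apply: measurableT_comp => //; exact: measurable_fst.
Qed.

Lemma measurable_lp_mass : measurable_fun setT (lp_mass M).
Proof.
have mj : measurable_fun setT
    (fun p : D * Omega => (`|ortho_sum E M (u p.2) p.1| `^ b)%:E).
  apply: measurable_fun_EFin; apply: (measurableT_comp (f := fun t : R => t `^ b)) => //.
  by apply: measurableT_comp => //; exact: measurable_ortho_series.
apply: (measurable_fun_fubini_tonelli_G (m1 := nu) _ mj) => p.
by rewrite lee_fin powR_ge0.
Qed.

Lemma measurable_tail_event : measurable tail_event.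
Proof.
have -> : tail_event = (energy M @^-1` `]-oo, K]) `&`
    (lp_mass M @^-1` `[(tail_level * L%:R `^ th)%:E, +oo[).
  by apply/seteqP; split => w; rewrite /tail_event/= !in_itv/= andbT.
apply: measurableI.
  rewrite -[X in measurable X]setTI; apply: measurable_energy => //.
rewrite -[X in measurable X]setTI; apply: measurable_lp_mass => //.
exact: emeasurable_itv.
Qed.

(** The deterministic part of [high_le] takes at most half of L^th, so the part containing F must
    supply the other half, which is Q l^b I' by [lb]. *)
Let tail_F w : tail_event w -> ((expR (l ^+ 2) * (l `^ b * I'))%:E <= F w)%E.
Proof.
move=> [eK hl].
have : (lp_mass M w <= (2 `^ b)%:E * ((klow * K)%:E +
    ((Q * (l `^ b * I))%:E + (Q * expR (- l ^+ 2))%:E * F w)))%E.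
  have mSb (S : D -> R) : measurable_fun setT S ->
      measurable_fun setT (fun x => (`|S x| `^ b)%:E).
    move=> mS; apply: measurable_fun_EFin.
    apply: (measurableT_comp (f := fun t : R => t `^ b)) => //.
    exact: measurableT_comp.
  have mo v' : measurable_fun setT (ortho_sum E M v') by exact: measurable_ortho_sum.
  apply: (@le_trans _ _ (\int[nu]_x ((2 `^ b)%:E *
      ((`|ortho_sum E M (low z L (u w)) x| `^ b)%:E +
       (`|ortho_sum E M (high z L (u w)) x| `^ b)%:E)))%E).
    apply: ge0_le_integral => //.
    - exact: mSb.
    - by apply: emeasurable_funM => //; apply: emeasurable_funD; exact: mSb.
    move=> x _; rewrite -EFinD -EFinM lee_fin (low_high E z M L (u w) x).
    exact: powR_add_le.
  rewrite ge0_integralZl//; first last.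
  - by move=> x _; rewrite -EFinD lee_fin addr_ge0 ?powR_ge0.
  - by apply: emeasurable_funD; exact: mSb.
  rewrite lee_wpmul2l ?lee_fin ?powR_ge0// ge0_integralD//; first last.
  - exact: mSb.
  - exact: mSb.
  by apply: leeD; [exact: low_le|exact: high_le].
move=> /(le_trans hl).
have := F_ge0 w; case: (F w) => [r|_ _|//]; last by rewrite leey.
rewrite lee_fin => r0.
move=> h0; rewrite lee_fin.
have : tail_level * L%:R `^ th <=
    2 `^ b * (klow * K + (Q * (l `^ b * I) + Q * expR (- l ^+ 2) * r)).
  by rewrite -lee_fin; exact: h0.
rewrite -[tail_level * _]mulrA ler_pM2l ?powR_gt0// => h.
have h2 : L%:R `^ th <= Q * (l `^ b * I) + Q * expR (- l ^+ 2) * r.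
  by move: h; rewrite /klow; lra.
have h3 : Q * (l `^ b * I) <= L%:R `^ th / 2.
  rewrite -lb ler_pM2l// ler_wpM2l ?powR_ge0// /I'; lra.
have : Q * (l `^ b * I') <= Q * (expR (- l ^+ 2) * r) by rewrite lb mulrA; lra.
rewrite ler_pM2l// => h4.
have -> : r = expR (l ^+ 2) * (expR (- l ^+ 2) * r).
  by rewrite mulrA -expRD subrr expR0 mul1r.
by rewrite ler_wpM2l ?expR_ge0.
Qed.

(** Markov's inequality leaves the exponent (b + l)^2 / 2 - l^2, which is at most 3 b^2 / 2 - l^2 /
    4 because (2b - l)^2 >= 0. The first term goes into this constant and the second into
    [tail_rate]; dividing by c3^b uses l >= c3. *)
Definition tail_const := 2 * expR (3 * b ^+ 2 / 2) / c3 `^ b.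
Definition tail_rate := c3 ^+ 2 / 4.

Lemma tail_rate_gt0 : 0 < tail_rate.
Proof. by rewrite divr_gt0// exprn_gt0. Qed.

(* On [tail_event] the modes with z n <= L, bounded uniformly by low_sup, account for
   at most part of the level; hence the remaining ones, whose variance is O(rho / L),
   must be large, and Markov's inequality for an exponential moment applies. *)
Lemma tail_event_le :
  (P tail_event <= (tail_const * expR (- (tail_rate * L%:R `^ gam)))%:E)%E.
Proof.
have gam0 : 0 < gam.
  by have := b2; rewrite /gam subr_gt0 ltr_pdivrMr; [lra|exact: b0].
pose t := expR (l ^+ 2) * (l `^ b * I').
have t0 : 0 < t by rewrite mulr_gt0 ?expR_gt0// mulr_gt0 ?powR_gt0.
have : (t%:E * P tail_event <= (2 * expR ((b + l) ^+ 2 / 2) * I)%:E)%E.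
  apply: le_trans F_mean.
  have mev := measurable_tail_event.
  have -> : P tail_event = (\int[P]_w (\1_tail_event w)%:E)%E by rewrite integral_indic ?setIT.
  rewrite -ge0_integralZl//; last by rewrite lee_fin ltW.
  - apply: ge0_le_integral => //.
    + by move=> w _; rewrite mule_ge0// lee_fin// ltW.
    + apply: emeasurable_funM => //; apply: measurable_fun_EFin.
      exact: measurable_indic.
    move=> w _; rewrite indicE; case: (boolP (w \in tail_event)) => [|_].
      by rewrite inE mule1 => /tail_F.
    by rewrite mule0.
  - by apply: measurable_fun_EFin; exact: measurable_indic.
rewrite -lee_pdivlMl// => /le_trans; apply.
rewrite -EFinM lee_fin.
have l2 : l ^+ 2 = c3 ^+ 2 * L%:R `^ gam.
  by rewrite exprMn -[in X in _ * X]powR_mulrn ?powR_ge0// -powRrM divfK.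
have lc3 : c3 `^ b <= l `^ b.
  apply: ge0_ler_powR; rewrite ?nnegrE ?(ltW b0) ?(ltW c3_gt0) ?(ltW l_gt0)//.
  rewrite /l ler_peMr ?(ltW c3_gt0)//.
  rewrite -[leLHS](powRr0 L%:R); apply: ler_powR => //.
  by rewrite divr_ge0// ltW.
apply: (@le_trans _ _ ((expR (l ^+ 2))^-1 / c3 `^ b * (2 * expR ((b + l) ^+ 2 / 2)))).
  have -> : t^-1 * (2 * expR ((b + l) ^+ 2 / 2) * I) =
      (expR (l ^+ 2))^-1 * ((l `^ b)^-1 * (I'^-1 * I)) * (2 * expR ((b + l) ^+ 2 / 2)).
    by rewrite /t !invfM; ring.
  rewrite ler_wpM2r ?mulr_ge0 ?expR_ge0// ler_wpM2l ?invr_ge0 ?expR_ge0//.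
  apply: (@le_trans _ _ ((l `^ b)^-1 * 1)).
    rewrite ler_wpM2l ?invr_ge0 ?powR_ge0// mulrC ler_pdivrMr// mul1r /I'; lra.
  by rewrite mulr1 lef_pV2 ?posrE//; apply: powR_gt0; [exact: l_gt0|exact: c3_gt0].
rewrite /tail_const -expRN.
have -> : expR (- l ^+ 2) / c3 `^ b * (2 * expR ((b + l) ^+ 2 / 2)) =
  2 * (expR (- l ^+ 2) * expR ((b + l) ^+ 2 / 2)) / c3 `^ b by ring.
have -> : 2 * expR (3 * b ^+ 2 / 2) / c3 `^ b * expR (- (tail_rate * L%:R `^ gam)) =
  2 * (expR (3 * b ^+ 2 / 2) * expR (- (tail_rate * L%:R `^ gam))) / c3 `^ b by ring.
rewrite ler_wpM2r ?invr_ge0 ?powR_ge0// ler_wpM2l// -!expRD ler_expR.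
have -> : tail_rate * L%:R `^ gam = l ^+ 2 / 4 by rewrite l2 /tail_rate; ring.
have := sqr_ge0 (2 * b - l).
have -> : (2 * b - l) ^+ 2 = 4 * b ^+ 2 - 4 * (b * l) + l ^+ 2 by ring.
have -> : (b + l) ^+ 2 = b ^+ 2 + 2 * (b * l) + l ^+ 2 by ring.
lra.
Qed.

End fixed_scale.

End ExponentialTail.

(** * From stretched exponential tails to exponential moments *)

Section MomentFromTail.
Variable R : realType.

(** The power gam beats both th and 1. The linear term 11x/10 is reserved on purpose: it leaves a
    factor exp(-11x/10), below x^(-11/10), to make the sum over levels converge. *)
Lemma powR_dominated (a r th gam : R) : 0 <= a -> 0 < r -> 0 < th -> th < gam -> 1 < gam ->
  exists2 C, 0 <= C & forall x, 1 <= x -> a * x `^ th + 11 / 10 * x - r * x `^ gam <= C.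
Proof.
move=> a0 r0 th0 thg g1; pose m := Num.max th 1.
have mg : 0 < gam - m by rewrite subr_gt0 gt_max thg.
pose k := (a + 11 / 10) / r; pose x0 := k `^ (gam - m)^-1.
have a2 : 0 <= a + 11 / 10 by lra.
have k0 : 0 <= k by rewrite divr_ge0 // ltW.
exists ((a + 11 / 10) * x0 `^ m); first by rewrite mulr_ge0 ?powR_ge0.
move=> x x1; have xp : 0 < x by rewrite (lt_le_trans ltr01).
have h1 : a * x `^ th + 11 / 10 * x <= (a + 11 / 10) * x `^ m.
  rewrite [leRHS]mulrDl; apply: lerD.
    by rewrite ler_wpM2l// ler_powR// le_max lexx.
  rewrite ler_wpM2l//.
  by rewrite -[leLHS](powRr1 (ltW xp)) ler_powR// le_max lexx orbT.
have h2 : x `^ gam = x `^ (gam - m) * x `^ m.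
  by rewrite -powRD ?(gt_eqF xp) ?implybT// subrK.
have xm0 : 0 <= x `^ m by exact: powR_ge0.
have [xx0|x0x] := leP x x0.
  apply: (@le_trans _ _ ((a + 11 / 10) * x `^ m)).
    by rewrite lerBlDr; apply: (le_trans h1); rewrite lerDl mulr_ge0 ?powR_ge0// ltW.
  rewrite ler_wpM2l// ge0_ler_powR ?nnegrE ?(ltW xp) ?powR_ge0//.
  by rewrite le_max ler01 orbT.
apply: (@le_trans _ _ 0); last by rewrite mulr_ge0 ?powR_ge0.
rewrite subr_le0; apply: (le_trans h1).
rewrite h2 mulrA ler_wpM2r//.
have : k <= x `^ (gam - m).
  rewrite -[leLHS](powRr1 k0) -[X in k `^ X](mulVf (lt0r_neq0 mg)) powRrM.
  by rewrite ge0_ler_powR ?nnegrE ?powR_ge0 ?(ltW mg) ?(ltW xp) ?(ltW x0x).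
by rewrite /k (ler_pdivrMr _ _ r0) [leRHS]mulrC.
Qed.

(** The constant is chosen before the probability space and Y, which makes the bound uniform when Y
    runs over a whole sequence. *)
Lemma exp_moment_of_tail (A C0 th gam cst r : R) :
  0 <= A -> 0 < C0 -> 0 < th -> th < gam -> 1 < gam -> 0 <= cst -> 0 < r ->
  exists2 C, 0 <= C &
  forall d (Omega : measurableType d) (P : probability Omega R)
    (Y : Omega -> R) (G : set Omega),
  measurable_fun setT Y -> measurable G -> (forall w, 0 <= Y w) ->
  (forall L : nat, (0 < L)%N ->
    (P (G `&` [set w | (C0 * L%:R `^ th <= Y w)%R]) <=
     (cst * expR (- (r * L%:R `^ gam)))%:E)%E) ->
  (\int[P]_w (expR (A * Y w) * \1_G w)%:E <= C%:E)%E.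
Proof.
move=> A0 C00 th0 thg g1 cst0 r0.
have a0 : 0 <= A * C0 * 2 `^ th by rewrite !mulr_ge0 ?powR_ge0// ltW.
have [C6 C60 C6P] := powR_dominated a0 r0 th0 thg g1.
have C_ge0 : 0 <= expR (A * C0) + cst * expR C6 * 11.
  by rewrite addr_ge0 ?mulr_ge0 ?expR_ge0.
exists (expR (A * C0) + cst * expR C6 * 11) => //.
move=> d Omega P Y G mY mG Y0 tail.
pose T k := G `&` [set w | C0 * k.+1%:R `^ th <= Y w].
have mT k : measurable (T k).
  apply: measurableI => //.
  rewrite (_ : [set w | _] = setT `&` Y @^-1` `[C0 * k.+1%:R `^ th, +oo[); last first.
    by rewrite setTI; apply/seteqP; split => w /=; rewrite in_itv/= andbT.
  exact: mY.
(* On the slice of levels between k+1 and k+2 the exponential is bounded by its value at the upper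
   end, and the probability by the tail at the lower end. *)
pose q k := expR (A * (C0 * k.+2%:R `^ th)).
have q0 k : 0 <= q k by exact: expR_ge0.
pose g k w : \bar R := (q k * \1_(T k) w)%:E.
have g0 k w : (0 <= g k w)%E by rewrite lee_fin mulr_ge0.
have mg k : measurable_fun setT (g k).
  by apply: measurable_fun_EFin; apply: measurable_funM => //; exact: measurable_indic.
have mL : measurable_fun setT (fun w => (expR (A * Y w) * \1_G w)%:E).
  apply: measurable_fun_EFin; apply: measurable_funM; last exact: measurable_indic.
  by apply: (measurableT_comp (f := expR)); [exact: measurable_expR|exact: measurable_funM].
apply: (@le_trans _ _ (\int[P]_w ((expR (A * C0))%:E + \sum_(0 <= k <oo) g k w))%E).
  apply: ge0_le_integral => //.
  - by apply: emeasurable_funD => //; exact: ge0_emeasurable_sum.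
  move=> w _; rewrite indicE.
  have s0 : (0 <= \sum_(0 <= k <oo) g k w)%E by exact: nneseries_ge0.
  have [wG|wG] := boolP (w \in G); last first.
    by rewrite mulr0 adde_ge0// lee_fin expR_ge0.
  rewrite mulr1; set x := (Y w / C0) `^ th^-1.
  have xth : C0 * x `^ th = Y w.
    by rewrite -powRrM mulVf ?gt_eqF// powRr1 ?divr_ge0 ?(ltW C00)// mulrCA mulfV ?mulr1 ?gt_eqF.
  have x0 : 0 <= x by exact: powR_ge0.
  have /andP[tx xt] := truncn_itv x0.
  have up (n : nat) : x <= n%:R -> expR (A * Y w) <= expR (A * (C0 * n%:R `^ th)).
    move=> xn; rewrite ler_expR -xth !ler_wpM2l ?(ltW C00)//.
    by rewrite ge0_ler_powR ?nnegrE ?(ltW th0).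
  case En : (Num.truncn x) tx xt => [|k] tx xt.
    apply: (@le_trans _ _ (expR (A * C0))%:E); last by rewrite leeDl.
    by rewrite lee_fin; have := up 1%N (ltW xt); rewrite powR1 mulr1.
  apply: (@le_trans _ _ (g k w)).
    rewrite lee_fin indicE mem_set ?mulr1; first exact: up (ltW xt).
    split; first by move: wG; rewrite inE.
    rewrite /= -xth ler_wpM2l ?(ltW C00)//.
    by rewrite ge0_ler_powR ?nnegrE ?(ltW th0).
  apply: (@le_trans _ _ (\sum_(0 <= k <oo) g k w))%E; last by rewrite leeDr// lee_fin expR_ge0.
  rewrite (nneseries_split 0 k.+1)//= add0n.
  rewrite big_nat_recr//=.
  apply: (@le_trans _ _ (\sum_(0 <= i < k) g i w + g k w))%E.
    by rewrite leeDr// sume_ge0.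
  by rewrite leeDl// nneseries_ge0.
rewrite ge0_integralD//; first last.
- exact: ge0_emeasurable_sum.
- by move=> w _; exact: nneseries_ge0.
rewrite integral_cst//.
rewrite [X in (_ * X)%E](_ : _ = 1%E); last exact: probability_setT.
rewrite mule1 EFinD leeD2l//.
rewrite integral_nneseries//.
have int_g k : (\int[P]_w g k w <= (cst * expR C6 * k.+1%:R `^ (- 10%:R^-1 - 1))%:E)%E.
  under eq_integral do rewrite /g EFinM.
  rewrite ge0_integralZl//; last 2 first.
  - by apply: measurable_fun_EFin; exact: measurable_indic.
  - by rewrite lee_fin.
  rewrite integral_indic// setIT.
  apply: (@le_trans _ _ ((q k)%:E * (cst * expR (- (r * k.+1%:R `^ gam)))%:E)%E).
    by rewrite lee_wpmul2l ?lee_fin// tail.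
  rewrite -EFinM lee_fin mulrCA -mulrA ler_wpM2l//.
  have kp : 1 <= k.+1%:R :> R by rewrite ler1n.
  have kp0 : 0 < k.+1%:R :> R by rewrite ltr0n.
  apply: (@le_trans _ _ (expR (C6 - 11 / 10 * k.+1%:R))).
    rewrite -expRD ler_expR lerBrDr.
    (* From k + 2 <= 2(k + 1); the resulting factor 2^th was already included in the coefficient
       given to [powR_dominated]. *)
    have k2 : k.+2%:R `^ th <= 2 `^ th * k.+1%:R `^ th :> R.
      rewrite -powRM//; apply: ge0_ler_powR; rewrite ?nnegrE ?(ltW th0) ?mulr_ge0//.
      by rewrite -natrM ler_nat mul2n -addnn addSnnS leq_addl.
    apply: le_trans (C6P _ kp).
    rewrite addrAC lerD2r lerD2r.
    by rewrite !mulrA -(mulrA (A * C0)) ler_wpM2l// mulr_ge0// ltW.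
  rewrite expRD ler_wpM2l ?expR_ge0// expRN.
  have -> : - 10%:R^-1 - 1 = - (11 / 10) :> R by field.
  rewrite powRN lef_pV2 ?posrE ?expR_gt0 ?powR_gt0//.
  by apply: powR_le_expR => //; lra.
apply: lime_le.
  by apply: is_cvg_nneseries => k _ _; apply: integral_ge0.
apply: nearW => n; apply: (@le_trans _ _
    (\sum_(0 <= k < n) (cst * expR C6 * k.+1%:R `^ (- 10%:R^-1 - 1))%:E)%E).
  by apply: lee_sum => k _; exact: int_g.
rewrite sumEFin lee_fin -mulr_sumr ler_wpM2l ?mulr_ge0 ?expR_ge0//.
have := @zeta_le R 10%:R^-1 n; rewrite big_mkord; move=> /(_ _)/le_trans; apply.
  by rewrite invr_gt0.
by rewrite invrK; lra.
Qed.

End MomentFromTail.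

Section ExponentialMoment.
Variable R : realType.
Context d (Omega : measurableType d) (P : probability Omega R).
Variable X : nat -> Omega -> R.
Hypotheses (mX : forall i, measurable_fun setT (X i))
  (lX : forall i B, measurable B -> P (X i @^-1` B) = normal_prob 0 1 B)
  (iX : mutually_independent P X).
Context d' (D : measurableType d') (nu : {finite_measure set D -> \bar R}).
Variables (E : nat -> D -> R) (beta : nat -> R).
Hypotheses (mE : forall n, measurable_fun setT (E n))
  (Eb : forall n x, `|E n x| <= beta n)
  (onE : forall n m, (\int[nu]_x (E n x * E m x)%:E = ((n == m)%:R)%:E)%E).
Variables (z : nat -> R) (c B : R) (rho : D -> R).
Hypotheses (c01 : 0 < c <= 1) (zc : forall n, c * n.+1%:R <= z n) (B0 : 0 < B)
  (rho1 : forall x, 1 <= rho x) (mrho : measurable_fun setT rho)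
  (Ez : forall n x, E n x ^+ 2 <= B * z n)
  (Erho : forall n x, E n x ^+ 2 <= B * rho x).
Variable b : R.
Hypotheses (b24 : 2 < b < 4)
  (rho_int : (\int[nu]_x (rho x `^ (b / 2))%:E < +oo)%E).

Lemma lp_mass_fin M w : lp_mass X nu E z b M w \is a fin_num.
Proof.
have b0 : 0 < b by case/andP: b24 => /(lt_trans _) ->.
have m1 : measurable_fun setT (fun x => `|ortho_sum E M (series_coef X z w) x| `^ b).
  apply: (measurableT_comp (f := fun t : R => t `^ b)) => //.
  by apply: measurableT_comp => //; exact: measurable_ortho_sum.
apply: integrable_fin_num => //.
apply: (@bounded_integrable _ _ _ nu _ ((\sum_(n < M) `|series_coef X z w n| * beta n) `^ b)) => //.
move=> x; rewrite ger0_norm ?powR_ge0//; apply: ge0_ler_powR; rewrite ?nnegrE ?(ltW b0)//.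
  by apply: le_trans (ortho_sum_le Eb M (series_coef X z w) x); exact: normr_ge0.
exact: ortho_sum_le.
Qed.

Lemma exponential_moment (A K : R) : 0 <= A -> 0 <= K ->
  exists2 C, 0 <= C & forall M,
  (\int[P]_w (expR (A * fine (lp_mass X nu E z b M w)) *
    \1_[set w | (energy X z M w <= K)%R] w)%:E <= C%:E)%E.
Proof.
move=> A0 K0; have [b2 b4] : 2 < b /\ b < 4 by case/andP: b24.
have b0 : 0 < b by exact: lt_trans b2.
have c0 : 0 < c by case/andP: c01.
have [||||||| C C0 CP] := @exp_moment_of_tail R A (tail_level c B b K) (b - 2) (3 - 4 / b)
    (tail_const nu c B rho b) (tail_rate nu c B rho b).
- by [].
- rewrite mulr_gt0 ?powR_gt0// ltr_wpDl// mulr_ge0 ?powR_ge0//.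
- by rewrite subr_gt0.
- (* b < 4 is what makes the tail rate 3 - 4 / b exceed the growth b - 2. *)
  rewrite -subr_gt0.
  have -> : 3 - 4 / b - (b - 2) = (b - 1) * (4 - b) / b by field; rewrite gt_eqF.
  by rewrite divr_gt0// mulr_gt0; lra.
- by rewrite ltrBrDr -ltrBrDl ltr_pdivrMr//; lra.
- by rewrite /tail_const divr_ge0 ?powR_ge0// mulr_ge0 ?expR_ge0.
- exact: tail_rate_gt0.
exists C => // M; apply: CP => //.
- exact: (measurableT_comp (f := fine)) (measurable_lp_mass mX nu mE z b M).
- rewrite (_ : [set w | _] = setT `&` energy X z M @^-1` `]-oo, K]); last first.
    by rewrite setTI; apply/seteqP; split => w /=; rewrite in_itv.
  exact: measurable_energy.
- by move=> w; apply: fine_ge0; apply: integral_ge0 => x _; rewrite lee_fin powR_ge0.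
- move=> L L0.
  apply: le_trans (tail_event_le mX lX iX mE Eb onE c01 zc B0 rho1 mrho Ez Erho
    b24 rho_int M L0 K0).
  rewrite (_ : _ `&` _ = tail_event X nu E z c B b M L K)//.
  apply/seteqP; split => w [h1 h2]; split => //=.
    by rewrite -(fineK (lp_mass_fin M w)) lee_fin.
  by rewrite -lee_fin fineK ?lp_mass_fin.
Qed.

End ExponentialMoment.

Lemma bounded_fin_num (R : realType) d (D : measurableType d)
    (nu : {finite_measure set D -> \bar R}) (f : D -> R) b :
  measurable_fun setT f -> (forall x, `|f x| <= b) ->
  (\int[nu]_x (f x)%:E)%E \is a fin_num.
Proof.
by move=> mf fb; exact: (integrable_fin_num measurableT (bounded_integrable nu mf fb)).
Qed.

(** * Eigenfunctions corrected at the origin *)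

Section PuncturedEigenfunctions.
Variable R : realType.
Local Notation leb2 := (@leb2 R).
Local Notation sqnorm := (@sqnorm R).
Local Notation plane := (measurableTypeR R * measurableTypeR R)%type.
Local Notation nu := (@disc_leb R).
Variable z : nat -> R.
Hypothesis Hz : J0_zeros z.

Definition eigen_sup : R := sval (cid2 (e_bounds Hz)).
Local Notation B := eigen_sup.

Lemma eigen_sup_gt0 : 0 < B.
Proof. by rewrite /B; case: cid2. Qed.

Lemma e_sq_le n x : e z n x ^+ 2 <= B * z n.
Proof. by rewrite /B; case: cid2 => /= b b0 /(_ n x)[]. Qed.

Lemma cmod_e_sq_le n x : cmod x * e z n x ^+ 2 <= B.
Proof. by rewrite /B; case: cid2 => /= b b0 /(_ n x)[]. Qed.

Lemma e_norm_le n x : `|e z n x| <= Num.sqrt (B * z n).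
Proof.
rewrite -(ler_pXn2r (n := 2))// ?nnegrE ?sqrtr_ge0//.
rewrite real_normK ?num_real// sqr_sqrtr ?e_sq_le//.
by apply: le_trans (e_sq_le n x); exact: sqr_ge0.
Qed.

(** Only bounded profiles, their normalisation and the integrals of 1 + k_n k_m are retained, so
    that orthonormality is proved without unfolding J0. *)
Let eigen_profile : exists (k : nat -> plane -> R) (N : nat -> R),
  [/\ forall i, measurable_fun setT (k i), forall i x, `|k i x| <= 1,
      forall n m, n != m ->
        (\int[leb2]_(x in @Theta R) (1 + k n x * k m x)%:E = (disc_area R)%:E)%E,
      forall i, 0 < N i /\ N i = fine (\int[nu]_x (k i x ^+ 2)%:E)%E &
      forall i x, e z i x = k i x / Num.sqrt (N i)].
Proof.
pose k i (x : plane) := J0 (z i * cmod x).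
have mk i : measurable_fun setT (k i).
  apply: (measurableT_comp (f := @J0 R)).
    by apply: measurable_fun_continuous; exact: continuous_J0.
  by apply: measurable_funM => //; exact: measurable_cmod.
exists k, (fun i => Rintegral leb2 (@Theta R) (fun y => J0 (z i * cmod y) ^+ 2)).
split; first exact: mk.
- move=> i x; rewrite -(expr_le1 (n := 2)) ?normr_ge0// real_normK ?num_real//.
  exact: J0_sq_le1.
- move=> n m nm; rewrite -(integral_kk Hz nm); apply: eq_integral => x _.
  by rewrite /k !J0_cmod.
- move=> i; split; first exact: eigen_norm_gt0.
  by apply: (Rintegral_disc_leb (f := fun x => k i x ^+ 2)); exact: measurable_funX.
- by [].
Qed.

Lemma e_orthonormal n m :
  (\int[nu]_x (e z n x * e z m x)%:E = ((n == m)%:R)%:E)%E.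
Proof.
have [k [N [mk k1 korth N0 ek]]] := eigen_profile.
have kk i j : measurable_fun setT (fun x => k i x * k j x) by exact: measurable_funM.
have kk1 i j x : `|k i x * k j x| <= 1 by rewrite normrM -[leRHS]mul1r ler_pM.
have ikk i j := bounded_integrable nu (kk i j) (kk1 i j).
transitivity (\int[nu]_x (((Num.sqrt (N n))^-1 * (Num.sqrt (N m))^-1)%:E *
    (k n x * k m x)%:E))%E.
  by apply: eq_integral => x _; rewrite -EFinM !ek; congr _%:E; ring.
rewrite (integralZl measurableT (ikk n m)).
rewrite [X in (_ * X)%E](_ : _ = (\int[nu]_x (k n x * k m x)%:E)%E)//.
have [<-|nm] := eqVneq n m.
  have [n0 nE] := N0 n.
  under eq_integral do rewrite -expr2.
  have fk : (\int[nu]_x (k n x ^+ 2)%:E)%E \is a fin_num.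
    by under eq_integral do rewrite expr2; exact: (bounded_fin_num _ (kk n n) (kk1 n n)).
  rewrite -(fineK fk) -nE -EFinM -invfM -expr2 sqr_sqrtr ?(ltW n0)//.
  by rewrite mulVf// gt_eqF.
suff -> : (\int[nu]_x (k n x * k m x)%:E = 0)%E by rewrite mule0.
(* Subtracting the area, that is the integral of 1, recovers the orthogonality hidden in
   [integral_kk]. *)
have := korth _ _ nm.
rewrite integral_disc_leb; last first.
  by apply: (@measurable_fun_EFin R _ plane setT); exact: measurable_funD.
under eq_integral do rewrite EFinD.
have i1 : nu.-integrable setT (fun x : plane => 1%:E).
  by apply: (@bounded_integrable _ _ _ nu (fun=> 1) 1) => // x; rewrite normr1.
rewrite (integralD measurableT i1 (ikk n m)) -(integral_disc_leb (f := fun=> 1%E))//.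
rewrite integral_cst//; last exact: measurable_Theta.
rewrite mul1e.
rewrite [X in (X + _)%E](_ : _ = (disc_area R)%:E)%E; last exact: leb2_ThetaE.
rewrite [X in (_ + X)%E](_ : _ = (\int[nu]_x (k n x * k m x)%:E)%E)//.
have := bounded_fin_num nu (kk n m) (kk1 n m).
case: (\int[nu]_x _)%E => // r _ [] h; congr _%:E; move: h => /=; lra.
Qed.

(* The bound by 1/|x| fails at the origin because of the junk value 0^-1 = 0;
   the eigenfunctions are therefore set to 0 there. *)
Definition punctured n (x : plane) : R := if sqnorm x == 0 then 0 else e z n x.

Lemma measurable_punctured n : measurable_fun setT (punctured n).
Proof.
have -> : punctured n = (fun x : plane => \1_(~` [set x | sqnorm x = 0]) x * e z n x).
  apply/funext => x; rewrite /punctured indicE in_setC.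
  have [x0|/eqP x0] := eqVneq (sqnorm x) 0; first by rewrite mem_set// mul0r.
  by rewrite memNset// mul1r.
apply: measurable_funM; last exact: measurable_e.
by apply: measurable_indic; apply: measurableC; exact: measurable_origin.
Qed.

Lemma punctured_sq_le n x : punctured n x ^+ 2 <= B * z n.
Proof.
rewrite /punctured; case: ifP => _; last exact: e_sq_le.
by rewrite expr0n/= mulr_ge0// ltW// ?eigen_sup_gt0// zeros_gt0.
Qed.

Lemma punctured_norm_le n x : `|punctured n x| <= Num.sqrt (B * z n).
Proof.
rewrite /punctured; case: ifP => _; last exact: e_norm_le.
by rewrite normr0 sqrtr_ge0.
Qed.

Lemma punctured_sq_le_invr n x : punctured n x ^+ 2 <= B * invr_cmod x.
Proof.
have B0 := eigen_sup_gt0.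
rewrite /punctured; case: ifPn => [_|x0].
  by rewrite expr0n/= mulr_ge0 ?(ltW B0)// (le_trans _ (invr_cmod_ge1 x)).
have c0 : 0 < cmod x by rewrite sqrtr_gt0 lt_neqAle eq_sym x0 sqnorm_ge0.
apply: (@le_trans _ _ (B * (cmod x)^-1)).
  by rewrite ler_pdivlMr// mulrC cmod_e_sq_le.
by rewrite ler_wpM2l ?(ltW B0)// /invr_cmod le_max powR_inv1 ?(ltW c0)// lexx orbT.
Qed.

Lemma punctured_orthonormal n m :
  (\int[nu]_x (punctured n x * punctured m x)%:E = ((n == m)%:R)%:E)%E.
Proof.
rewrite -e_orthonormal; apply: disc_leb_ae.
- apply: (@measurable_fun_EFin R _ plane setT).
  by apply: measurable_funM; exact: measurable_punctured.
- apply: (@measurable_fun_EFin R _ plane setT).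
  by apply: measurable_funM; exact: measurable_e.
- by move=> x x0; rewrite /punctured (negbTE x0).
Qed.

(** Interpolation with weights 3/5 on the bound B z_n and 2/5 on the bound B/|x|. Division by z_n^2
    leaves z_n^(-7/5), and the fourth power taken by the eighth moment leaves |x|^(-8/5), integrable
    in the plane. *)
Lemma punctured_coef_le : exists2 A, 0 < A & forall n x,
  ((Num.sqrt 2 * z n)^-1 * punctured n x) ^+ 2 <=
  A * n.+1%:R `^ (- (7 / 5)) * invr_cmod x `^ (2 / 5).
Proof.
have [c /andP[c0 c1] zc] := zeros_growth Hz; have B0 := eigen_sup_gt0.
exists (2^-1 * (B * c `^ (- (7 / 5)))).
  by rewrite !mulr_gt0 ?powR_gt0.
move=> n x; have z0 := zeros_gt0 Hz n.
have rh := invr_cmod_ge1 x; have rh0 : 0 < invr_cmod x by rewrite (lt_le_trans ltr01).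
have p2 : punctured n x ^+ 2 <= B * z n `^ (3 / 5) * invr_cmod x `^ (2 / 5).
  have [->|p0] := eqVneq (punctured n x ^+ 2) 0.
    by rewrite !mulr_ge0 ?powR_ge0// ltW.
  have {p0} p0 : 0 < punctured n x ^+ 2 by rewrite lt_neqAle eq_sym p0 sqr_ge0.
  have -> : punctured n x ^+ 2 =
      (punctured n x ^+ 2) `^ (3 / 5) * (punctured n x ^+ 2) `^ (2 / 5).
    rewrite -powRD; last by rewrite gt_eqF// implybT.
    by rewrite (_ : 3 / 5 + 2 / 5 = 1) ?powRr1 ?ltW//; field.
  have -> : B * z n `^ (3 / 5) * invr_cmod x `^ (2 / 5) =
      (B * z n) `^ (3 / 5) * (B * invr_cmod x) `^ (2 / 5).
    rewrite !powRM ?(ltW B0) ?(ltW z0) ?(ltW rh0)//.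
    have {1}-> : B = B `^ (3 / 5) * B `^ (2 / 5).
      rewrite -powRD; last by rewrite gt_eqF// implybT.
      by rewrite (_ : 3 / 5 + 2 / 5 = 1) ?powRr1 ?ltW//; field.
    by ring.
  rewrite ler_pM ?powR_ge0//; apply: ge0_ler_powR; rewrite ?nnegrE ?(ltW p0) ?mulr_ge0 ?(ltW B0) ?(ltW z0) ?(ltW rh0) ?punctured_sq_le ?punctured_sq_le_invr//.
rewrite exprMn exprVn exprMn sqr_sqrtr// invfM.
apply: (@le_trans _ _ (2^-1 * (z n ^+ 2)^-1 * (B * z n `^ (3 / 5) * invr_cmod x `^ (2 / 5)))).
  by rewrite ler_wpM2l// mulr_ge0// invr_ge0// sqr_ge0.
have -> : (z n ^+ 2)^-1 = z n `^ (- 2) by rewrite powRN powR_mulrn// ltW.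
have -> : 2^-1 * z n `^ (- 2) * (B * z n `^ (3 / 5) * invr_cmod x `^ (2 / 5)) =
   2^-1 * (B * (z n `^ (- 2) * z n `^ (3 / 5))) * invr_cmod x `^ (2 / 5) by ring.
rewrite -powRD; last by rewrite (gt_eqF z0) implybT.
have -> : -2 + 3 / 5 = - (7 / 5) :> R by field.
rewrite ler_wpM2r ?powR_ge0// -!mulrA ler_wpM2l// ler_wpM2l ?(ltW B0)//.
rewrite -powRM ?(ltW c0)// !powRN lef_pV2 ?posrE ?powR_gt0// ?mulr_gt0//.
by apply: ge0_ler_powR; rewrite ?nnegrE ?mulr_ge0 ?(ltW c0) ?(ltW z0).
Qed.

End PuncturedEigenfunctions.

(** * Limits of integrals *)

Section MeasurableLimits.
Variable R : realType.
Context d (T : measurableType d).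

(** Cauchy's criterion with countable quantifiers only, so that the set of convergence is built from
    countable unions and intersections. *)
Let cvgn_cauchy (u : R^nat) : cvgn u <-> forall k : nat, exists N : nat,
  forall n m : nat, `|u (N + n)%N - u (N + m)%N| < k.+1%:R^-1.
Proof.
split=> [/cvg_ex[l ul] k|H].
  have k0 : 0 < k.+1%:R^-1 / 2 :> R by rewrite divr_gt0.
  move/cvgrPdist_lt : ul => /(_ _ k0)[N _ HN]; exists N => n m.
  have := HN _ (leq_addr n N); have := HN _ (leq_addr m N).
  rewrite (distrC l (u (N + n)%N)) => h1 h2.
  have -> : u (N + n)%N - u (N + m)%N = (u (N + n)%N - l) + (l - u (N + m)%N) by ring.
  by rewrite (le_lt_trans (ler_normD _ _))// [ltRHS]splitr ltrD.
apply/cauchy_cvgP; apply: cauchy_exP => eps e0.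
have [k _ ke] : exists2 k : nat, True & k.+1%:R^-1 < eps.
  exists (Num.truncn eps^-1) => //.
  rewrite -[ltRHS]invrK ltf_pV2 ?posrE ?invr_gt0//.
  by have /andP[_] := truncn_itv (ltW (etrans (invr_gt0 eps) e0)).
have [N HN] := H k; exists (u N); exists N => // n /= Nn.
rewrite -ball_normE/= (lt_trans _ ke)//.
by have := HN 0%N (n - N)%N; rewrite addn0 subnKC.
Qed.

Lemma measurable_cvgn (f : nat -> T -> R) : (forall n, measurable_fun setT (f n)) ->
  measurable [set t | cvgn (f ^~ t)].
Proof.
move=> mf.
have -> : [set t | cvgn (f ^~ t)] = \bigcap_k \bigcup_N \bigcap_n \bigcap_m
    (setT `&` (fun t => `|f (N + n)%N t - f (N + m)%N t|) @^-1` `]-oo, k.+1%:R^-1[).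
  apply/seteqP; split => t /=.
    move=> /cvgn_cauchy H k _; have [N HN] := H k; exists N => // n _ m _.
    by split => //=; rewrite in_itv/=; exact: HN.
  move=> H; apply/cvgn_cauchy => k; have [N _ HN] := H k I; exists N => n m.
  by have [_] := HN n I m I; rewrite /= in_itv.
apply: bigcap_measurable => [|k _]; first by exists 0%N.
apply: bigcup_measurable => N _.
apply: bigcap_measurable => [|n _]; first by exists 0%N.
apply: bigcap_measurable => [|m _]; first by exists 0%N.
have : measurable_fun setT (fun t => `|f (N + n)%N t - f (N + m)%N t|).
  by apply: measurableT_comp => //; exact: measurable_funB.
by apply.
Qed.

Lemma measurable_lim_if (A : set T) (f : nat -> T -> R) : measurable A ->
  (forall n, measurable_fun setT (f n)) -> (forall t, A t -> cvgn (f ^~ t)) ->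
  measurable_fun setT (fun t => if `[< A t >] then limn (f ^~ t) else 0).
Proof.
move=> mA mf fA.
apply: (@measurable_fun_cvg _ _ _ _ (fun n t => f n t * \1_A t)) => [n|t _].
  by apply: measurable_funM => //; exact: measurable_indic.
case: ifPn => /asboolP At.
  have -> : (fun n => f n t * \1_A t) = f ^~ t.
    by apply/funext => n; rewrite indicE mem_set// mulr1.
  exact: fA.
have -> : (fun n => f n t * \1_A t) = cst 0.
  by apply/funext => n; rewrite indicE memNset// mulr0.
exact: cvg_cst.
Qed.

(** Tonelli gives measurability for nonnegative integrands; positive and negative parts are treated
    separately. *)
Lemma measurable_param_integral d' (D : measurableType d')
    (nu : {finite_measure set D -> \bar R}) (F : D * T -> R) :
  measurable_fun setT F ->
  measurable_fun setT (fun t => fine (\int[nu]_x (F (x, t))%:E)%E).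
Proof.
move=> mF; have mE : measurable_fun setT (EFin \o F) by exact: measurable_fun_EFin.
apply: (measurableT_comp (f := fine)) => //.
under eq_fun do rewrite integralE.
apply: emeasurable_funB.
- have := measurable_fun_fubini_tonelli_G (m1 := nu) _
    (measurable_funepos mE) (funepos_ge0 _).
  by apply: eq_measurable_fun => t _; apply: eq_integral => x _; rewrite !funeposE.
- have := measurable_fun_fubini_tonelli_G (m1 := nu) _
    (measurable_funeneg mE) (funeneg_ge0 _).
  by apply: eq_measurable_fun => t _; apply: eq_integral => x _; rewrite !funenegE.
Qed.

End MeasurableLimits.

(** * One-sided limit theorems adapted to open and closed sets *)

Section LimitsOfIntegrals.
Variable R : realType.
Context d (T : measurableType d) (P : probability T R).
Local Open Scope ereal_scope.

(** Fatou with convergence demanded only where Z is positive. This fits an open set: off the set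
    nothing is known about the truncations, and nothing is required. *)
Lemma integral_le_limn_einf (Y : nat -> T -> R) (Z : T -> R) :
  (forall n, measurable_fun setT (Y n)) -> (forall n w, (0 <= Y n w)%R) ->
  measurable_fun setT Z -> (forall w, (0 <= Z w)%R) ->
  {ae P, forall w, (0 < Z w)%R -> exists2 c : R, (Z w <= c)%R & (Y ^~ w @ \oo --> c)%R} ->
  \int[P]_w (Z w)%:E <= limn_einf (fun n => \int[P]_w (Y n w)%:E).
Proof.
move=> mY Y0 mZ Z0 YZ.
have mYE n : measurable_fun setT (fun w => (Y n w)%:E) by exact: measurable_fun_EFin.
have Y0E n w : setT w -> 0 <= (Y n w)%:E by rewrite lee_fin.
apply: le_trans (@fatou _ _ _ P setT measurableT (fun n w => (Y n w)%:E) mYE Y0E) => //.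
have mZE : measurable_fun setT (fun w => (Z w)%:E) by exact: measurable_fun_EFin.
have mL : measurable_fun setT (fun w => limn_einf (fun n => (Y n w)%:E)).
  rewrite /limn_einf; apply: measurableT_comp => //.
  apply: (measurable_fun_limn_esup (f := fun n w => - (Y n w)%:E)) => n.
  exact: measurableT_comp.
have L0 w : 0 <= limn_einf (fun n => (Y n w)%:E).
  rewrite limn_einf_lim; apply: lime_ge; first exact: is_cvg_einfs.
  apply: nearW => n; apply: le_ereal_inf_tmp => _ [m _ <-].
  by rewrite lee_fin.
apply: ae_ge0_le_integral => //.
  by move=> w _; rewrite lee_fin.
apply: filterS YZ => w YZ _; have := Z0 w; rewrite le_eqVlt => /predU1P[<-//|].
move=> /YZ[c Zc Yc].
have Yc' : (fun n => (Y n w)%:E) @ \oo --> c%:E.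
  by apply/fine_cvgP; split; [exact: nearW|exact: Yc].
by rewrite (cvg_limn_einf_sup Yc').1 lee_fin.
Qed.

(** Only the excess of Y over Z has to vanish, which suits the upper semicontinuous indicator of a
    closed set. The bound in L^2 takes the place of an integrable majorant. *)
Lemma limn_esup_integral_le (Y : nat -> T -> R) (Z : T -> R) (C : R) :
  (forall n, measurable_fun setT (Y n)) -> (forall n w, (0 <= Y n w)%R) ->
  measurable_fun setT Z -> (forall w, (0 <= Z w)%R) ->
  (forall n, \int[P]_w (Y n w ^+ 2)%:E <= C%:E) ->
  {ae P, forall w, ((fun n => Num.max (Y n w - Z w) 0) @ \oo --> 0)%R} ->
  limn_esup (fun n => \int[P]_w (Y n w)%:E) <= \int[P]_w (Z w)%:E.
Proof.
move=> mY Y0 mZ Z0 YC YZ; apply/lee_addgt0Pr => eps e0.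
have C0 : (0 <= C)%R.
  by rewrite -lee_fin; apply: le_trans (YC 0%N); apply: integral_ge0 => w _; rewrite lee_fin sqr_ge0.
(* The truncation level makes C / M at most eps / 2; C + 1 keeps it positive when C = 0. *)
pose M : R := (2 * (C + 1) / eps)%R.
have M0 : (0 < M)%R by rewrite divr_gt0// mulr_gt0// ltr_wpDl.
have CM : (M^-1 * C <= eps / 2)%R.
  rewrite ler_pdivrMl// /M; have -> : (2 * (C + 1) / eps * (eps / 2) = C + 1)%R.
    by field; rewrite gt_eqF.
  by rewrite lerDl.
(* Y <= Z + min ((Y - Z)^+, M) + Y^2 / M *)
pose W n w : R := Num.min (Num.max (Y n w - Z w) 0)%R M.
have W0 n w : (0 <= W n w)%R by rewrite /W le_min le_max lexx orbT ltW.
have WM n w : (W n w <= M)%R by rewrite /W ge_min lexx orbT.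
have mW n : measurable_fun setT (W n).
  apply: measurable_minr => //; apply: measurable_maxr => //.
  exact: measurable_funB.
have Wc : (fun n => \int[P]_w (W n w)%:E) @ \oo --> 0.
  have [||||| _ _] := @dominated_convergence _ T R P setT measurableT
      (fun n w => (W n w)%:E) (cst 0) (cst M%:E).
  - by move=> n; exact: measurable_fun_EFin.
  - exact: measurable_cst.
  - apply: filterS YZ => w Yw _.
    apply: cvg_EFin; first exact: nearW.
    apply: (@squeeze_cvgr _ _ _ _ (cst 0%R) (fun n => Num.max (Y n w - Z w) 0)%R) => //.
      by apply: nearW => n; rewrite W0/= /W ge_min lexx.
    exact: cvg_cst.
  - exact: finite_measure_integrable_cst.
  - by apply: aeW => w n _ /=; rewrite lee_fin ger0_norm.
  by rewrite integral0.
have e2 : (0 < eps / 2)%R by rewrite divr_gt0.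
have key n : \int[P]_w (Y n w)%:E <=
    \int[P]_w (Z w)%:E + (\int[P]_w (W n w)%:E + (eps / 2)%:E).
  apply: (@le_trans _ _ (\int[P]_w ((Z w)%:E +
      ((W n w)%:E + (M^-1)%:E * (Y n w ^+ 2)%:E)))).
    apply: ge0_le_integral => //.
    - by move=> w _; rewrite lee_fin.
    - exact: measurable_fun_EFin.
    - apply: emeasurable_funD; first exact: measurable_fun_EFin.
      apply: emeasurable_funD; first exact: measurable_fun_EFin.
      by apply: emeasurable_funM => //; apply: measurable_fun_EFin; exact: measurable_funX.
    move=> w _; rewrite -EFinM -!EFinD lee_fin.
    have q0 : (0 <= M^-1 * Y n w ^+ 2)%R by rewrite mulr_ge0 ?sqr_ge0// invr_ge0 ltW.
    rewrite /W; case: (leP _ M) => h.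
      by have := lexx (Num.max (Y n w - Z w) 0)%R; rewrite {1}ge_max => /andP[+ _]; lra.
    have {h} h : (M < Y n w)%R.
      move: h; rewrite lt_max => /orP[|]; last by rewrite ltNge ltW.
      by have := Z0 w; lra.
    have : (Y n w <= M^-1 * Y n w ^+ 2)%R.
      by rewrite ler_pdivlMl// expr2 ler_wpM2r// ltW.
    by have := Z0 w; lra.
  rewrite ge0_integralD//; first last.
  - apply: emeasurable_funD; first exact: measurable_fun_EFin.
    by apply: emeasurable_funM => //; apply: measurable_fun_EFin; exact: measurable_funX.
  - move=> w _; rewrite -EFinM -EFinD lee_fin addr_ge0// mulr_ge0 ?sqr_ge0//.
    by rewrite invr_ge0 ltW.
  - exact: measurable_fun_EFin.
  - by move=> w _; rewrite lee_fin.
  rewrite leeD2l// ge0_integralD//; first last.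
  - by apply: emeasurable_funM => //; apply: measurable_fun_EFin; exact: measurable_funX.
  - by move=> w _; rewrite -EFinM lee_fin mulr_ge0 ?sqr_ge0// invr_ge0 ltW.
  - exact: measurable_fun_EFin.
  - by move=> w _; rewrite lee_fin.
  rewrite leeD2l// ge0_integralZl//; first last.
  - by rewrite lee_fin invr_ge0 ltW.
  - by move=> w _; rewrite lee_fin sqr_ge0.
  - by apply: measurable_fun_EFin; exact: measurable_funX.
  apply: (@le_trans _ _ ((M^-1)%:E * C%:E)).
    by rewrite lee_wpmul2l// lee_fin invr_ge0 ltW.
  by rewrite -EFinM lee_fin.
have Wnear : \forall n \near \oo, \int[P]_w (W n w)%:E <= (eps / 2)%:E.
  move/fine_cvgP : Wc => [Wf /cvgr_lt/(_ _ e2) Wl].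
  by apply: filterS2 Wf Wl => n fn h; rewrite -(fineK fn) lee_fin ltW.
rewrite limn_esup_lim; apply: lime_le; first exact: is_cvg_esups.
have [N _ HN] := Wnear.
exists N => // n /= Nn; apply: ge_ereal_sup => _ [m /= nm <-].
apply: (le_trans (key m)); rewrite leeD2l//.
apply: (@le_trans _ _ ((eps / 2)%:E + (eps / 2)%:E)).
  by rewrite leeD2r//; apply: HN; exact: leq_trans nm.
by rewrite -EFinD lee_fin -splitr.
Qed.

End LimitsOfIntegrals.

(** * The radial Sobolev spaces *)

Section DiscIntegrals.
Variable R : realType.
Local Notation leb2 := (@leb2 R).
Local Notation Theta := (@Theta R).
Local Notation plane := (measurableTypeR R * measurableTypeR R)%type.

Lemma Hrad_measurable z sigma (u : R * R -> R * R) : Hrad z sigma u ->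
  measurable_fun (Theta : set plane) (fun x : plane => (u x).1) /\
  measurable_fun (Theta : set plane) (fun x : plane => (u x).2).
Proof.
case=> mu _ _ _; split.
- have mf : measurable_fun (Theta : set plane) (u : plane -> plane) := mu.
  exact: (measurableT_comp (f := fst : plane -> measurableTypeR R) measurable_fst mf).
- have mf : measurable_fun (Theta : set plane) (u : plane -> plane) := mu.
  exact: (measurableT_comp (f := snd : plane -> measurableTypeR R) measurable_snd mf).
Qed.

Lemma measurable_fun_disc (u : plane -> plane) :
  measurable_fun setT (fun x => (u x).1) -> measurable_fun setT (fun x => (u x).2) ->
  measurable_fun (Theta : set (R * R)) (u : R * R -> R * R).
Proof.
move=> m1 m2; have mf : measurable_fun (Theta : set plane) u.
  apply: (@measurable_funS _ _ _ _ setT) => //.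
  by apply/measurable_fun_pairP; split.
exact: mf.
Qed.

Lemma square_integrable (f : plane -> R) : measurable_fun (Theta : set plane) f ->
  (\int[leb2]_(x in Theta) (f x ^+ 2)%:E < +oo)%E ->
  (plane_leb R).-integrable Theta (fun x => (f x ^+ 2)%:E).
Proof.
move=> mf foo; apply/integrableP; split.
  by apply: (@measurable_fun_EFin R _ plane Theta); exact: measurable_funX.
rewrite (eq_integral (fun x : plane => (f x ^+ 2)%:E)); first exact: foo.
by move=> x _; rewrite gee0_abs// lee_fin sqr_ge0.
Qed.

Lemma disc_cst_integrable (b : R) : (plane_leb R).-integrable Theta (fun=> b%:E).
Proof.
apply/integrableP; split; first exact: measurable_cst.
rewrite integral_cst//; last exact: measurable_Theta.
rewrite [X in (_ * X)%E](_ : _ = (disc_area R)%:E); last exact: leb2_ThetaE.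
by rewrite -EFinM ltry.
Qed.

(** Domination by f^2 + b^2, which is integrable because the disc has finite area. *)
Lemma product_integrable (f g : plane -> R) (b : R) :
  measurable_fun (Theta : set plane) f -> measurable_fun (Theta : set plane) g ->
  (\int[leb2]_(x in Theta) (f x ^+ 2)%:E < +oo)%E -> (forall x, `|g x| <= b) ->
  (plane_leb R).-integrable Theta (fun x => (f x * g x)%:E).
Proof.
move=> mf mg foo gb.
have iG : (plane_leb R).-integrable Theta
    ((fun x : plane => (f x ^+ 2)%:E) \+ (fun=> (b ^+ 2)%:E))%E.
  apply: integrableD; [exact: measurable_Theta|exact: square_integrable|].
  exact: disc_cst_integrable.
refine (le_integrable (measurable_Theta (R := R)) _ _ iG).
  by apply: (@measurable_fun_EFin R _ plane Theta); exact: measurable_funM.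
move=> x _; rewrite /= !lee_fin [leRHS]ger0_norm ?addr_ge0 ?sqr_ge0//.
rewrite normrM; have := gb x; have := normr_ge0 (g x) => g0 gb'.
have : `|g x| ^+ 2 <= b ^+ 2 by rewrite lerXn2r ?nnegrE// (le_trans g0).
rewrite -(real_normK (num_real (f x))).
have := sqr_ge0 (`|f x| - `|g x|); rewrite sqrrB.
by have := sqr_ge0 (`|f x|); have := sqr_ge0 (`|g x|); rewrite mulr2n; lra.
Qed.

End DiscIntegrals.

Section Combinations.
Variable R : realType.
Local Notation leb2 := (@leb2 R).
Local Notation Theta := (@Theta R).
Local Notation plane := (measurableTypeR R * measurableTypeR R)%type.
Local Notation nu := (@disc_leb R).
Variable z : nat -> R.
Hypothesis Hz : J0_zeros z.
Implicit Types (u v : R * R -> R * R) (a b : nat -> R).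

(** Linearity of the integral needs integrability of u e_n; it comes from the square integrability
    contained in [Hrad]. *)
Lemma coefB sigma u v n : Hrad z sigma u -> Hrad z sigma v ->
  coef z n (fun x => u x - v x) = coef z n u - coef z n v.
Proof.
move=> Hu Hv; have [mu1 mu2] := Hrad_measurable Hu; have [mv1 mv2] := Hrad_measurable Hv.
have me : measurable_fun (Theta : set plane) (fun x : plane => e z n x).
  by apply: (@measurable_funS _ _ _ _ setT) => //; exact: measurable_e.
have sq (f : plane -> R) (w : R * R -> R * R) : Hrad z sigma w ->
    measurable_fun (Theta : set plane) f -> (forall x, f x ^+ 2 <= cmod (w x) ^+ 2) ->
    measurable_fun (Theta : set plane) (fun x : plane => (w x).1) ->
    measurable_fun (Theta : set plane) (fun x : plane => (w x).2) ->
    (plane_leb R).-integrable Theta (fun x => (f x * e z n x)%:E).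
  move=> [_ _ woo _] mf fw mw1 mw2.
  apply: (product_integrable mf me _ (e_norm_le Hz n)).
  apply: le_lt_trans woo; apply: ge0_le_integral => //.
  - exact: measurable_Theta.
  - by move=> x _; rewrite lee_fin sqr_ge0.
  - by apply: (@measurable_fun_EFin R _ plane Theta); exact: measurable_funX.
  - apply: (@measurable_fun_EFin R _ plane Theta).
    rewrite (_ : (fun x => _) = fun x : plane => (w x).1 ^+ 2 + (w x).2 ^+ 2).
      by apply: measurable_funD; exact: measurable_funX.
    by apply/funext => x; rewrite cmod_sq.
  - by move=> x _; rewrite lee_fin.
have c1 w (x : plane) : (w x : R * R).1 ^+ 2 <= cmod (w x) ^+ 2.
  by rewrite cmod_sq lerDl sqr_ge0.
have c2 w (x : plane) : (w x : R * R).2 ^+ 2 <= cmod (w x) ^+ 2.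
  by rewrite cmod_sq lerDr sqr_ge0.
have i1u := sq _ _ Hu mu1 (c1 u) mu1 mu2.
have i2u := sq _ _ Hu mu2 (c2 u) mu1 mu2.
have i1v := sq _ _ Hv mv1 (c1 v) mv1 mv2.
have i2v := sq _ _ Hv mv2 (c2 v) mv1 mv2.
rewrite /coef /=; congr pair.
- have E := RintegralB (measurable_Theta (R := R)) i1u i1v.
  rewrite -[RHS]/(Rintegral (plane_leb R) Theta (fun x => (u x).1 * e z n x) -
    Rintegral (plane_leb R) Theta (fun x => (v x).1 * e z n x)) -E.
  by apply: eq_Rintegral => x _ /=; rewrite mulrBl.
- have E := RintegralB (measurable_Theta (R := R)) i2u i2v.
  rewrite -[RHS]/(Rintegral (plane_leb R) Theta (fun x => (u x).2 * e z n x) -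
    Rintegral (plane_leb R) Theta (fun x => (v x).2 * e z n x)) -E.
  by apply: eq_Rintegral => x _ /=; rewrite mulrBl.
Qed.

Definition combination N a b : R * R -> R * R :=
  fun x => (ortho_sum (e z) N a x, ortho_sum (e z) N b x).

Lemma ortho_sum_coef N a m :
  Rintegral leb2 Theta (fun x => ortho_sum (e z) N a x * e z m x) =
  if (m < N)%N then a m else 0.
Proof.
have me n : measurable_fun setT (fun x : plane => e z n x) by exact: measurable_e.
rewrite (Rintegral_disc_leb (f := fun x => ortho_sum (e z) N a x * e z m x)); last first.
  by apply: measurable_funM => //; exact: measurable_ortho_sum.
elim: N => [|N IH].
  rewrite (eq_integral (fun=> 0%E)) ?integral0// => x _.
  by rewrite /ortho_sum big_ord0 mul0r.
have i1 : nu.-integrable setT (fun x => (ortho_sum (e z) N a x * e z m x)%:E).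
  apply: (@bounded_integrable _ _ _ nu (fun x => ortho_sum (e z) N a x * e z m x)
    ((\sum_(n < N) `|a n| * Num.sqrt (eigen_sup Hz * z n)) * Num.sqrt (eigen_sup Hz * z m))).
    by apply: measurable_funM => //; exact: measurable_ortho_sum.
  move=> x; rewrite normrM ler_pM//; last exact: e_norm_le.
  exact: (ortho_sum_le (D := plane) (e_norm_le Hz)).
have i2 : nu.-integrable setT (fun x => (e z N x * e z m x)%:E).
  apply: (@bounded_integrable _ _ _ nu (fun x => e z N x * e z m x)
    (Num.sqrt (eigen_sup Hz * z N) * Num.sqrt (eigen_sup Hz * z m))).
    exact: measurable_funM.
  by move=> x; rewrite normrM ler_pM//; exact: e_norm_le.
have i2' := integrableZl measurableT (a N) i2.
rewrite (eq_integral (fun x : plane => ((ortho_sum (e z) N a x * e z m x)%:E +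
    (a N)%:E * (e z N x * e z m x)%:E)%E)); last first.
  move=> x _; rewrite -EFinM -EFinD; congr _%:E.
  by rewrite /ortho_sum big_ord_recr/= mulrDl; congr (_ + _); rewrite -mulrA.
have E := integralD measurableT i1 i2'.
rewrite -[X in fine X]/(\int[nu]_x ((fun x => (ortho_sum (e z) N a x * e z m x)%:E) x +
  (fun x => (a N)%:E * (e z N x * e z m x)%:E) x))%E E.
rewrite fineD; [|exact: (integrable_fin_num measurableT)..].
rewrite IH (integralZl measurableT i2).
rewrite [X in (_ * X)%E](_ : _ = ((N == m)%:R)%:E); last exact: e_orthonormal.
rewrite -EFinM/= ltnS; case: ltngtP => mN.
- by rewrite mulr0 addr0.
- by rewrite mulr0 addr0.
- by rewrite mN mulr1 add0r.
Qed.

Lemma coef_combination N a b m :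
  coef z m (combination N a b) = if (m < N)%N then (a m, b m) else 0.
Proof. by rewrite /coef /combination !ortho_sum_coef; case: ifP. Qed.

Lemma SN_combination N u :
  SN z N u = combination N (fun n => (coef z n u).1) (fun n => (coef z n u).2).
Proof. by []. Qed.

Lemma coef_SN N u m : coef z m (SN z N u) = if (m < N)%N then coef z m u else 0.
Proof. by rewrite SN_combination coef_combination -surjective_pairing. Qed.

Lemma combination_sq_integral N a b :
  (\int[leb2]_(x in Theta) (cmod (combination N a b x) ^+ 2)%:E =
   (\sum_(n < N) (a n ^+ 2 + b n ^+ 2))%:E)%E.
Proof.
have me n : measurable_fun setT (fun x : plane => e z n x) by exact: measurable_e.
have mo c : measurable_fun setT (ortho_sum (fun n => (e z n : plane -> R)) N c).
  exact: measurable_ortho_sum.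
rewrite (eq_integral (fun x : plane => ((ortho_sum (e z) N a x ^+ 2)%:E +
    (ortho_sum (e z) N b x ^+ 2)%:E)%E)); last first.
  by move=> x _; rewrite cmod_sq /sqnorm/= EFinD.
have ms c : measurable_fun setT (fun x : plane => (ortho_sum (e z) N c x ^+ 2)%:E).
  by apply: (@measurable_fun_EFin R _ plane setT); apply: measurable_funX; exact: mo.
rewrite (integral_disc_leb (f := fun x : plane => ((ortho_sum (e z) N a x ^+ 2)%:E +
    (ortho_sum (e z) N b x ^+ 2)%:E)%E)); last exact: emeasurable_funD.
rewrite ge0_integralD//; try by move=> x _; rewrite lee_fin sqr_ge0.
rewrite !(ortho_sum_norm (nu := nu) me (e_norm_le Hz) (e_orthonormal Hz)).
by rewrite -EFinD big_split.
Qed.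

Lemma Hnorm2_combination sigma N a b : (Hnorm2 z sigma (combination N a b) < +oo)%E.
Proof.
rewrite /Hnorm2 (nneseries_split 0 N)/=; last first.
  by move=> k _; rewrite lee_fin mulr_ge0 ?powR_ge0 ?sqr_ge0.
rewrite add0n [X in (_ + X)%E]eseries0 ?adde0; last first.
  move=> n Nn _; rewrite coef_combination ltnNge Nn/=.
  by rewrite cmod_sq /sqnorm/= !expr0n/= addr0 mulr0.
by rewrite sumEFin ltry.
Qed.

Lemma combination_Hrad sigma N a b : Hrad z sigma (combination N a b).
Proof.
split.
- apply: measurable_fun_disc => /=; apply: measurable_ortho_sum => n; exact: measurable_e.
- move=> x y _ _ xy; rewrite /combination /ortho_sum.
  by congr pair; apply: eq_bigr => n _; rewrite /e xy.
- by rewrite combination_sq_integral ltry.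
- exact: Hnorm2_combination.
Qed.

Lemma SN_Hrad sigma N u : Hrad z sigma (SN z N u).
Proof. by rewrite SN_combination; exact: combination_Hrad. Qed.

Lemma SN_EN N u : EN z N (SN z N u).
Proof. by exists (fun n => coef z n u). Qed.

End Combinations.

(** * Open sets of the Sobolev space seen through coefficients *)

Section OpenSets.
Variable R : realType.
Local Notation leb2 := (@leb2 R).
Local Notation Theta := (@Theta R).
Variable z : nat -> R.
Hypothesis Hz : J0_zeros z.
Variable sigma : R.
Implicit Types (u v : R * R -> R * R) (a b : nat -> R).

(** Defined on coefficient sequences rather than functions, so that rational sequences can serve as
    centres of balls and measurability reduces to that of the coefficients. *)
Definition Hdist2 (p q : nat -> R * R) : \bar R :=
  (\sum_(0 <= n <oo) (z n `^ (2 * sigma) * cmod (p n - q n) ^+ 2)%:E)%E.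

Let term_ge0 (r : R * R) n : (0 <= (z n `^ (2 * sigma) * cmod r ^+ 2)%:E)%E.
Proof. by rewrite lee_fin mulr_ge0 ?powR_ge0 ?sqr_ge0. Qed.

Lemma Hnorm2B u v : Hrad z sigma u -> Hrad z sigma v ->
  Hnorm2 z sigma (fun x => u x - v x) = Hdist2 (coef z ^~ u) (coef z ^~ v).
Proof.
by move=> Hu Hv; apply: eq_eseriesr => n _; rewrite (coefB Hz _ Hu Hv).
Qed.

Lemma cmodB_sq (p q : R * R) : cmod (p - q) ^+ 2 = (p.1 - q.1) ^+ 2 + (p.2 - q.2) ^+ 2.
Proof. by rewrite cmod_sq. Qed.

Lemma Hdist2_sym p q : Hdist2 p q = Hdist2 q p.
Proof.
apply: eq_eseriesr => n _; congr (_ * _)%:E.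
by rewrite !cmodB_sq -(opprB (q n).1) -(opprB (q n).2) !sqrrN.
Qed.

Lemma Hdist2_triangle p q r :
  (Hdist2 p r <= 2%:E * Hdist2 p q + 2%:E * Hdist2 q r)%E.
Proof.
rewrite /Hdist2 -!nneseriesZl// -nneseriesD//.
- apply: lee_nneseries => // n _.
  rewrite -!EFinM -EFinD lee_fin !cmodB_sq.
  set P := z n `^ _; have P0 : 0 <= P by exact: powR_ge0.
have -> : 2 * (P * (((p n).1 - (q n).1) ^+ 2 + ((p n).2 - (q n).2) ^+ 2)) +
    2 * (P * (((q n).1 - (r n).1) ^+ 2 + ((q n).2 - (r n).2) ^+ 2)) =
  P * (2 * (((p n).1 - (q n).1) ^+ 2 + ((p n).2 - (q n).2) ^+ 2) +
       2 * (((q n).1 - (r n).1) ^+ 2 + ((q n).2 - (r n).2) ^+ 2)) by ring.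
rewrite ler_wpM2l//.
have := sqr_ge0 (((p n).1 - (q n).1) - ((q n).1 - (r n).1)).
have := sqr_ge0 (((p n).2 - (q n).2) - ((q n).2 - (r n).2)).
nra.
- by move=> n _ _; rewrite mule_ge0.
- by move=> n _ _; rewrite mule_ge0.
Qed.

Lemma Hnorm_lt u v eps : Hrad z sigma u -> Hrad z sigma v -> 0 < eps ->
  (Hdist2 (coef z ^~ u) (coef z ^~ v) < (eps ^+ 2)%:E)%E ->
  Hnorm z sigma (fun x => u x - v x) < eps.
Proof.
move=> Hu Hv e0; rewrite /Hnorm (Hnorm2B Hu Hv).
have : (0 <= Hdist2 (coef z ^~ u) (coef z ^~ v))%E by exact: nneseries_ge0.
case: (Hdist2 _ _) => //= r; rewrite !(lee_fin, lte_fin) => r0 re.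
by rewrite -(ltr_pXn2r (ltn0Sn 1)) ?nnegrE ?sqrtr_ge0 ?(ltW e0)// sqr_sqrtr.
Qed.

Lemma Hdist2_fst p N (q : nat -> R * R) : (forall n, (N <= n)%N -> q n = 0) ->
  Hdist2 p q = ((\sum_(0 <= n < N) z n `^ (2 * sigma) * cmod (p n - q n) ^+ 2)%:E +
    \sum_(N <= n <oo) (z n `^ (2 * sigma) * cmod (p n) ^+ 2)%:E)%E.
Proof.
move=> q0; rewrite /Hdist2 (nneseries_split 0 N)//= add0n sumEFin; congr (_ + _)%E.
by apply/congr_lim/funext => k; apply: eq_big_nat => n /andP[Nn _]; rewrite q0 ?subr0.
Qed.

Lemma Hdist2_SN_cvg u : Hrad z sigma u ->
  (fun N => Hdist2 (coef z ^~ u) (coef z ^~ (SN z N u))) @ \oo --> 0%E.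
Proof.
move=> [_ _ _ Hoo]; have := nneseries_tail_cvg Hoo (fun n _ => term_ge0 _ n).
apply: cvg_trans; apply: near_eq_cvg; apply: nearW => N.
rewrite (@Hdist2_fst _ N); last first.
  by move=> n Nn; rewrite (coef_SN Hz) ltnNge Nn.
rewrite big_nat big1 ?add0e// => n /andP[_ nN].
by rewrite (coef_SN Hz) nN subrr cmod_sq /sqnorm/= expr0n/= addr0 mulr0.
Qed.

(** Truncations converge in the Sobolev norm because the squared distance is the tail of a
    convergent series. This is the only topological input for both inequalities. *)
Lemma openH_SN U u : openH z sigma U -> U u -> \forall N \near \oo, U (SN z N u).
Proof.
move=> [UH Uo] Uu; have Hu := UH _ Uu; have [eps e0 He] := Uo _ Uu.
have e2 : 0 < eps ^+ 2 by rewrite exprn_gt0.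
have /fine_cvgP[ff /cvgr_lt/(_ _ e2) fl] := Hdist2_SN_cvg Hu.
apply: filterS2 ff fl => N fN lN; apply: He; first exact: SN_Hrad.
apply: (Hnorm_lt Hu (SN_Hrad Hz sigma N u) e0).
by rewrite -(fineK fN) lte_fin.
Qed.

Let rational (q : seq (rat * rat)) (n : nat) : R * R :=
  (ratr (nth (0, 0) q n).1, ratr (nth (0, 0) q n).2).

Let rat_approx (x eps : R) : 0 < eps -> exists q : rat, (ratr q - x) ^+ 2 <= eps ^+ 2.
Proof.
move=> e0; have [q] := @rat_in_itvoo R x (x + eps) ltac:(by rewrite ltrDl).
rewrite in_itv/= => /andP[xq qx]; exists q.
by rewrite lerXn2r ?nnegrE ?subr_ge0 ?(ltW xq) ?(ltW e0)// lerBlDl ltW.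
Qed.

Let rational_dense u r : Hrad z sigma u -> 0 < r ->
  exists q, (Hdist2 (rational q) (coef z ^~ u) < (r ^+ 2)%:E)%E.
Proof.
move=> Hu r0; have r2 : 0 < r ^+ 2 / 2 by rewrite divr_gt0// exprn_gt0.
have [_ _ _ Hoo] := Hu.
have /fine_cvgP[ff /cvgr_lt/(_ _ r2) fl] :=
  nneseries_tail_cvg Hoo (fun n _ => term_ge0 _ n).
have [N _ HN] := filterI ff fl; have [fN lN] := HN N (leqnn N).
pose w n := z n `^ (2 * sigma).
pose W := \sum_(0 <= n < N) w n + 1.
have W1 : 1 <= W by rewrite lerDr sumr_ge0// => n _; exact: powR_ge0.
have W0 : 0 < W by rewrite (lt_le_trans ltr01).
(* With this precision the first N terms contribute at most 2 W eta^2 = r^2 / (2W), and W >= 1; the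
   tail takes the other half of r^2. *)
pose eta := r / (2 * W).
have eta0 : 0 < eta by rewrite divr_gt0// mulr_gt0.
have /choice[g gP] : forall n, exists q : rat * rat,
    cmod ((ratr q.1, ratr q.2) - coef z n u) ^+ 2 <= 2 * eta ^+ 2.
  move=> n; have [q1 h1] := rat_approx (coef z n u).1 eta0.
  have [q2 h2] := rat_approx (coef z n u).2 eta0.
  exists (q1, q2); rewrite cmodB_sq/=.
  have -> : 2 * eta ^+ 2 = eta ^+ 2 + eta ^+ 2 by ring.
  exact: lerD.
exists (mkseq g N); rewrite Hdist2_sym (@Hdist2_fst _ N); last first.
  by move=> n Nn; rewrite /rational nth_default ?size_mkseq//= rmorph0.
rewrite -(fineK fN) -EFinD lte_fin.
suff : \sum_(0 <= n < N) w n * cmod (coef z n u - rational (mkseq g N) n) ^+ 2 <= r ^+ 2 / 2.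
  by move: lN; rewrite /w /=; lra.
apply: (@le_trans _ _ (\sum_(0 <= n < N) w n * (2 * eta ^+ 2))).
  apply: ler_sum_nat => n /andP[_ nN]; rewrite ler_wpM2l ?powR_ge0//.
  rewrite cmodB_sq -(opprB _ (coef z n u).1) -(opprB _ (coef z n u).2) !sqrrN -cmodB_sq.
  by rewrite /rational nth_mkseq.
rewrite -mulr_suml.
apply: (@le_trans _ _ (W * (2 * eta ^+ 2))).
  by rewrite ler_wpM2r ?lerDl// mulr_ge0// sqr_ge0.
rewrite /eta; have -> : W * (2 * (r / (2 * W)) ^+ 2) = r ^+ 2 / 2 * W^-1.
  by field; rewrite gt_eqF.
by rewrite ler_piMr ?(ltW r2)// invf_le1.
Qed.

(* By separability, U is a countable union of balls centred at combinations of
   eigenfunctions with rational coefficients. *)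
Lemma measurable_openH d (Omega : measurableType d) (Y : Omega -> R * R -> R * R) U :
  openH z sigma U ->
  (forall w, measurable_fun Theta (Y w)) -> (forall w, radial (Y w)) ->
  measurable_fun setT (fun w => \int[leb2]_(x in Theta) (cmod (Y w x) ^+ 2)%:E)%E ->
  (forall n, measurable_fun setT (fun w => (coef z n (Y w)).1)) ->
  (forall n, measurable_fun setT (fun w => (coef z n (Y w)).2)) ->
  measurable [set w | Hrad z sigma (Y w)] /\ measurable [set w | U (Y w)].
Proof.
move=> [UH Uo] mY rY mL mc1 mc2.
have mdist (p : nat -> R * R) : measurable_fun setT (fun w => Hdist2 p (coef z ^~ (Y w))).
  apply: ge0_emeasurable_sum => // n _.
  under eq_fun do rewrite cmodB_sq.
  apply: measurable_fun_EFin; apply: measurable_funM => //.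
  by apply: measurable_funD; apply: measurable_funX; apply: measurable_funB.
have mlt (f : Omega -> \bar R) y : measurable_fun setT f ->
    measurable [set w | (f w < y)%E].
  move=> mf; rewrite -[X in measurable X]setTI.
  rewrite (_ : [set w | _] = f @^-1` `]-oo, y[); first by apply: mf => //; exact: emeasurable_itv.
  by apply/seteqP; split => w /=; rewrite in_itv.
have mHrad : measurable [set w | Hrad z sigma (Y w)].
  rewrite (_ : [set w | _] =
    [set w | (\int[leb2]_(x in Theta) (cmod (Y w x) ^+ 2)%:E < +oo)%E] `&`
    [set w | (Hdist2 (fun=> 0%R) (coef z ^~ (Y w)) < +oo)%E]).
    by apply: measurableI; apply: mlt.
  have E w : Hnorm2 z sigma (Y w) = Hdist2 (fun=> 0%R) (coef z ^~ (Y w)).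
    by rewrite Hdist2_sym; apply: eq_eseriesr => n _; rewrite subr0.
  apply/seteqP; split => w /=; first by move=> [_ _ h1 h2]; split => //; rewrite -E.
  by move=> [h1 h2]; split => //; rewrite E.
split => //.
(* Only balls contained in U are kept, which makes one inclusion immediate. For the other, a radius
   below eps/2 suffices, since [Hdist2_triangle] gives a squared distance below 4 (eps/2)^2. *)
pose good (i : seq (rat * rat) * nat) := `[< forall v, Hrad z sigma v ->
  (Hdist2 (rational i.1) (coef z ^~ v) < (i.2.+1%:R^-1 ^+ 2)%:E)%E -> U v >].
pose A i : set Omega := if good i then
  [set w | Hrad z sigma (Y w)] `&`
  [set w | (Hdist2 (rational i.1) (coef z ^~ (Y w)) < (i.2.+1%:R^-1 ^+ 2)%:E)%E] else set0.
have mA i : measurable (A i).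
  by rewrite /A; case: ifP => _ //; apply: measurableI => //; exact: mlt.
rewrite (_ : [set w | _] = \bigcup_i A i).
  by apply: countable_bigcupT_measurable => //; exact: countableP.
apply/seteqP; split => w /=; last first.
  move=> [i _]; rewrite /A; case: ifP => // /asboolP gi [Hw lw]; exact: gi.
move=> Uw; have [eps e0 He] := Uo _ Uw; have Hw := UH _ Uw.
have e2 : 0 < eps / 2 by rewrite divr_gt0.
have [k ke] : exists k : nat, k.+1%:R^-1 < eps / 2.
  exists (Num.truncn (eps / 2)^-1); rewrite -[ltRHS]invrK ltf_pV2 ?posrE ?invr_gt0//.
  by apply: truncnS_gt.
have k0 : 0 < k.+1%:R^-1 :> R by rewrite invr_gt0.
have [q qP] := rational_dense Hw k0.
exists (q, k) => //; rewrite /A; case: ifPn => [_|/asboolPn[]]; first by split.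
move=> v Hv qv; apply: He => //; apply: Hnorm_lt => //.
apply: (le_lt_trans (Hdist2_triangle _ (rational q) _)).
rewrite Hdist2_sym in qP.
apply: (@lt_trans _ _ ((2 * k.+1%:R^-1 ^+ 2)%:E + (2 * k.+1%:R^-1 ^+ 2)%:E)%E).
  by rewrite !EFinM lteD// lte_pmul2l.
rewrite -EFinD lte_fin.
have : k.+1%:R^-1 ^+ 2 < (eps / 2) ^+ 2 by rewrite ltrXn2r ?nnegrE// ltW.
have -> : (eps / 2) ^+ 2 = eps ^+ 2 / 4 by field.
rewrite ltr_pdivlMr//; move: (k.+1%:R^-1 ^+ 2) => t.
by have -> : 2 * t + 2 * t = t * 4 by ring.
Qed.

End OpenSets.

(** * Convergence of the random series *)

Section SeriesLimit.
Variable R : realType.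
Local Notation leb2 := (@leb2 R).
Local Notation Theta := (@Theta R).
Local Notation sqnorm := (@sqnorm R).
Local Notation plane := (measurableTypeR R * measurableTypeR R)%type.
Local Notation nu := (@disc_leb R).
Variable z : nat -> R.
Hypothesis Hz : J0_zeros z.
Implicit Types (a b : nat -> R).

(** The limit clause of [phi] for deterministic coefficients; [phi] unfolds to it at the
    coefficients of a sample. *)
Definition series_limit a b : R * R -> R * R :=
  fun x => let f := fun N => (combination z N a b x).1 in
           let g := fun N => (combination z N a b x).2 in
           if `[< cvgn f >] && `[< cvgn g >] then (limn f, limn g) else (0, 0).

Let me n : measurable_fun setT (fun x : plane => e z n x).
Proof. exact: measurable_e. Qed.

Lemma measurable_combination N a b :
  measurable_fun setT (fun x : plane => (combination z N a b x).1) /\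
  measurable_fun setT (fun x : plane => (combination z N a b x).2).
Proof. by split; exact: measurable_ortho_sum. Qed.

Lemma measurable_series_limit a b :
  measurable_fun setT (fun x : plane => (series_limit a b x).1) /\
  measurable_fun setT (fun x : plane => (series_limit a b x).2).
Proof.
pose A : set plane := [set x | cvgn (fun N => (combination z N a b x).1)] `&`
  [set x | cvgn (fun N => (combination z N a b x).2)].
have m1 N := (measurable_combination N a b).1.
have m2 N := (measurable_combination N a b).2.
have mA : measurable A by apply: measurableI; exact: measurable_cvgn.
split.
- rewrite (_ : (fun x => _) = fun x : plane => if `[< A x >] then
    limn (fun N => (combination z N a b x).1) else 0).
    by apply: measurable_lim_if => // x [].
  by apply/funext => x; rewrite /series_limit /A/= asbool_and; case: ifP.
- rewrite (_ : (fun x => _) = fun x : plane => if `[< A x >] then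
    limn (fun N => (combination z N a b x).2) else 0).
    by apply: measurable_lim_if => // x [].
  by apply/funext => x; rewrite /series_limit /A/= asbool_and; case: ifP.
Qed.

Lemma radial_series_limit a b : radial (series_limit a b).
Proof.
move=> x y _ _ xy; have E : (fun N => combination z N a b x) = fun N => combination z N a b y.
  apply/funext => N; rewrite /combination /ortho_sum.
  by congr pair; apply: eq_bigr => n _; rewrite /e xy.
rewrite /series_limit (_ : (fun N => (combination z N a b x).1) =
  (fun N => (combination z N a b y).1)); last first.
  by apply/funext => N; rewrite (congr1 (fun f => (f N).1) E).
rewrite (_ : (fun N => (combination z N a b x).2) =
  (fun N => (combination z N a b y).2))//.
by apply/funext => N; rewrite (congr1 (fun f => (f N).2) E).
Qed.

(** It involves [punctured] eigenfunctions, whose bound by 1/|x| holds everywhere; the change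
    affects a null set only. *)
Definition pointwise_majorant a (x : plane) : \bar R :=
  abel_majorant (fun n => a n * punctured z n x).

Lemma measurable_pointwise_majorant a : measurable_fun setT (pointwise_majorant a).
Proof.
apply: ge0_emeasurable_sum => [n x _ _|n _]; first by rewrite lee_fin abel_term_ge0.
apply: measurable_fun_EFin; apply: measurable_funM => //.
apply: measurable_funX; apply: measurable_sum => i.
by do 2 apply: measurable_funM => //; exact: measurable_punctured.
Qed.

Lemma pointwise_majorant_ge0 a x : (0 <= pointwise_majorant a x)%E.
Proof. by apply: nneseries_ge0 => n _ _; rewrite lee_fin abel_term_ge0. Qed.

Variables (a b : nat -> R).
Hypotheses (Ma : (\int[nu]_x pointwise_majorant a x < +oo)%E)
  (Mb : (\int[nu]_x pointwise_majorant b x < +oo)%E).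

Let majorant x : \bar R := (pointwise_majorant a x + pointwise_majorant b x)%E.

Let mmaj : measurable_fun setT majorant.
Proof. by apply: emeasurable_funD; exact: measurable_pointwise_majorant. Qed.

Let maj_ge0 x : (0 <= majorant x)%E.
Proof. by rewrite adde_ge0// pointwise_majorant_ge0. Qed.

Let imaj : nu.-integrable setT majorant.
Proof.
apply/integrableP; split => //.
under eq_integral do rewrite gee0_abs//.
rewrite ge0_integralD//; first by rewrite lte_add_pinfty.
- by move=> x _; exact: pointwise_majorant_ge0.
- exact: measurable_pointwise_majorant.
- by move=> x _; exact: pointwise_majorant_ge0.
- exact: measurable_pointwise_majorant.
Qed.

Let combE N x c : sqnorm x != 0 ->
  ortho_sum (e z) N c x = \sum_(n < N) c n * punctured z n x.
Proof. by move=> x0; apply: eq_bigr => n _; rewrite /punctured (negbTE x0). Qed.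

Let ae_good : {ae nu, forall x, sqnorm x != 0 /\ (majorant x < +oo)%E}.
Proof.
have h1 : {ae nu, forall x : plane, sqnorm x != 0}.
  exists [set x | sqnorm x = 0]; split; [exact: measurable_origin|exact: disc_leb_origin|].
  by move=> x /= /negP; rewrite negbK => /eqP.
have h2 := integrable_ae measurableT imaj.
apply: filterS2 h1 h2 => x x0 /(_ I) fx; split => //.
by rewrite -ge0_fin_numE.
Qed.

Let good_cvg x : sqnorm x != 0 -> (majorant x < +oo)%E ->
  (fun N => (combination z N a b x).1) @ \oo --> (series_limit a b x).1 /\
  (fun N => (combination z N a b x).2) @ \oo --> (series_limit a b x).2.
Proof.
move=> x0 foo.
have [ha hb] : (pointwise_majorant a x < +oo)%E /\ (pointwise_majorant b x < +oo)%E.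
  split; apply: le_lt_trans foo; rewrite /majorant; first by rewrite leeDl// pointwise_majorant_ge0.
  by rewrite leeDr// pointwise_majorant_ge0.
have ca : cvgn (fun N => (combination z N a b x).1).
  by rewrite /= (_ : (fun N => _) = fun N => \sum_(n < N) a n * punctured z n x);
    [exact: (abel_majorant_cvg ha)|apply/funext => N; exact: combE].
have cb : cvgn (fun N => (combination z N a b x).2).
  by rewrite /= (_ : (fun N => _) = fun N => \sum_(n < N) b n * punctured z n x);
    [exact: (abel_majorant_cvg hb)|apply/funext => N; exact: combE].
by rewrite /series_limit; move: (ca) (cb) => /asboolP -> /asboolP -> /=; split.
Qed.

Let good_le x N : sqnorm x != 0 ->
  (((combination z N a b x).1 ^+ 8 + (combination z N a b x).2 ^+ 8)%:E <=
    256%:E * majorant x)%E.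
Proof.
move=> x0; rewrite EFinD /majorant ge0_muleDr ?pointwise_majorant_ge0//=.
by rewrite !combE//; apply: leeD; exact: abel_majorant_ge.
Qed.

(** Any functional of growth at most eight passes to the limit, because one integrable function
    dominates the eighth powers of all partial sums. It is applied to the coefficients, to the L^2
    norm and to the potential. *)
Lemma series_limit_dominated (F : nat -> plane -> R) (f : plane -> R) (C : R) :
  (forall N, measurable_fun setT (F N)) -> measurable_fun setT f -> 0 <= C ->
  (forall N x, `|F N x| <=
    C * (1 + ((combination z N a b x).1 ^+ 8 + (combination z N a b x).2 ^+ 8))) ->
  (forall x, (fun N => (combination z N a b x).1) @ \oo --> (series_limit a b x).1 ->
    (fun N => (combination z N a b x).2) @ \oo --> (series_limit a b x).2 ->
    F ^~ x @ \oo --> f x) ->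
  nu.-integrable setT (fun x => (f x)%:E) /\
  (fun N => Rintegral leb2 Theta (F N)) @ \oo --> Rintegral leb2 Theta f.
Proof.
move=> mF mf C0 FC Fc.
have [| | | | |i1 _ c1] := @dominated_convergence _ plane R nu setT measurableT
  (fun N x => (F N x)%:E) (fun x => (f x)%:E)
  (fun x => (C%:E * (1%:E + 256%:E * majorant x))%E).
- by move=> N; exact: (@measurable_fun_EFin R _ plane setT).
- exact: (@measurable_fun_EFin R _ plane setT).
- apply: (@filterS _ _ (ae_filter_ringOfSetsType nu) _ _ _ ae_good) => x [x0 foo] _.
  have [h1 h2] := good_cvg x0 foo.
  by apply/fine_cvgP; split; [exact: nearW|exact: Fc].
- apply: integrableZl => //; apply: integrableD => //.
    by apply: (@bounded_integrable _ _ _ nu (fun=> 1) 1) => // x; rewrite normr1.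
  exact: integrableZl.
- apply: (@filterS _ _ (ae_filter_ringOfSetsType nu) _ _ _ ae_good) => x [x0 foo] N _.
  rewrite (_ : `|(F N x)%:E|%E = (`|F N x|)%:E)//.
  apply: (@le_trans _ _ (C * (1 + ((combination z N a b x).1 ^+ 8 +
    (combination z N a b x).2 ^+ 8)))%:E); first by rewrite lee_fin.
  by rewrite EFinM lee_wpmul2l ?lee_fin// EFinD leeD2l// good_le.
split => //; rewrite (Rintegral_disc_leb mf).
rewrite (_ : (fun N => _) = fun N => fine (\int[nu]_x (F N x)%:E)); last first.
  by apply/funext => N; rewrite (Rintegral_disc_leb (mF N)).
apply: fine_cvg; rewrite fineK//.
exact: (integrable_fin_num measurableT i1).
Qed.

End SeriesLimit.

Section SeriesLimitFunctionals.
Variable R : realType.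
Local Notation leb2 := (@leb2 R).
Local Notation Theta := (@Theta R).
Local Notation plane := (measurableTypeR R * measurableTypeR R)%type.
Local Notation nu := (@disc_leb R).
Variable z : nat -> R.
Hypothesis Hz : J0_zeros z.
Variables (a b : nat -> R).
Hypotheses (Ma : (\int[nu]_x pointwise_majorant z a x < +oo)%E)
  (Mb : (\int[nu]_x pointwise_majorant z b x < +oo)%E).
Local Notation slim := (series_limit z a b).

Let m1 N := (measurable_combination z N a b).1.
Let m2 N := (measurable_combination z N a b).2.
Let s1 := (measurable_series_limit z a b).1.
Let s2 := (measurable_series_limit z a b).2.

Let norm_le_pow8 (p : R) : `|p| <= 1 + p ^+ 8.
Proof.
have [h|h] := leP `|p| 1; first by rewrite (le_trans h)// lerDl exprn_even_ge0.
apply: (@le_trans _ _ (p ^+ 8)); last by rewrite lerDr.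
rewrite -[p ^+ 8]ger0_norm ?exprn_even_ge0// normrX.
by rewrite -{1}(expr1 `|p|) ler_weXn2l// ltW.
Qed.

Let sq_le_pow8 (p : R) : p ^+ 2 <= 1 + p ^+ 8.
Proof.
have -> : p ^+ 8 = (p ^+ 2) ^+ 4 by rewrite -exprM.
have := sqr_ge0 p; move: (p ^+ 2) => t t0.
have [h|h] := leP t 1; first by rewrite (le_trans h)// lerDl exprn_ge0.
apply: (@le_trans _ _ (t ^+ 4)); last by rewrite lerDr.
by rewrite -{1}(expr1 t) ler_weXn2l// ltW.
Qed.

(** By orthonormality the n-th coefficient of a partial sum is constant as soon as N > n, and
    dominated convergence transfers this constant to the limit. *)
Lemma coef_series_limit n : coef z n slim = (a n, b n).
Proof.
have me : measurable_fun setT (fun x : plane => e z n x) by exact: measurable_e.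
have bnd (p q : R) (x : plane) : `|p * e z n x| <=
    Num.sqrt (eigen_sup Hz * z n) * (1 + (p ^+ 8 + q ^+ 8)).
  rewrite normrM mulrC ler_pM//; first exact: e_norm_le.
  by apply: (le_trans (norm_le_pow8 p)); rewrite addrA lerDl exprn_even_ge0.
have bnd' (p q : R) (x : plane) : `|q * e z n x| <=
    Num.sqrt (eigen_sup Hz * z n) * (1 + (p ^+ 8 + q ^+ 8)).
  by rewrite [p ^+ 8 + _]addrC; exact: bnd.
have lim_eq (u : nat -> R) (l c : R) : u @ \oo --> l ->
    (forall N, (n < N)%N -> u N = c) -> l = c.
  move=> ul uc; apply: (@cvg_unique _ _ (u @ \oo)) => //.
  by apply: cvg_near_cst; exists n.+1 => // N /= nN; rewrite uc.
have [_ c1] := series_limit_dominated Ma Mb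
  (F := fun N x => (combination z N a b x).1 * e z n x)
  (f := fun x => (slim x).1 * e z n x) (fun N => measurable_funM (m1 N) me)
  (measurable_funM s1 me) (sqrtr_ge0 _) (fun N x => bnd _ _ x)
  (fun x h1 _ => cvgM h1 (cvg_cst _)).
have [_ c2] := series_limit_dominated Ma Mb
  (F := fun N x => (combination z N a b x).2 * e z n x)
  (f := fun x => (slim x).2 * e z n x) (fun N => measurable_funM (m2 N) me)
  (measurable_funM s2 me) (sqrtr_ge0 _)
  (fun N x => bnd' _ _ x)
  (fun x _ h2 => cvgM h2 (cvg_cst _)).
rewrite /coef; congr pair.
- apply: (lim_eq _ _ _ c1) => N nN.
  by have := ortho_sum_coef Hz N a n; rewrite nN.
- apply: (lim_eq _ _ _ c2) => N nN.
  by have := ortho_sum_coef Hz N b n; rewrite nN.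
Qed.

Lemma SN_series_limit N : SN z N slim = combination z N a b.
Proof.
rewrite SN_combination; apply/funext => x; rewrite /combination /ortho_sum.
by congr pair; apply: eq_bigr => n _; rewrite coef_series_limit.
Qed.

Let cmod_le (p : R * R) : cmod p ^+ 2 <= 2 * (1 + (p.1 ^+ 8 + p.2 ^+ 8)).
Proof.
rewrite cmod_sq /sqnorm.
apply: (le_trans (lerD (sq_le_pow8 p.1) (sq_le_pow8 p.2))).
have : 0 <= p.1 ^+ 8 by rewrite exprn_even_ge0.
have : 0 <= p.2 ^+ 8 by rewrite exprn_even_ge0.
by move: (p.1 ^+ 8) (p.2 ^+ 8) => t r; lra.
Qed.

Let cmod_sq_cvg x :
  (fun N => (combination z N a b x).1) @ \oo --> (slim x).1 ->
  (fun N => (combination z N a b x).2) @ \oo --> (slim x).2 ->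
  (fun N => cmod (combination z N a b x) ^+ 2) @ \oo --> cmod (slim x) ^+ 2.
Proof.
move=> h1 h2; under eq_fun do rewrite cmod_sq; rewrite cmod_sq.
by apply: cvgD; rewrite /= expr2; under eq_fun do rewrite expr2; apply: cvgM.
Qed.

Let mcmod (u : plane -> plane) : measurable_fun setT (fun x => (u x).1) ->
  measurable_fun setT (fun x => (u x).2) ->
  measurable_fun setT (fun x : plane => cmod (u x) ^+ 2).
Proof.
move=> mu1 mu2; rewrite (_ : (fun x => _) = fun x : plane => (u x).1 ^+ 2 + (u x).2 ^+ 2).
  by apply: measurable_funD; exact: measurable_funX.
by apply/funext => x; rewrite cmod_sq.
Qed.

Let L2 : nu.-integrable setT (fun x => (cmod (slim x) ^+ 2)%:E) /\
  (fun N => Rintegral leb2 Theta (fun x => cmod (combination z N a b x) ^+ 2)) @ \oo -->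
  Rintegral leb2 Theta (fun x => cmod (slim x) ^+ 2).
Proof.
apply: (series_limit_dominated Ma Mb (C := 2)
  (F := fun N x => cmod (combination z N a b x) ^+ 2)) => //.
- by move=> N; exact: (mcmod (m1 N) (m2 N)).
- exact: (mcmod s1 s2).
- by move=> N x; rewrite ger0_norm ?sqr_ge0.
Qed.

Lemma series_limit_sq_lty :
  (\int[leb2]_(x in Theta) (cmod (slim x) ^+ 2)%:E < +oo)%E.
Proof.
rewrite (integral_disc_leb (f := fun x : plane => (cmod (slim x) ^+ 2)%:E)); last first.
  by apply: (@measurable_fun_EFin R _ plane setT); exact: mcmod.
have := integrable_fin_num measurableT L2.1.
by rewrite ge0_fin_numE// integral_ge0// => x _; rewrite lee_fin sqr_ge0.
Qed.

Lemma L2norm_series_limit : (fun N => L2norm (combination z N a b)) @ \oo --> L2norm slim.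
Proof. by apply: continuous_cvg; [exact: sqrt_continuous|exact: L2.2]. Qed.

Lemma series_limit_Hrad sigma :
  (\sum_(0 <= n <oo) (z n `^ (2 * sigma) * (a n ^+ 2 + b n ^+ 2))%:E < +oo)%E ->
  Hrad z sigma slim.
Proof.
move=> Hoo; split.
- by apply: measurable_fun_disc.
- exact: radial_series_limit.
- exact: series_limit_sq_lty.
- apply: le_lt_trans Hoo; apply: lee_nneseries => n *.
    by rewrite lee_fin mulr_ge0 ?powR_ge0 ?sqr_ge0.
  by rewrite coef_series_limit cmod_sq.
Qed.

Variables (V : R * R -> R) (G chi : R -> R) (CV : R).
Hypotheses (VG : forall p, V p = G (cmod p ^+ 2)) (Gc : continuous G)
  (cchi : continuous chi) (CV0 : 0 <= CV)
  (Vle : forall p, `|V p| <= CV * (1 + (p.1 ^+ 8 + p.2 ^+ 8))).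

Lemma measurable_potential (u : plane -> plane) : measurable_fun setT (fun x => (u x).1) ->
  measurable_fun setT (fun x => (u x).2) -> measurable_fun setT (fun x : plane => V (u x)).
Proof.
move=> mu1 mu2; rewrite (_ : (fun x => _) = fun x : plane => G (cmod (u x) ^+ 2)).
  apply: (measurableT_comp (f := G)); first exact: measurable_fun_continuous.
  exact: mcmod.
by apply/funext => x; rewrite VG.
Qed.

Lemma fdens_series_limit :
  (fun N => fdens chi V (combination z N a b)) @ \oo --> fdens chi V slim.
Proof.
apply: cvgM; first by apply: continuous_cvg; [exact: cchi|exact: L2norm_series_limit].
have Vc (x : R * R) : (fun N => (combination z N a b x).1) @ \oo --> (slim x).1 ->
    (fun N => (combination z N a b x).2) @ \oo --> (slim x).2 ->
    (fun N => V (combination z N a b x)) @ \oo --> V (slim x).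
  move=> h1 h2; rewrite VG.
  rewrite (_ : (fun N => _) = fun N => G (cmod (combination z N a b x) ^+ 2)).
    by apply: continuous_cvg; [exact: Gc|exact: cmod_sq_cvg].
  by apply/funext => N; rewrite VG.
have [_ c] := series_limit_dominated Ma Mb (C := CV)
  (F := fun N x => V (combination z N a b x)) (f := fun x => V (slim x))
  (fun N => measurable_potential (m1 N) (m2 N)) (measurable_potential s1 s2) CV0
  (fun N x => Vle _) Vc.
by apply: continuous_cvg; [exact: continuous_expR|exact: cvgN c].
Qed.

End SeriesLimitFunctionals.

(** * Joint measurability in the point and the sample *)

Section RandomFields.
Variable R : realType.
Local Notation leb2 := (@leb2 R).
Local Notation Theta := (@Theta R).
Local Notation plane := (measurableTypeR R * measurableTypeR R)%type.
Local Notation nu := (@disc_leb R).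
Variable z : nat -> R.
Context d (Omega : measurableType d).

Section functionals.
Variable Y : Omega -> R * R -> R * R.
Hypotheses (mY1 : measurable_fun setT (fun p : plane * Omega => (Y p.2 p.1).1))
  (mY2 : measurable_fun setT (fun p : plane * Omega => (Y p.2 p.1).2)).

Lemma measurable_section w : measurable_fun setT (fun x : plane => (Y w x).1) /\
  measurable_fun setT (fun x : plane => (Y w x).2).
Proof.
split; first exact: (measurable_fun_pair1 (f := fun p : plane * Omega => (Y p.2 p.1).1)).
exact: (measurable_fun_pair1 (f := fun p : plane * Omega => (Y p.2 p.1).2)).
Qed.

Lemma measurable_field_disc w : measurable_fun Theta (Y w).
Proof. by have [h1 h2] := measurable_section w; exact: measurable_fun_disc. Qed.

Let mcmod : measurable_fun setT (fun p : plane * Omega => cmod (Y p.2 p.1) ^+ 2).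
Proof.
rewrite (_ : (fun p => _) = fun p : plane * Omega => (Y p.2 p.1).1 ^+ 2 + (Y p.2 p.1).2 ^+ 2).
  by apply: measurable_funD; exact: measurable_funX.
by apply/funext => p; rewrite cmod_sq.
Qed.

Let mcmod_section w : measurable_fun setT (fun x : plane => cmod (Y w x) ^+ 2).
Proof. exact: (measurable_fun_pair1 (f := fun p : plane * Omega => cmod (Y p.2 p.1) ^+ 2)). Qed.

Lemma measurable_field_sq :
  measurable_fun setT (fun w => \int[leb2]_(x in Theta) (cmod (Y w x) ^+ 2)%:E)%E.
Proof.
rewrite (_ : (fun w => _) = (fun w => \int[nu]_x (cmod (Y w x) ^+ 2)%:E)%E).
  apply: (measurable_fun_fubini_tonelli_G (m1 := nu)
    (fun p : plane * Omega => (cmod (Y p.2 p.1) ^+ 2)%:E)).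
    exact: (@measurable_fun_EFin R _ (plane * Omega)%type setT).
  by move=> p; rewrite lee_fin sqr_ge0.
apply/funext => w; apply: (integral_disc_leb (f := fun x : plane => (cmod (Y w x) ^+ 2)%:E)).
exact: (@measurable_fun_EFin R _ plane setT).
Qed.

Let mRint (F : plane * Omega -> R) : measurable_fun setT F ->
  measurable_fun setT (fun w => Rintegral leb2 Theta (fun x => F (x, w))).
Proof.
move=> mF; rewrite (_ : (fun w => _) = fun w => fine (\int[nu]_x (F (x, w))%:E)%E).
  exact: measurable_param_integral.
apply/funext => w; apply: (Rintegral_disc_leb (f := fun x => F (x, w))).
exact: (measurable_fun_pair1 (f := F)).
Qed.

Let me n : measurable_fun setT (fun p : plane * Omega => e z n p.1).
Proof.
by apply: (measurableT_comp (f := e z n : plane -> R)); [exact: measurable_e|exact: measurable_fst].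
Qed.

Lemma measurable_field_coef n : measurable_fun setT (fun w => (coef z n (Y w)).1) /\
  measurable_fun setT (fun w => (coef z n (Y w)).2).
Proof.
split.
- exact: (mRint (measurable_funM mY1 (me n))).
- exact: (mRint (measurable_funM mY2 (me n))).
Qed.

Lemma measurable_field_openH (Hz : J0_zeros z) sigma U :
  (forall w, radial (Y w)) -> openH z sigma U ->
  measurable [set w | Hrad z sigma (Y w)] /\ measurable [set w | U (Y w)].
Proof.
move=> rY Uo; apply: measurable_openH => //.
- exact: measurable_field_disc.
- exact: measurable_field_sq.
- by move=> n; exact: (measurable_field_coef n).1.
- by move=> n; exact: (measurable_field_coef n).2.
Qed.

Variables (V : R * R -> R) (G chi : R -> R).
Hypotheses (VG : forall p, V p = G (cmod p ^+ 2)) (Gc : continuous G)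
  (cchi : continuous chi).

Lemma measurable_fdens : measurable_fun setT (fun w => fdens chi V (Y w)).
Proof.
apply: measurable_funM.
  apply: (measurableT_comp (f := chi)); first exact: measurable_fun_continuous.
  apply: (measurableT_comp (f := @Num.sqrt R)).
    by apply: measurable_fun_continuous; exact: sqrt_continuous.
  exact: (mRint mcmod).
apply: (measurableT_comp (f := @expR R)); first exact: measurable_expR.
apply: measurableT_comp => //.
apply: (mRint (F := fun p => V (Y p.2 p.1))).
rewrite (_ : (fun p => _) = fun p : plane * Omega => G (cmod (Y p.2 p.1) ^+ 2)).
  by apply: (measurableT_comp (f := G)); first exact: measurable_fun_continuous.
by apply/funext => p; rewrite VG.
Qed.

End functionals.

Variables (A B : Omega -> nat -> R).
Hypotheses (mA : forall n, measurable_fun setT (A ^~ n))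
  (mB : forall n, measurable_fun setT (B ^~ n)).

Let measurable_ortho (C : Omega -> nat -> R) N : (forall n, measurable_fun setT (C ^~ n)) ->
  measurable_fun setT (fun p : plane * Omega => ortho_sum (e z) N (C p.2) p.1).
Proof.
move=> mC; apply: measurable_sum => n; apply: measurable_funM.
  by apply: (measurableT_comp (mC n)); exact: measurable_snd.
by apply: (measurableT_comp (f := e z n : plane -> R)); [exact: measurable_e|exact: measurable_fst].
Qed.

Lemma measurable_combination_field N :
  measurable_fun setT (fun p : plane * Omega => (combination z N (A p.2) (B p.2) p.1).1) /\
  measurable_fun setT (fun p : plane * Omega => (combination z N (A p.2) (B p.2) p.1).2).
Proof. by split; exact: measurable_ortho. Qed.

Lemma measurable_series_limit_field :
  measurable_fun setT (fun p : plane * Omega => (series_limit z (A p.2) (B p.2) p.1).1) /\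
  measurable_fun setT (fun p : plane * Omega => (series_limit z (A p.2) (B p.2) p.1).2).
Proof.
have m1 N := (measurable_combination_field N).1.
have m2 N := (measurable_combination_field N).2.
pose D : set (plane * Omega) :=
  [set p | cvgn (fun N => (combination z N (A p.2) (B p.2) p.1).1)] `&`
  [set p | cvgn (fun N => (combination z N (A p.2) (B p.2) p.1).2)].
have mD : measurable D by apply: measurableI; exact: measurable_cvgn.
split.
- rewrite (_ : (fun p => _) = fun p : plane * Omega => if `[< D p >] then
    limn (fun N => (combination z N (A p.2) (B p.2) p.1).1) else 0).
    by apply: measurable_lim_if => // x [].
  by apply/funext => x; rewrite /series_limit /D/= asbool_and; case: ifP.
- rewrite (_ : (fun p => _) = fun p : plane * Omega => if `[< D p >] then
    limn (fun N => (combination z N (A p.2) (B p.2) p.1).2) else 0).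
    by apply: measurable_lim_if => // x [].
  by apply/funext => x; rewrite /series_limit /D/= asbool_and; case: ifP.
Qed.

End RandomFields.

(** * Almost sure properties of the Gaussian series *)

Section GaussianSeries.
Variable R : realType.
Local Notation plane := (measurableTypeR R * measurableTypeR R)%type.
Local Notation nu := (@disc_leb R).
Variable z : nat -> R.
Hypothesis Hz : J0_zeros z.
Context d (Omega : measurableType d) (P : probability Omega R).
Variable X : nat -> Omega -> R.
Hypotheses (mX : forall i, measurable_fun setT (X i))
  (lX : forall i B, measurable B -> P (X i @^-1` B) = normal_prob 0 1 B)
  (iX : mutually_independent P X).

Definition gauss_coef w n : R := X n w / (Num.sqrt 2 * z n).

Lemma gauss_coefE w n : gauss_coef w n = series_coef X z w n.
Proof. by rewrite /gauss_coef /series_coef mulrC. Qed.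

Lemma measurable_gauss_coef n : measurable_fun setT (gauss_coef ^~ n).
Proof. exact: measurable_funM. Qed.

Let nonneg_ae_lty (f : Omega -> \bar R) : measurable_fun setT f ->
  (forall w, (0 <= f w)%E) -> (\int[P]_w f w < +oo)%E -> {ae P, forall w, (f w < +oo)%E}.
Proof.
move=> mf f0 foo; have fi : P.-integrable setT f.
  by apply/integrableP; split => //; under eq_integral do rewrite gee0_abs//.
apply: filterS (integrable_ae measurableT fi) => w /(_ I).
by rewrite ge0_fin_numE.
Qed.

Let majorantE w x : pointwise_majorant z (gauss_coef w) x =
  abel_majorant (fun n => ((Num.sqrt 2 * z n)^-1 * punctured z n x) * X n w).
Proof.
by congr abel_majorant; apply/funext => n; rewrite /gauss_coef; ring.
Qed.

(** Its expectation is finite because |x|^(-8/5) is integrable on the disc. *)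
Lemma pointwise_majorant_ae :
  {ae P, forall w, (\int[nu]_x pointwise_majorant z (gauss_coef w) x < +oo)%E}.
Proof.
have [A A0 AP] := punctured_coef_le Hz.
have ma n : measurable_fun setT (fun x : plane => (Num.sqrt 2 * z n)^-1 * punctured z n x).
  by apply: measurable_funM => //; exact: measurable_punctured.
have r1 : forall x : plane, 1 <= invr_cmod x by exact: invr_cmod_ge1.
have ri : (\int[nu]_x (invr_cmod x `^ (8 / 5))%:E < +oo)%E.
  by apply: integral_invr_cmod_lty; lra.
have mj := measurable_series_majorant mX ma.
have int := series_majorant_integrable mX lX iX ma A0 r1 (@measurable_invr_cmod R) AP ri.
apply: nonneg_ae_lty.
- under eq_fun do under eq_integral do rewrite majorantE.
  apply: (measurable_fun_fubini_tonelli_G (m1 := nu) _ mj) => p.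
  by apply: nneseries_ge0 => n _ _; rewrite lee_fin abel_term_ge0.
- by move=> w; apply: integral_ge0 => x _; exact: pointwise_majorant_ge0.
- by under eq_integral do under eq_integral do rewrite majorantE.
Qed.

Let sq_le_expR (x : R) : x ^+ 2 <= 4 * (expR (1 * x) + expR (- 1 * x)).
Proof.
rewrite mul1r mulN1r; wlog x0 : x / 0 <= x => [H|].
  have [/H//|/ltW x0] := leP 0 x.
  by have := H (- x); rewrite oppr_ge0 opprK sqrrN addrC => /(_ x0).
apply: (@le_trans _ _ (4 * expR x)); last first.
  by rewrite ler_wpM2l// lerDl expR_ge0.
have h : 0 <= x / 2 <= expR (x / 2).
  by rewrite divr_ge0//=; apply: le_trans (expR_ge1Dx _); rewrite lerDr.
have -> : expR x = expR (x / 2) ^+ 2 by rewrite -expRM_natl; congr expR; field.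
have /andP[h0 h1] := h.
have : (x / 2) ^+ 2 <= expR (x / 2) ^+ 2 by rewrite lerXn2r ?nnegrE ?expR_ge0.
by have -> : (x / 2) ^+ 2 = x ^+ 2 / 4 by [field]; lra.
Qed.

Let sq_moment n : (\int[P]_w (X n w ^+ 2)%:E <= (8 * expR (1 / 2))%:E)%E.
Proof.
have mE t : measurable_fun setT (fun w => (expR (t * X n w))%:E).
  apply: measurable_fun_EFin; apply: (measurableT_comp (f := @expR R)).
    exact: measurable_expR.
  exact: measurable_funM.
apply: (@le_trans _ _ (\int[P]_w (4%:E * ((expR (1 * X n w))%:E + (expR (- 1 * X n w))%:E)))%E).
  apply: ge0_le_integral => //.
  - by move=> w _; rewrite lee_fin sqr_ge0.
  - by apply: measurable_fun_EFin; exact: measurable_funX.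
  - by apply: emeasurable_funM => //; exact: emeasurable_funD.
  - by move=> w _; rewrite -EFinD -EFinM lee_fin.
rewrite ge0_integralZl//; last 2 first.
- exact: emeasurable_funD.
- by move=> w _; rewrite -EFinD lee_fin addr_ge0 ?expR_ge0.
rewrite ge0_integralD//; try by move=> w _; rewrite lee_fin expR_ge0.
rewrite !(normal_mgf _ (mX n) (lX n)) sqrrN expr1n -EFinD -EFinM lee_fin.
by rewrite le_eqVlt; apply/orP; left; apply/eqP; ring.
Qed.

(** Second moments of the Gaussians are bounded, so the expectation is of the order of the sum of
    z_n^(2 sigma - 2). As z_n >= c n, it converges precisely because 2 sigma - 2 < -1. *)
Lemma sobolev_sum_ae sigma : sigma < 1 / 2 ->
  {ae P, forall w, (\sum_(0 <= n <oo) (z n `^ (2 * sigma) * gauss_coef w n ^+ 2)%:E < +oo)%E}.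
Proof.
move=> s12; have [c /andP[c0 c1] zc] := zeros_growth Hz.
have mt n : measurable_fun setT (fun w => (z n `^ (2 * sigma) * gauss_coef w n ^+ 2)%:E).
  apply: measurable_fun_EFin; apply: measurable_funM => //.
  by apply: measurable_funX; exact: measurable_gauss_coef.
have t0 n w : (0 <= (z n `^ (2 * sigma) * gauss_coef w n ^+ 2)%:E)%E.
  by rewrite lee_fin mulr_ge0 ?powR_ge0 ?sqr_ge0.
apply: nonneg_ae_lty.
- by apply: ge0_emeasurable_sum => // n w _ _; exact: t0.
- by move=> w; apply: nneseries_ge0.
rewrite integral_nneseries//.
pose eps := 1 - 2 * sigma; have eps0 : 0 < eps by rewrite /eps; lra.
pose K := 8 * expR (1 / 2) / 2 * c `^ (- eps - 1) : R.
have K0 : 0 <= K by rewrite !mulr_ge0 ?powR_ge0 ?expR_ge0// invr_ge0.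
apply: (@le_lt_trans _ _ (K * (1 + eps^-1))%:E); last by rewrite ltry.
have tn n : (\int[P]_w (z n `^ (2 * sigma) * gauss_coef w n ^+ 2)%:E <=
    (K * n.+1%:R `^ (- eps - 1))%:E)%E.
  have z0 := zeros_gt0 Hz n.
  rewrite (eq_integral (fun w => ((2^-1 * z n `^ (- eps - 1))%:E * (X n w ^+ 2)%:E)%E)).
    rewrite ge0_integralZl//; first last.
    - by rewrite lee_fin mulr_ge0 ?powR_ge0// invr_ge0.
    - by move=> w _; rewrite lee_fin sqr_ge0.
    - by apply: measurable_fun_EFin; exact: measurable_funX.
    apply: (@le_trans _ _ ((2^-1 * z n `^ (- eps - 1))%:E * (8 * expR (1 / 2))%:E)%E).
      by rewrite lee_wpmul2l// ?lee_fin ?sq_moment// mulr_ge0 ?powR_ge0// invr_ge0.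
    rewrite -EFinM lee_fin /K.
    have -> : 2^-1 * z n `^ (- eps - 1) * (8 * expR (1 / 2)) =
      8 * expR (1 / 2) / 2 * z n `^ (- eps - 1) by ring.
    rewrite -[leRHS]mulrA; apply: ler_wpM2l.
      by rewrite !mulr_ge0 ?expR_ge0// invr_ge0.
    rewrite -powRM ?(ltW c0)//.
    have -> : - eps - 1 = - (1 + eps) by ring.
    rewrite !powRN lef_pV2 ?posrE ?powR_gt0 ?mulr_gt0//.
    apply: ge0_ler_powR; last exact: zc.
    - by rewrite addr_ge0 ?(ltW eps0).
    - by rewrite nnegrE mulr_ge0 ?(ltW c0).
    - by rewrite nnegrE ltW.
  move=> w _; rewrite -EFinM; congr _%:E.
  rewrite /gauss_coef exprMn exprVn exprMn sqr_sqrtr// invfM.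
  have -> : - eps - 1 = 2 * sigma + - 2 by rewrite /eps; ring.
  rewrite powRD; last by rewrite (gt_eqF z0) implybT.
  by rewrite (powRN (z n) 2) powR_mulrn ?(ltW z0)//; ring.
apply: lime_le.
  by apply: is_cvg_nneseries => n _ _; apply: integral_ge0.
apply: nearW => n; apply: (@le_trans _ _
    (\sum_(0 <= k < n) (K * k.+1%:R `^ (- eps - 1))%:E)%E).
  by apply: lee_sum => k _; exact: tn.
rewrite sumEFin lee_fin -mulr_sumr ler_wpM2l// big_mkord.
exact: zeta_le.
Qed.

(** Returning from the punctured to the true eigenfunctions changes the integrand at the origin
    only. *)
Let ortho_mass b N w : 0 < b -> lp_mass X nu (punctured z) z b N w =
  (\int[nu]_x (`|ortho_sum (e z) N (gauss_coef w) x| `^ b)%:E)%E.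
Proof.
move=> b0; have mp (E : nat -> plane -> R) (v : nat -> R) :
    (forall n, measurable_fun setT (E n)) ->
    measurable_fun setT (fun x : plane => (`|ortho_sum E N v x| `^ b)%:E).
  move=> mE; apply: (@measurable_fun_EFin R _ plane setT).
  apply: (measurableT_comp (f := fun t : R => t `^ b)); first exact: measurable_powR.
  by apply: measurableT_comp => //; exact: measurable_ortho_sum.
apply: disc_leb_ae.
- by apply: mp => n; exact: measurable_punctured.
- by apply: (mp (fun n => e z n)) => n; exact: measurable_e.
move=> x x0; congr (`|_| `^ _)%:E; apply: eq_bigr => n _.
by rewrite gauss_coefE /punctured (negbTE x0).
Qed.

Lemma gauss_exponential_moment b A K : 2 < b < 4 -> 0 <= A -> 0 <= K ->
  exists2 C, 0 <= C & forall N,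
  (\int[P]_w (expR (A * fine (\int[nu]_x (`|ortho_sum (e z) N (gauss_coef w) x| `^ b)%:E)) *
    \1_[set w | (\sum_(n < N) gauss_coef w n ^+ 2 <= K)%R] w)%:E <= C%:E)%E.
Proof.
move=> b24 A0 K0; have b0 : 0 < b by case/andP: b24 => /(lt_trans _) ->.
have [c c01 zc] := zeros_growth Hz.
have ri : (\int[nu]_x (invr_cmod x `^ (b / 2))%:E < +oo)%E.
  by apply: integral_invr_cmod_lty; case/andP: b24; lra.
have [C C0 CP] := @exponential_moment R d Omega P X mX lX iX _ plane nu (punctured z)
  (fun n => Num.sqrt (eigen_sup Hz * z n)) (@measurable_punctured R z)
  (punctured_norm_le Hz) (punctured_orthonormal Hz) z c (eigen_sup Hz) (@invr_cmod R)
  c01 zc (eigen_sup_gt0 Hz) (@invr_cmod_ge1 R) (@measurable_invr_cmod R)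
  (punctured_sq_le Hz) (punctured_sq_le_invr Hz) b b24 ri A K A0 K0.
exists C => // N; apply: le_trans (CP N).
rewrite le_eqVlt; apply/orP; left; apply/eqP; apply: eq_integral => w _.
rewrite -(ortho_mass _ _ b0); congr (_ * \1_ _ _)%:E.
rewrite /energy; apply/funext => v /=.
by congr (_ <= K)%R; apply: eq_bigr => n _; rewrite gauss_coefE.
Qed.

End GaussianSeries.

(** * The Gibbs measure *)

(** It extracts the families of real and of imaginary parts from the joint family indexed by pairs;
    the left inverse g transports the test sets. *)
Lemma mutually_independent_reindex (R : realType) d (T : measurableType d)
    (P : probability T R) (I J : eqType) (X : J -> T -> R) (f : I -> J) (g : J -> I) :
  cancel f g -> mutually_independent P X -> mutually_independent P (fun i => X (f i)).
Proof.
move=> fg iX s B us mB.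
have := iX (map f s) (fun j => B (g j)) _ (fun j => mB (g j)).
rewrite (map_inj_uniq (can_inj fg)) big_map => /(_ us) h.
rewrite (_ : \bigcap_(i in _) _ = \bigcap_(i in [set` map f s]) (X i @^-1` B (g i))).
  by rewrite h; apply: eq_bigr => i _; rewrite fg.
apply/seteqP; split => t /= H i.
  by move=> /mapP[j js ->]; rewrite /= fg; exact: H.
by move=> si; have := H (f i); rewrite /= fg; apply; exact: map_f.
Qed.

(** * Bounds on the cut-off and on the potential *)

Section Bounds.
Variable R : realType.

Lemma compact_support_bounded (chi : R -> R) : continuous chi -> (forall x, 0 <= chi x) ->
  compact (closure [set x | chi x != 0]) ->
  exists M K : R, [/\ 0 <= M, 0 <= K, forall x, chi x <= M &
    forall x, chi x != 0 -> `|x| <= K].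
Proof.
move=> cchi chi0 cS; set S := [set x | _] in cS.
have [K [_ HK]] := compact_bounded cS.
have cI : compact (chi @` closure S).
  by apply: continuous_compact => //; exact: continuous_subspaceT.
have [M [_ HM]] := compact_bounded cI.
exists (`|M| + 1), (`|K| + 1); split; try by rewrite addr_ge0.
- move=> x; have [->|x0] := eqVneq (chi x) 0; first by rewrite addr_ge0.
  have h : M < `|M| + 1 by rewrite (le_lt_trans (ler_norm _))// ltrDl.
  apply: le_trans (ler_norm _) _; apply: (HM _ h).
  by exists x => //; exact: subset_closure.
- move=> x x0; apply: (HK (`|K| + 1)); first by rewrite (le_lt_trans (ler_norm _))// ltrDl.
  exact: subset_closure.
Qed.

Lemma cmod_le_add (w : R * R) : cmod w <= `|w.1| + `|w.2|.
Proof.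
rewrite -(ler_pXn2r (ltn0Sn 1)) ?nnegrE ?cmod_ge0 ?addr_ge0// cmod_sq /sqnorm.
rewrite -(real_normK (num_real w.1)) -(real_normK (num_real w.2)).
by rewrite sqrrD lerD2r lerDl mulrn_wge0// mulr_ge0.
Qed.

Lemma powR_cmod_le (q b : R) (w : R * R) : 0 < b -> q <= b ->
  (1 + cmod w) `^ q <= 2 `^ b * 2 `^ b * (1 + (`|w.1| `^ b + `|w.2| `^ b)).
Proof.
move=> b0 qb; have c0 := cmod_ge0 w.
have two1 : 1 <= 2 `^ b :> R.
  by rewrite -[leLHS](powRr0 (2 : R)); apply: ler_powR; rewrite ?ler1n// ltW.
apply: (@le_trans _ _ ((1 + cmod w) `^ b)).
  by apply: ler_powR => //; rewrite lerDl.
apply: (@le_trans _ _ (2 `^ b * (1 + cmod w `^ b))).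
  have := @powR_add_le R b 1 (cmod w) b0.
  by rewrite normr1 powR1 !ger0_norm// addr_ge0.
rewrite -mulrA ler_wpM2l ?powR_ge0//.
rewrite mulrDr mulr1 lerD//.
apply: (@le_trans _ _ (`| `|w.1| + `|w.2| | `^ b)).
  apply: ge0_ler_powR; rewrite ?nnegrE ?(ltW b0)//.
  by rewrite ger0_norm ?addr_ge0// cmod_le_add.
by have := @powR_add_le R b `|w.1| `|w.2| b0; rewrite !normr_id.
Qed.

(** As 2 + alpha < 6, the eighth powers controlled by the majorant dominate V. *)
Lemma potential_growth (V : R * R -> R) (alpha C : R) : alpha < 4 ->
  (forall w, cmod (wirt 0 0 V w) <= C * (1 + cmod w) `^ (2 + alpha - 0 - 0)) ->
  exists2 CV, 0 <= CV & forall w, `|V w| <= CV * (1 + (w.1 ^+ 8 + w.2 ^+ 8)).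
Proof.
move=> a4 VC; exists (`|C| * (2 `^ 8 * 2 `^ 8)); first by rewrite !mulr_ge0 ?powR_ge0.
move=> w; have := VC w; rewrite /wirt /= /cmod/= expr0n/= addr0 sqrtr_sqr !subr0.
rewrite -/(cmod w) => /le_trans; apply.
have c0 : 0 <= (1 + cmod w) `^ (2 + alpha) by exact: powR_ge0.
apply: (@le_trans _ _ (`|C| * (1 + cmod w) `^ (2 + alpha))).
  by rewrite ler_wpM2r// ler_norm.
rewrite -mulrA ler_wpM2l//.
have p8 (x : R) : x ^+ 8 = `|x| `^ 8.
  by rewrite powR_mulrn// -normrX ger0_norm// exprn_even_ge0.
by rewrite !p8; apply: powR_cmod_le => //; lra.
Qed.

(** The exponent has to lie strictly between 2 and 4, while beta may equal 2; the maximum with 3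
    repairs this. *)
Lemma potential_below (V : R * R -> R) (beta C : R) : beta < 4 -> 0 < C ->
  (forall w, - (C * (1 + cmod w) `^ beta) <= V w) ->
  exists b C', [/\ 2 < b < 4, 0 <= C' &
    forall w, - V w <= C' * (1 + (`|w.1| `^ b + `|w.2| `^ b))].
Proof.
move=> b4 C0 VC; exists (Num.max beta 3), (C * (2 `^ (Num.max beta 3) * 2 `^ (Num.max beta 3))).
have m0 : 0 < Num.max beta 3 by rewrite lt_max; apply/orP; right.
split.
- by rewrite lt_max gt_max b4; apply/andP; split; [apply/orP; right|]; lra.
- by rewrite !mulr_ge0 ?powR_ge0 ?(ltW C0).
- move=> w; have := VC w; rewrite lerNl => /le_trans; apply.
  by rewrite -mulrA ler_pM2l//; apply: powR_cmod_le => //; rewrite le_max lexx.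
Qed.

End Bounds.

(** The inequality exp(x + y) <= exp(2x) + exp(2y) separates real and imaginary parts, so that one
    exponential moment for each is enough. *)
Lemma powR_exp_split (R : realType) (t M C F D x y : R) : 1 <= t -> 0 <= M -> 0 <= F ->
  F <= M * expR (C * (D + (x + y))) ->
  F `^ t <= M `^ t * expR (t * C * D) * (expR (2 * t * C * x) + expR (2 * t * C * y)).
Proof.
move=> t1 M0 F0 FM; have t0 : 0 < t by rewrite (lt_le_trans ltr01).
apply: (@le_trans _ _ ((M * expR (C * (D + (x + y)))) `^ t)).
  by apply: ge0_ler_powR; rewrite ?nnegrE ?(ltW t0) ?mulr_ge0 ?expR_ge0.
rewrite powRM ?expR_ge0// -mulrA ler_wpM2l ?powR_ge0//.
rewrite powR_expR_ln ?expR_gt0// expRK.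
have -> : t * (C * (D + (x + y))) = t * C * D + (t * C * x + t * C * y) by ring.
rewrite expRD ler_wpM2l ?expR_ge0// expRD.
have sq v : expR (2 * t * C * v) = expR (t * C * v) ^+ 2.
  by rewrite -expRM_natl; congr expR; ring.
rewrite !sq; have := sqr_ge0 (expR (t * C * x) - expR (t * C * y)).
have := sqr_ge0 (expR (t * C * x)); have := sqr_ge0 (expR (t * C * y)).
by rewrite sqrrB mulr2n; lra.
Qed.

(** * Moments of the truncated densities, uniformly in the truncation *)

Section UniformMoment.
Variable R : realType.
Local Notation leb2 := (@leb2 R).
Local Notation Theta := (@Theta R).
Local Notation plane := (measurableTypeR R * measurableTypeR R)%type.
Local Notation nu := (@disc_leb R).
Variable z : nat -> R.
Hypothesis Hz : J0_zeros z.
Context d (Omega : measurableType d) (P : probability Omega R).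
Variables h l : nat -> Omega -> R.
Hypotheses (mh : forall i, measurable_fun setT (h i))
  (lh : forall i B, measurable B -> P (h i @^-1` B) = normal_prob 0 1 B)
  (ih : mutually_independent P h).
Hypotheses (ml : forall i, measurable_fun setT (l i))
  (ll : forall i B, measurable B -> P (l i @^-1` B) = normal_prob 0 1 B)
  (il : mutually_independent P l).
Variables (V : R * R -> R) (G chi : R -> R).
Hypotheses (VG : forall p, V p = G (cmod p ^+ 2)) (Gc : continuous G)
  (cchi : continuous chi) (chi0 : forall x, 0 <= chi x).
Variables (M K b C' CV : R).
Hypotheses (M0 : 0 <= M) (K0 : 0 <= K) (chiM : forall x, chi x <= M)
  (chiK : forall x, chi x != 0 -> `|x| <= K)
  (b24 : 2 < b < 4) (C'0 : 0 <= C')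
  (V_ge : forall w, - V w <= C' * (1 + (`|w.1| `^ b + `|w.2| `^ b)))
  (CV0 : 0 <= CV) (V_le : forall w, `|V w| <= CV * (1 + (w.1 ^+ 8 + w.2 ^+ 8))).

Let b0 : 0 < b. Proof. by case/andP: b24 => /(lt_trans _) ->. Qed.

Definition lp_norm_pow c N : R := fine (\int[nu]_x (`|ortho_sum (e z) N c x| `^ b)%:E)%E.

Let me n : measurable_fun setT (fun x : plane => e z n x).
Proof. exact: measurable_e. Qed.

Let ortho_bnd (c : nat -> R) N : R := \sum_(n < N) `|c n| * Num.sqrt (eigen_sup Hz * z n).

Let ortho_le c N (x : plane) : `|ortho_sum (e z) N c x| <= ortho_bnd c N.
Proof. exact: (ortho_sum_le (D := plane) (e_norm_le Hz)). Qed.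

Let mortho c N : measurable_fun setT (fun x : plane => ortho_sum (e z) N c x).
Proof. exact: measurable_ortho_sum. Qed.

Let mpow c N : measurable_fun setT (fun x : plane => `|ortho_sum (e z) N c x| `^ b).
Proof.
apply: (measurableT_comp (f := fun t : R => t `^ b)); first exact: measurable_powR.
by apply: measurableT_comp => //; exact: mortho.
Qed.

Let ipow c N : nu.-integrable setT (fun x => (`|ortho_sum (e z) N c x| `^ b)%:E).
Proof.
apply: (@bounded_integrable _ _ _ nu _ (ortho_bnd c N `^ b)); first exact: mpow.
move=> x; rewrite ger0_norm ?powR_ge0//; apply: ge0_ler_powR; rewrite ?nnegrE ?(ltW b0)//.
by apply: le_trans (ortho_le c N x); exact: normr_ge0.
Qed.

(** The two-sided bound on V makes it integrable, so that the integral is monotone; the one-sided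
    bound then gives the estimate. *)
Let exponent_le N p q :
  - Rintegral leb2 Theta (fun x => V (combination z N p q x)) <=
  C' * (disc_area R + (lp_norm_pow p N + lp_norm_pow q N)).
Proof.
have mV : measurable_fun setT (fun x : plane => V (combination z N p q x)).
  by apply: (measurable_potential VG Gc); exact: mortho.
have iV : nu.-integrable setT (fun x => (V (combination z N p q x))%:E).
  apply: (@bounded_integrable _ _ _ nu _ (CV * (1 + (ortho_bnd p N ^+ 8 + ortho_bnd q N ^+ 8)))) => //.
  have p8 (y t : R) : `|y| <= t -> y ^+ 8 <= t ^+ 8.
    move=> yt; rewrite -[leLHS]ger0_norm ?exprn_even_ge0// normrX.
    by rewrite lerXn2r ?nnegrE// (le_trans _ yt).
  move=> x; apply: le_trans (V_le _) _; rewrite ler_wpM2l// lerD2l lerD//.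
    exact/p8/ortho_le.
  exact/p8/ortho_le.
rewrite (Rintegral_disc_leb mV).
have iVf := integrable_fin_num measurableT iV.
have i1 : nu.-integrable setT (fun x : plane => 1%:E).
  by apply: (@bounded_integrable _ _ _ nu (fun=> 1) 1) => // x; rewrite normr1.
have ig : nu.-integrable setT ((fun x : plane => 1%:E) \+ ((fun x => (`|ortho_sum (e z) N p x| `^ b)%:E)
    \+ (fun x => (`|ortho_sum (e z) N q x| `^ b)%:E)))%E.
  by apply: integrableD => //; apply: integrableD => //; exact: ipow.
have iC := integrableZl measurableT C' ig.
have iN := integrableZl measurableT (-1) iV.
have leN : (\int[nu]_x ((-1)%:E * (V (combination z N p q x))%:E) <=
    \int[nu]_x (C'%:E * (1 + ((`|ortho_sum (e z) N p x| `^ b)%:E +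
      (`|ortho_sum (e z) N q x| `^ b)%:E))))%E.
  apply: (le_integral _ iN iC) => // x _.
  by rewrite -!EFinD -!EFinM lee_fin mulN1r; exact: V_ge.
have E1 : (\int[nu]_x ((-1)%:E * (V (combination z N p q x))%:E) =
    (-1)%:E * \int[nu]_x (V (combination z N p q x))%:E)%E.
  exact: (integralZl measurableT iV).
have E2 : (\int[nu]_x (C'%:E * (1 + ((`|ortho_sum (e z) N p x| `^ b)%:E +
      (`|ortho_sum (e z) N q x| `^ b)%:E))) =
    (C' * (disc_area R + (lp_norm_pow p N + lp_norm_pow q N)))%:E)%E.
  have := integralZl measurableT ig C'; rewrite /= => ->.
  rewrite (integralD measurableT i1 (integrableD measurableT (ipow p N) (ipow q N))).
  rewrite (integralD measurableT (ipow p N) (ipow q N)).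
  rewrite -(integral_disc_leb (f := fun=> 1%E))//.
  rewrite integral_cst//; last exact: measurable_Theta.
  rewrite mul1e [X in (_ * (X + _))%E](_ : _ = (disc_area R)%:E)%E; last exact: leb2_ThetaE.
  have xE c : (\int[nu]_x (`|ortho_sum (e z) N c x| `^ b)%:E = (lp_norm_pow c N)%:E)%E.
    by rewrite /lp_norm_pow fineK//; exact: (integrable_fin_num measurableT (ipow c N)).
  by rewrite (xE p) (xE q) -(EFinD (lp_norm_pow p N)) -(EFinD (disc_area R)) -EFinM.
by move: leN; rewrite E1 E2 -[in X in (X <= _)%E -> _](fineK iVf) -EFinM lee_fin mulN1r.
Qed.

Let L2norm_combination N (p q : nat -> R) :
  L2norm (combination z N p q) ^+ 2 = \sum_(n < N) (p n ^+ 2 + q n ^+ 2).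
Proof.
rewrite /L2norm /Rintegral (combination_sq_integral Hz) /= sqr_sqrtr//.
by apply: sumr_ge0 => n _; rewrite addr_ge0// sqr_ge0.
Qed.

(** Where the cut-off is nonzero the L^2 norm is at most K, and its square is the sum of the
    energies of the two parts; hence each energy is at most K^2. *)
Lemma fdens_combination_le (t : R) N (p q : nat -> R) : 1 <= t ->
  fdens chi V (combination z N p q) `^ t <=
  M `^ t * expR (t * C' * disc_area R) *
   ((if \sum_(n < N) p n ^+ 2 <= K ^+ 2 then expR (2 * t * C' * lp_norm_pow p N) else 0) +
    (if \sum_(n < N) q n ^+ 2 <= K ^+ 2 then expR (2 * t * C' * lp_norm_pow q N) else 0)).
Proof.
move=> t1; have t0 : 0 < t by rewrite (lt_le_trans ltr01).
have [c0|c0] := eqVneq (chi (L2norm (combination z N p q))) 0.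
  rewrite /fdens c0 mul0r powR0 ?gt_eqF//.
  apply: mulr_ge0; first by rewrite mulr_ge0 ?powR_ge0 ?expR_ge0.
  by apply: addr_ge0; case: ifP => // _; exact: expR_ge0.
have L2K : \sum_(n < N) (p n ^+ 2 + q n ^+ 2) <= K ^+ 2.
  rewrite -L2norm_combination -(real_normK (num_real (L2norm _))).
  by rewrite lerXn2r ?nnegrE// chiK.
rewrite big_split/= in L2K.
have s0 (c : nat -> R) : 0 <= \sum_(n < N) c n ^+ 2 by apply: sumr_ge0 => n _; exact: sqr_ge0.
have hp : \sum_(n < N) p n ^+ 2 <= K ^+ 2 by apply: le_trans L2K; rewrite lerDl s0.
have hq : \sum_(n < N) q n ^+ 2 <= K ^+ 2 by apply: le_trans L2K; rewrite lerDr s0.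
rewrite hp hq.
apply: powR_exp_split => //; first by rewrite mulr_ge0 ?expR_ge0.
by rewrite /fdens ler_pM ?expR_ge0// ler_expR exponent_le.
Qed.

Lemma fdens_uniform_moment (t : R) : 1 <= t -> exists2 C, 0 <= C & forall N,
  (\int[P]_w (fdens chi V (combination z N (gauss_coef z h w) (gauss_coef z l w)) `^ t)%:E
    <= C%:E)%E.
Proof.
move=> t1; have t0 : 0 < t by rewrite (lt_le_trans ltr01).
have A0 : 0 <= 2 * t * C' by rewrite !mulr_ge0// ltW.
have K20 : 0 <= K ^+ 2 by exact: sqr_ge0.
have [Ch Ch0 ChP] := gauss_exponential_moment Hz mh lh ih b24 A0 K20.
have [Cl Cl0 ClP] := gauss_exponential_moment Hz ml ll il b24 A0 K20.
pose T : R := M `^ t * expR (t * C' * disc_area R).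
have T0 : 0 <= T by rewrite mulr_ge0 ?powR_ge0 ?expR_ge0.
exists (T * (Ch + Cl)) => [|N]; first by rewrite mulr_ge0// addr_ge0.
pose g (X : nat -> Omega -> R) w : R :=
  expR (2 * t * C' * fine (\int[nu]_x (`|ortho_sum (e z) N (gauss_coef z X w) x| `^ b)%:E)%E) *
  \1_[set w | \sum_(n < N) gauss_coef z X w n ^+ 2 <= K ^+ 2] w.
have g0 X w : 0 <= g X w by rewrite mulr_ge0 ?expR_ge0.
have mg X : (forall i, measurable_fun setT (X i)) -> measurable_fun setT (g X).
  move=> mX; have mc n : measurable_fun setT (fun w => gauss_coef z X w n).
    exact: measurable_gauss_coef.
  apply: measurable_funM.
    apply: (measurableT_comp (f := @expR R)); first exact: measurable_expR.
    apply: measurable_funM => //.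
    apply: (measurable_param_integral nu
      (F := fun p : plane * Omega => `|ortho_sum (e z) N (gauss_coef z X p.2) p.1| `^ b)).
    apply: (measurableT_comp (f := fun t : R => t `^ b)); first exact: measurable_powR.
    apply: measurableT_comp => //.
    exact: (measurable_combination_field z mc mc N).1.
  apply: measurable_indic.
  rewrite -[X in measurable X]setTI.
  rewrite (_ : [set w | _] = (fun w => \sum_(n < N) gauss_coef z X w n ^+ 2) @^-1` `]-oo, K ^+ 2]).
    have ms : measurable_fun setT (fun w => \sum_(n < N) gauss_coef z X w n ^+ 2).
      by apply: measurable_sum => n; exact: measurable_funX.
    exact: ms.
  by apply/seteqP; split => w /=; rewrite in_itv.
have mgh := mg _ mh; have mgl := mg _ ml.
apply: (@le_trans _ _ (\int[P]_w (T%:E * ((g h w)%:E + (g l w)%:E)))%E).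
  have mch n : measurable_fun setT (fun w => gauss_coef z h w n) by exact: measurable_gauss_coef.
  have mcl n : measurable_fun setT (fun w => gauss_coef z l w n) by exact: measurable_gauss_coef.
  have [mf1 mf2] := measurable_combination_field z mch mcl N.
  apply: ge0_le_integral => //.
  - by move=> w _; rewrite lee_fin powR_ge0.
  - apply: measurable_fun_EFin; apply: (measurableT_comp (f := fun y : R => y `^ t)).
      exact: measurable_powR.
    exact: (measurable_fdens (Y := fun w => combination z N (gauss_coef z h w) (gauss_coef z l w))
      mf1 mf2 VG Gc cchi).
  - by apply: emeasurable_funM => //; apply: emeasurable_funD; exact: measurable_fun_EFin.
  - move=> w _; rewrite -EFinD -EFinM lee_fin.
    have E X : g X w = if \sum_(n < N) gauss_coef z X w n ^+ 2 <= K ^+ 2 then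
        expR (2 * t * C' * lp_norm_pow (gauss_coef z X w) N) else 0.
      rewrite /g indicE; case: ifPn => hX.
        by rewrite mem_set// mulr1.
      by rewrite memNset ?mulr0//=; exact/negP.
    by rewrite !E; exact: fdens_combination_le.
rewrite ge0_integralZl//; last 2 first.
- by apply: emeasurable_funD; exact: measurable_fun_EFin.
- by move=> w _; rewrite -EFinD lee_fin addr_ge0.
rewrite ge0_integralD//; try by move=> w _; rewrite lee_fin.
- rewrite (EFinM T) (EFinD Ch) lee_wpmul2l// leeD//; [exact: ChP|exact: ClP].
- exact: measurable_fun_EFin.
- exact: measurable_fun_EFin.
Qed.

End UniformMoment.

Lemma integral_indic_mul (R : realType) d (T : measurableType d) (P : probability T R)
    (D : set T) (f : T -> R) :
  (\int[P]_(w in D) (f w)%:E = \int[P]_w (f w * \1_D w)%:E)%E.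
Proof.
rewrite integral_mkcond; apply: eq_integral => w _.
by rewrite patchE indicE; case: ifP => _; rewrite ?mulr1 ?mulr0.
Qed.

Lemma limn_esup_le (R : realType) (u : nat -> \bar R) C :
  (forall n, (u n <= C)%E) -> (limn_esup u <= C)%E.
Proof.
move=> uC; rewrite limn_esup_lim; apply: lime_le; first exact: is_cvg_esups.
by apply: nearW => n; apply: ge_ereal_sup => _ [m _ <-].
Qed.

Lemma cvg_exprn (R : realType) (u : nat -> R) (c : R) k :
  u @ \oo --> c -> (fun n => u n ^+ k) @ \oo --> c ^+ k.
Proof.
move=> uc; elim: k => [|k IHk]; first by under eq_fun do rewrite expr0; exact: cvg_cst.
by under eq_fun do rewrite exprS; rewrite exprS; exact: cvgM.
Qed.

(** * Integrability of the density and the two inequalities *)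

Section GibbsMeasure.
Variable R : realType.
Local Notation plane := (measurableTypeR R * measurableTypeR R)%type.
Local Notation nu := (@disc_leb R).
Variable z : nat -> R.
Hypothesis Hz : J0_zeros z.
Context d (Omega : measurableType d) (P : probability Omega R).
Variables h l : nat -> Omega -> R.
Hypotheses (mh : forall i, measurable_fun setT (h i))
  (lh : forall i B, measurable B -> P (h i @^-1` B) = normal_prob 0 1 B)
  (ih : mutually_independent P h).
Hypotheses (ml : forall i, measurable_fun setT (l i))
  (ll : forall i B, measurable B -> P (l i @^-1` B) = normal_prob 0 1 B)
  (il : mutually_independent P l).
Variables (V : R * R -> R) (G chi : R -> R).
Hypotheses (VG : forall p, V p = G (cmod p ^+ 2)) (Gc : continuous G)
  (cchi : continuous chi) (chi0 : forall x, 0 <= chi x).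
Variables (M K b C' CV : R).
Hypotheses (M0 : 0 <= M) (K0 : 0 <= K) (chiM : forall x, chi x <= M)
  (chiK : forall x, chi x != 0 -> `|x| <= K)
  (b24 : 2 < b < 4) (C'0 : 0 <= C')
  (V_ge : forall w, - V w <= C' * (1 + (`|w.1| `^ b + `|w.2| `^ b)))
  (CV0 : 0 <= CV) (V_le : forall w, `|V w| <= CV * (1 + (w.1 ^+ 8 + w.2 ^+ 8))).

Let A w := gauss_coef z h w.
Let B w := gauss_coef z l w.
Let field w := phi z h l w.
Let fieldE w : field w = series_limit z (A w) (B w). Proof. by []. Qed.
Let trunc N w := SN z N (field w).
Let f w := fdens chi V (field w).
Let fN N w := fdens chi V (trunc N w).

Let mA n : measurable_fun setT (A ^~ n). Proof. exact: measurable_gauss_coef. Qed.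
Let mB n : measurable_fun setT (B ^~ n). Proof. exact: measurable_gauss_coef. Qed.

Let mfield : measurable_fun setT (fun p : plane * Omega => (field p.2 p.1).1) /\
  measurable_fun setT (fun p : plane * Omega => (field p.2 p.1).2).
Proof. exact: (measurable_series_limit_field z mA mB). Qed.

Let mtrunc N : measurable_fun setT (fun p : plane * Omega => (trunc N p.2 p.1).1) /\
  measurable_fun setT (fun p : plane * Omega => (trunc N p.2 p.1).2).
Proof.
have mc n := measurable_field_coef z mfield.1 mfield.2 n.
exact: (measurable_combination_field z (fun n => (mc n).1) (fun n => (mc n).2) N).
Qed.

Lemma measurable_gibbs_density : measurable_fun setT f.
Proof. exact: (measurable_fdens mfield.1 mfield.2 VG Gc cchi). Qed.

Let mfN N : measurable_fun setT (fN N).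
Proof. exact: (measurable_fdens (mtrunc N).1 (mtrunc N).2 VG Gc cchi). Qed.

Let fdens_ge0 u : 0 <= fdens chi V u.
Proof. by rewrite mulr_ge0 ?expR_ge0. Qed.

Let good w := (\int[nu]_x pointwise_majorant z (A w) x < +oo)%E /\
  (\int[nu]_x pointwise_majorant z (B w) x < +oo)%E.

Let good_ae : {ae P, forall w, good w}.
Proof.
have h1 := pointwise_majorant_ae Hz mh lh ih.
have h2 := pointwise_majorant_ae Hz ml ll il.
by apply: filterS2 h1 h2 => w g1 g2; split; [exact: g1|exact: g2].
Qed.

Let trunc_good N w : good w -> trunc N w = combination z N (A w) (B w).
Proof. by move=> [g1 g2]; rewrite /trunc fieldE (SN_series_limit Hz g1 g2). Qed.

Let fN_cvg w : good w -> (fun N => fN N w) @ \oo --> f w.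
Proof.
move=> gw; rewrite (_ : (fun N => _) = fun N => fdens chi V (combination z N (A w) (B w))).
  by rewrite /f fieldE; case: gw => g1 g2; exact: (fdens_series_limit g1 g2 VG Gc cchi CV0 V_le).
by apply/funext => N; rewrite /fN trunc_good.
Qed.

Let moment (t : R) : 1 <= t -> exists2 C, 0 <= C & forall N,
  (\int[P]_w (fN N w `^ t)%:E <= C%:E)%E.
Proof.
move=> t1; have [C C0 CP] := fdens_uniform_moment Hz mh lh ih ml ll il VG Gc cchi chi0
  M0 K0 chiM chiK b24 C'0 V_ge CV0 V_le t1.
exists C; first exact: C0.
move=> N; suff -> : (\int[P]_w (fN N w `^ t)%:E =
    \int[P]_w (fdens chi V (combination z N (A w) (B w)) `^ t)%:E)%E by exact: CP.
have [mc1 mc2] := measurable_combination_field z mA mB N.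
have mp (g : Omega -> R) : measurable_fun setT g -> measurable_fun setT (fun w => (g w `^ t)%:E).
  move=> mg; apply: measurable_fun_EFin; apply: (measurableT_comp (f := fun y : R => y `^ t)) => //.
apply: ae_eq_integral => //.
- exact: mp.
- apply: mp.
  exact: (measurable_fdens (Y := fun w => combination z N (A w) (B w)) mc1 mc2 VG Gc cchi).
by apply: filterS good_ae => w gw _; rewrite /fN trunc_good.
Qed.

(** For an integer k >= p, convergence of the k-th powers is plain multiplication of limits, and f^p
    <= 1 + f^k concludes. *)
Lemma gibbs_density_Lp (p : R) : 1 <= p -> (\int[P]_w (f w `^ p)%:E < +oo)%E.
Proof.
move=> p1; pose k := (Num.truncn p).+1.
have pk : p <= k%:R by rewrite ltW// truncnS_gt.
have k1 : 1 <= k%:R :> R by rewrite ler1n.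
have [C C0 CP] := moment k1.
have mk : measurable_fun setT (fun w => (f w ^+ k)%:E).
  by apply: measurable_fun_EFin; apply: measurable_funX; exact: measurable_gibbs_density.
have fk : (\int[P]_w (f w ^+ k)%:E <= C%:E)%E.
  apply: le_trans (integral_le_limn_einf (Y := fun N w => fN N w ^+ k) _ _ _ _ _) _.
  - by move=> N; apply: measurable_funX; exact: mfN.
  - by move=> N w; rewrite exprn_ge0// fdens_ge0.
  - by apply: measurable_funX; exact: measurable_gibbs_density.
  - by move=> w; rewrite exprn_ge0// fdens_ge0.
  - apply: filterS good_ae => w gw _; exists (f w ^+ k) => //.
    exact: cvg_exprn (fN_cvg gw).
  apply: (le_trans (limn_einf_sup _)); apply: limn_esup_le => N.
  suff -> : (\int[P]_w (fN N w ^+ k)%:E = \int[P]_w (fN N w `^ k%:R)%:E)%E by exact: CP.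
  by apply: eq_integral => w _; rewrite powR_mulrn//; exact: fdens_ge0.
apply: (@le_lt_trans _ _ (\int[P]_w (1%:E + (f w ^+ k)%:E))%E).
  apply: ge0_le_integral => //.
  - by move=> w _; rewrite lee_fin powR_ge0.
  - apply: measurable_fun_EFin; apply: (measurableT_comp (f := fun y : R => y `^ p)) => //.
    exact: measurable_gibbs_density.
  - exact: emeasurable_funD.
  move=> w _; rewrite -EFinD lee_fin.
  have f0 : 0 <= f w by exact: fdens_ge0.
  have [f1|f1] := leP (f w) 1.
    apply: (@le_trans _ _ 1); last by rewrite lerDl exprn_ge0.
    apply: (@le_trans _ _ (1 `^ p)); last by rewrite powR1.
    by apply: ge0_ler_powR; rewrite ?nnegrE ?(le_trans _ p1).
  apply: (@le_trans _ _ (f w `^ k%:R)).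
    by apply: ler_powR => //; exact: ltW.
  by rewrite powR_mulrn// lerDr.
rewrite ge0_integralD//; last by move=> w _; rewrite lee_fin exprn_ge0// fdens_ge0.
rewrite integral_cst// lte_add_pinfty//.
  by rewrite [X in (_ * X)%E](_ : _ = 1%E) ?mule1 ?ltry//; exact: probability_setT.
by apply: le_lt_trans fk _; rewrite ltry.
Qed.

Section topology.
Variable sigma : R.
Hypothesis sigma12 : sigma < 1 / 2.

Let field_Hrad : {ae P, forall w, good w /\ Hrad z sigma (field w)}.
Proof.
have h1 := sobolev_sum_ae Hz mh lh sigma12.
have h2 := sobolev_sum_ae Hz ml ll sigma12.
apply: filterS3 good_ae h1 h2 => w gw s1 s2; split; first exact: gw.
rewrite fieldE; case: gw => g1 g2; apply: (series_limit_Hrad Hz g1 g2).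
under eq_eseriesr do rewrite mulrDr EFinD.
rewrite nneseriesD; first by rewrite lte_add_pinfty.
- by move=> n _ _; rewrite lee_fin mulr_ge0 ?powR_ge0 ?sqr_ge0.
- by move=> n _ _; rewrite lee_fin mulr_ge0 ?powR_ge0 ?sqr_ge0.
Qed.

Let mopen W : openH z sigma W -> measurable [set w | Hrad z sigma (field w)] /\
  measurable [set w | W (field w)].
Proof.
apply: (measurable_field_openH mfield.1 mfield.2 Hz) => w.
rewrite fieldE; exact: radial_series_limit.
Qed.

Let mopenN W N : openH z sigma W -> measurable [set w | W (trunc N w)].
Proof.
move=> Wo; apply: (measurable_field_openH (mtrunc N).1 (mtrunc N).2 Hz _ Wo).2 => w.
by have [_ r _ _] := SN_Hrad Hz sigma N (field w).
Qed.

Let rhoE U : rho P z h l chi V U = (\int[P]_w (f w * \1_[set w | U (field w)] w)%:E)%E.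
Proof. exact: integral_indic_mul. Qed.

Let rhoNE U N : rhoN P z h l chi V N (U `&` EN z N) =
  (\int[P]_w (fN N w * \1_[set w | U (trunc N w)] w)%:E)%E.
Proof.
rewrite /rhoN integral_indic_mul; apply: eq_integral => w _; congr (_ * \1_ _ _)%:E.
by apply/seteqP; split => v /=; [case|split => //; exact: SN_EN].
Qed.

Let mulind_ge0 u (D : set Omega) w : 0 <= fdens chi V u * \1_D w.
Proof. by rewrite mulr_ge0. Qed.

(** If the sample lies in U, so do its truncations from some rank on, hence the integrands converge
    to f there; elsewhere the integrand on the left is 0. *)
Lemma gibbs_open U : openH z sigma U ->
  (rho P z h l chi V U <= limn_einf (fun N => rhoN P z h l chi V N (U `&` EN z N)))%E.
Proof.
move=> Uo; rewrite rhoE (_ : (fun N => rhoN _ _ _ _ _ _ _ _) =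
  (fun N => \int[P]_w (fN N w * \1_[set w | U (trunc N w)] w)%:E)%E); last first.
  by apply/funext => N; exact: rhoNE.
apply: (integral_le_limn_einf (Y := fun N w => fN N w * \1_[set w | U (trunc N w)] w)).
- by move=> N; apply: measurable_funM => //; apply: measurable_indic; exact: mopenN.
- by move=> N w; exact: mulind_ge0.
- apply: measurable_funM; first exact: measurable_gibbs_density.
  by apply: measurable_indic; exact: (mopen Uo).2.
- by move=> w; exact: mulind_ge0.
apply: filterS good_ae => w gw; rewrite indicE.
have [|_] := boolP (w \in [set w | U (field w)]); last by rewrite mulr0 ltxx.
rewrite inE/= => Uw _; exists (f w); first by rewrite mulr1.
apply: cvg_trans (fN_cvg gw); apply: near_eq_cvg.
apply: filterS (openH_SN Hz Uo Uw) => N UN.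
by rewrite indicE mem_set// mulr1.
Qed.

Lemma gibbs_closed F : closedH z sigma F ->
  (limn_esup (fun N => rhoN P z h l chi V N (F `&` EN z N)) <= rho P z h l chi V F)%E.
Proof.
move=> [FH Wo]; rewrite rhoE (_ : (fun N => rhoN _ _ _ _ _ _ _ _) =
  (fun N => \int[P]_w (fN N w * \1_[set w | F (trunc N w)] w)%:E)%E); last first.
  by apply/funext => N; exact: rhoNE.
(* The sample may fail to lie in the Sobolev space, so the complement is taken inside it;
   truncations always lie in it, and a plain complement works for them. *)
have mF : measurable [set w | F (field w)].
  have [m1 m2] := mopen Wo.
  rewrite (_ : [set w | _] = [set w | Hrad z sigma (field w)] `\`
      [set w | (Hrad z sigma `\` F) (field w)]); first exact: measurableD.
  apply/seteqP; split => w /=; first by move=> Fw; split; [exact: FH|case].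
  by move=> [Hw nW]; apply: contrapT => nF; exact: nW.
have mFN N : measurable [set w | F (trunc N w)].
  rewrite (_ : [set w | _] = ~` [set w | (Hrad z sigma `\` F) (trunc N w)]).
    by apply: measurableC; exact: mopenN.
  apply/seteqP; split => w /=; first by move=> Fw [].
  by move=> nW; apply: contrapT => nF; apply: nW; split => //; exact: SN_Hrad.
have two : 1 <= 2 :> R by rewrite ler1n.
have [C C0 CP] := moment two.
apply: (limn_esup_integral_le (Y := fun N w => fN N w * \1_[set w | F (trunc N w)] w) (C := C)).
- by move=> N; apply: measurable_funM => //; apply: measurable_indic; exact: mFN.
- by move=> N w; exact: mulind_ge0.
- apply: measurable_funM; first exact: measurable_gibbs_density.
  exact: measurable_indic.
- by move=> w; exact: mulind_ge0.
- move=> N; apply: le_trans (CP N); apply: ge0_le_integral => //.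
  + by move=> w _; rewrite lee_fin sqr_ge0.
  + apply: measurable_fun_EFin; apply: measurable_funX; exact: measurable_funM.
  + apply: measurable_fun_EFin; apply: (measurableT_comp (f := fun y : R => y `^ 2)).
      exact: measurable_powR.
    exact: mfN.
  move=> w _; rewrite lee_fin powR_mulrn ?fdens_ge0//.
  by rewrite exprMn ler_piMr ?sqr_ge0.
apply: filterS field_Hrad => w [gw Hw].
(* On F the excess is at most |f_N - f|, whatever the truncations do. Off F the complement is open,
   so the truncations eventually leave F and the excess is 0. *)
have [Fw|nF] := pselect (F (field w)).
  rewrite indicE mem_set// mulr1.
  have cn : (fun N => `|fN N w - f w|) @ \oo --> 0.
    have -> : 0 = `|f w - f w| by rewrite subrr normr0.
    by apply: cvg_norm; apply: cvgB; [exact: fN_cvg|exact: cvg_cst].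
  apply: (squeeze_cvgr _ (cvg_cst 0) cn); apply: nearW => N.
  rewrite le_max lexx orbT/= ge_max normr_ge0 andbT.
  apply: le_trans (ler_norm (fN N w - f w)); rewrite lerD2r.
  by rewrite ler_piMr ?fdens_ge0.
have -> : \1_[set w0 | F (field w0)] w = 0 :> R by rewrite indicE memNset.
rewrite mulr0.
apply: cvg_near_cst.
apply: filterS (openH_SN Hz Wo (conj Hw nF)) => N [_ nFN].
by rewrite indicE memNset// mulr0 subrr maxxx.
Qed.

End topology.

End GibbsMeasure.

Theorem theorem2 (R : realType) (z : nat -> R) (alpha beta s : R)
  (V : R * R -> R) (G : R -> R) (chi : R -> R)
  (d : measure_display) (Omega : measurableType d) (P : probability Omega R)
  (h l : nat -> Omega -> R) :
  J0_zeros z ->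
  (* V : C -> R smooth, V(z) = G(|z|^2) with G smooth *)
  smooth2 V -> smooth1 G -> (forall w, V w = G (cmod w ^+ 2)) ->
  (* (i) *)
  0 < alpha < 4 ->
  (forall k1 k2 : nat, exists C : R, forall w : R * R,
     cmod (wirt k1 k2 V w) <= C * (1 + cmod w) `^ (2 + alpha - k1%:R - k2%:R)) ->
  (* (ii) *)
  2 <= beta < 4 ->
  (exists2 C : R, 0 < C & forall w : R * R, - (C * (1 + cmod w) `^ beta) <= V w) ->
  (* choice of s *)
  Num.max (1 / 3) (Num.max (1 - 2 / alpha) (1 - 2 / beta)) < s < 1 / 2 ->
  (* chi *)
  continuous chi -> (forall x, 0 <= chi x) ->
  compact (closure [set x | chi x != 0]) ->
  (* the Gaussians *)
  iid_std_gaussians P h l ->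
  (forall p : R, 1 <= p ->
     measurable_fun setT (fun w => fdens chi V (phi z h l w)) /\
     (\int[P]_w ((fdens chi V (phi z h l w)) `^ p)%:E < +oo)%E) /\
  (forall sigma : R, s <= sigma < 1 / 2 ->
     (forall U, openH z sigma U ->
        (rho P z h l chi V U <=
         limn_einf (fun N => rhoN P z h l chi V N (U `&` EN z N)))%E) /\
     (forall F, closedH z sigma F ->
        (limn_esup (fun N => rhoN P z h l chi V N (F `&` EN z N)) <=
         rho P z h l chi V F)%E)).
Proof.
move=> Hz _ sG VG /andP[_ a4] VC /andP[_ b4] [CL CL0 VL] _ cchi chi0 cS [mX lX iX].
have Gc : continuous G.
  move=> x; apply: differentiable_continuous.
  by apply/derivable1_diffP; exact: (sG 0%N x).
have [M [K [M0 K0 chiM chiK]]] := compact_support_bounded cchi chi0 cS.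
(* At order zero [wirt] is V itself, so this is a bound of |V| by the power 2 + alpha. *)
have [C VC0] := VC 0%N 0%N.
have [CV CV0 V_le] := potential_growth a4 VC0.
have [b [C' [b24 C'0 V_ge]]] := potential_below b4 CL0 VL.
have mh i : measurable_fun setT (h i) := mX (true, i).
have ml i : measurable_fun setT (l i) := mX (false, i).
have lh i B : measurable B -> P (h i @^-1` B) = normal_prob 0 1 B := lX (true, i) B.
have ll i B : measurable B -> P (l i @^-1` B) = normal_prob 0 1 B := lX (false, i) B.
have ih : mutually_independent P h.
  exact: (@mutually_independent_reindex _ _ _ _ nat _ _ (pair true) snd (fun=> erefl) iX).
have il : mutually_independent P l.
  exact: (@mutually_independent_reindex _ _ _ _ nat _ _ (pair false) snd (fun=> erefl) iX).
split=> [p p1|sigma /andP[_ s12]].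
  split; first exact: (measurable_gibbs_density z mh ml VG Gc cchi).
  exact: (gibbs_density_Lp Hz mh lh ih ml ll il VG Gc cchi chi0 M0 K0 chiM chiK b24 C'0
    V_ge CV0 V_le p1).
split=> [U Uo|F Fc].
  exact: (gibbs_open Hz mh lh ih ml ll il VG Gc cchi chi0 CV0 V_le Uo).
exact: (gibbs_closed Hz mh lh ih ml ll il VG Gc cchi chi0 M0 K0 chiM chiK b24 C'0
  V_ge CV0 V_le s12 Fc).
Qed.
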